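(* Let $d\ge1$, $R>0$, $0<U<1$. The process $(X_t)_{t\ge0}$ constructed in the context from the Markov chain $(Y_n)_{n\ge0}$ (started from $Y_0=f\in\mathcal{S}_c$) and the jump times $(T_n)_{n\ge0}$ is a non-explosive $\mathcal{S}_c$-valued continuous-time Markov chain (non-explosive meaning $\mathbb{P}[T_n\to\infty\text{ as }n\to\infty]=1$). Moreover, its generator is given, for every $n\ge1$, every $\psi:(\mathbb{R}^d)^n\to\mathbb{R}$ with $\int|\psi|\,dx_1\cdots dx_n<\infty$ and every $f\in\mathcal{S}_c$, by $$\mathcal{L} I_n(f;\psi)=\int_{\mathbb{R}^d}\int_{(\mathbb{R}^d)^n}\sum_{I\subset\{1,\dots,n\}}\Big(\prod_{j\notin I}\mathbf{1}_{x_j\notin B(c,R)}f(x_j)\Big)\Big(\prod_{i\in I}\mathbf{1}_{x_i\in B(c,R)}\Big)\Big[f(c)\Big(\prod_{i\in I}\big((1-U)f(x_i)+U\big)-\prod_{i\in I}f(x_i)\Big)+(1-f(c))\Big(\prod_{i\in I}(1-U)f(x_i)-\prod_{i\in I}f(x_i)\Big)\Big]\psi(x_1,\dots,x_n)\,dx_1\cdots dx_n\,dc .$$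
   Context: $|A|$ is the Lebesgue measure of $A\subset\mathbb{R}^d$, $B(c,r)=\{y\in\mathbb{R}^d:\|y-c\|\le r\}$ (Euclidean norm), $\delta_A$ denotes the indicator function of the set $A$, and $\mathrm{Supp}(f)$ is the support of $f$. $A^R:=\{x\in\mathbb{R}^d:\min_{y\in A}\|x-y\|\le R\}$. $\mathcal{S}_c$ is the set of Borel measurable functions $f:\mathbb{R}^d\to[0,1]$ with compact support. The chain: given $Y_0$ (an element of $\mathcal{S}_c$), set $\Delta_0=\mathrm{Supp}(Y_0)$, and recursively for $n\ge0$ let $\mathcal{P}_n=\sigma(C_1,\dots,C_n,V_1,\dots,V_n,Y_0,\dots,Y_n)$ (so $\mathcal{P}_0=\sigma(Y_0)$). Conditionally on $\mathcal{P}_n$, $C_{n+1}$ is uniform on $\Delta_n^R$; $V_{n+1}$ is uniform on $[0,1]$, independent of $\mathcal{P}_n$ and $C_{n+1}$; $\varepsilon_{n+1}:=\mathbf{1}_{\{V_{n+1}\le Y_n(C_{n+1})\}}$; $$Y_{n+1}(\cdot)=Y_n(\cdot)+U\,\delta_{B(C_{n+1},R)}(\cdot)\big(\varepsilon_{n+1}-Y_n(\cdot)\big),\qquad \Delta_{n+1}=\mathrm{Supp}(Y_{n+1}).$$ In the degenerate case $Y_n\equiv0$ (where $\Delta_n^R=\emptyset$), $C_{n+1}$ is an arbitrary fixed point, $\varepsilon_{n+1}=0$ and $Y_{n+1}\equiv0$. Continuous-time process: let $(E_1,E_2,\dots)$ be i.i.d. Exp(1) random variables, independent of the chain. Set $T_0=0$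 and $T_n=\frac{E_1}{\lambda(Y_0)}+\dots+\frac{E_n}{\lambda(Y_{n-1})}$ for $n\ge1$, where $\lambda(f):=|(\mathrm{Supp}(f))^R|$ for $f\in\mathcal{S}_c$ (with $E/0=+\infty$). Define $X_t=Y_n$ for $t\in[T_n,T_{n+1})$, $n\ge0$. Test functions and generator: $I_n(f;\psi)=\int_{(\mathbb{R}^d)^n}\psi(x_1,\dots,x_n)\prod_{i=1}^nf(x_i)\,dx_1\cdots dx_n$, and $\mathcal{L}I(f)=\lim_{t\to0}\mathbb{E}[I(X_t)-I(X_0)\mid X_0=f]/t$. *)

(* Defs.v *)
From HB Require Import structures.
From mathcomp Require Import all_boot all_order all_algebra.
From mathcomp Require Import all_classical all_reals all_analysis.
From mathcomp Require Import measurable_realfun.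

Set Implicit Arguments.
Unset Strict Implicit.
Unset Printing Implicit Defensive.

Import Order.TTheory GRing.Theory Num.Theory.
Import numFieldNormedType.Exports.

Local Open Scope classical_set_scope.
Local Open Scope ring_scope.

Section sigma_finite_transport.
Context d1 d2 (T1 : measurableType d1) (T2 : measurableType d2) (R : realType).
Variable m : {measure set T1 -> \bar R}.
Hypothesis m_sigma_finite : sigma_finite setT m.
Variables (f : T1 -> T2) (g : T2 -> T1).
Hypotheses (mf : measurable_fun setT f) (mg : measurable_fun setT g).
Hypothesis fK : cancel f g.

Let nu (A : set T2) := m (f @^-1` A).

Let mpre A : measurable A -> measurable (f @^-1` A).
Proof. by move=> mA; rewrite -[X in measurable X]setTI; exact: mf. Qed.

Let nu0 : nu set0 = 0%E. Proof. by rewrite /nu preimage_set0 measure0. Qed.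

Let nu_ge0 A : (0 <= nu A)%E. Proof. exact: measure_ge0. Qed.

Let nu_sigma_additive : semi_sigma_additive nu.
Proof.
move=> F mF tF mUF; rewrite /nu preimage_bigcup.
apply: measure_semi_sigma_additive.
- by move=> n; exact: mpre.
- apply/trivIsetP => /= i j _ _ ij; rewrite -preimage_setI.
  by move/trivIsetP : tF => /(_ _ _ _ _ ij) ->//; rewrite preimage_set0.
- by rewrite -preimage_bigcup; exact: mpre.
Qed.

HB.instance Definition _ := isMeasure.Build _ _ _ nu nu0 nu_ge0 nu_sigma_additive.

Let nu_sigma_finite : sigma_finite setT nu.
Proof.
have [F TF Foo] := m_sigma_finite.
exists (fun n => g @^-1` F n).
  by rewrite -preimage_bigcup -TF preimage_setT.
move=> n; have [mFn Fnoo] := Foo n; split.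
  by rewrite -[X in measurable X]setTI; exact: mg.
rewrite /nu -comp_preimage (_ : g \o f = id) ?preimage_id//.
by apply/funext => x /=; rewrite fK.
Qed.

HB.instance Definition _ := Measure_isSigmaFinite.Build _ _ _ nu nu_sigma_finite.

Lemma sigma_finite_transport :
  exists m' : {sigma_finite_measure set T2 -> \bar R},
    (m' : set T2 -> \bar R) = pushforward m f.
Proof. by exists nu. Qed.

End sigma_finite_transport.

Section power_measure.
Context {R : realType} {dT : measure_display} {T : measurableType dT}.
Variable mu : {sigma_finite_measure set T -> \bar R}.

(* The product measure [mu \x ... \x mu] on [n.-tuple T], by iterated
   integration over the successive coordinates. *)
Fixpoint power_measure (n : nat) : set (n.-tuple T) -> \bar R :=
  match n with
  | 0 => fun A => \d_([tuple] : 0.-tuple T) A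
  | m.+1 => fun A =>
      (\int[mu]_x power_measure [set t : m.-tuple T | A [tuple of x :: t]])%E
  end.

Let power_measure_ex n : exists m : {sigma_finite_measure set n.-tuple T -> \bar R},
  (m : set _ -> \bar R) = @power_measure n.
Proof.
elim: n => [|n [m IH]].
  by exists \d_([tuple] : 0.-tuple T).
pose c (p : T * n.-tuple T) : n.+1.-tuple T := [tuple of p.1 :: p.2].
pose u (t : n.+1.-tuple T) : T * n.-tuple T := (thead t, [tuple of behead t]).
have mc : measurable_fun setT c by exact: measurable_cons.
have mu' : measurable_fun setT u.
  apply: measurable_fun_pair; first exact: measurable_tnth.
  exact: measurable_behead.
have cK : cancel c u.
  by move=> [x t]; rewrite /u /c /= theadE; congr pair; exact: val_inj.
have sf : sigma_finite setT (mu \x m)%E.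
  have /sigma_finiteP[F [TF ndF Foo]] := sigma_finiteT mu.
  have /sigma_finiteP[G [TG ndG Goo]] := sigma_finiteT m.
  exists (fun k => F k `*` G k).
    rewrite -setXTT TF TG predeqE => -[x y]; split.
      move=> [/= [k _ Fkx] [l _ Gly]]; exists (maxn k l) => //; split.
      - by move: x Fkx; exact/subsetPset/ndF/leq_maxl.
      - by move: y Gly; exact/subsetPset/ndG/leq_maxr.
    by move=> [k _ []/= ? ?]; split; exists k.
  move=> k; have [? ?] := Foo k; have [? ?] := Goo k.
  split; first exact: measurableX.
  by rewrite product_measure1E// lte_mul_pinfty// ge0_fin_numE.
have [m' m'E] := sigma_finite_transport sf mc mu' cK.
exists m'; rewrite m'E; apply/funext => A /=.
rewrite /pushforward /product_measure1 -IH.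
by apply: eq_integral => x _ /=; rewrite xsectionE.
Qed.

Let power_measure0 n : @power_measure n set0 = 0%E.
Proof. by have [m <-] := power_measure_ex n; exact: measure0. Qed.

Let power_measure_ge0 n A : (0 <= @power_measure n A)%E.
Proof. by have [m <-] := power_measure_ex n; exact: measure_ge0. Qed.

Let power_measure_sigma_additive n : semi_sigma_additive (@power_measure n).
Proof.
by have [m <-] := power_measure_ex n; exact: measure_semi_sigma_additive.
Qed.

HB.instance Definition _ n := isMeasure.Build _ _ _ (@power_measure n)
  (@power_measure0 n) (@power_measure_ge0 n) (@power_measure_sigma_additive n).

Let power_measure_sigma_finite n : sigma_finite setT (@power_measure n).
Proof. by have [m <-] := power_measure_ex n; exact: sigma_finiteT. Qed.

HB.instance Definition _ n := Measure_isSigmaFinite.Build _ _ _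
  (@power_measure n) (@power_measure_sigma_finite n).

End power_measure.

Section borel_rV.
Context {R : realType} {d : nat}.

Let borel0 : <<s @open 'rV[R]_d >> set0.
Proof. exact: sigma_algebra0. Qed.

Let borelC A : <<s @open 'rV[R]_d >> A -> <<s @open 'rV[R]_d >> (~` A).
Proof. exact: sigma_algebraC. Qed.

Let borel_bigcup (F : (set 'rV[R]_d)^nat) :
  (forall i, <<s @open 'rV[R]_d >> (F i)) ->
  <<s @open 'rV[R]_d >> (\bigcup_i F i).
Proof. exact: sigma_algebra_bigcup. Qed.

HB.instance Definition _ := @isMeasurable.Build (sigma_display (@open 'rV[R]_d))
  'rV[R]_d (<<s @open 'rV[R]_d >>) borel0 borelC borel_bigcup.

Lemma open_measurable_rV (A : set 'rV[R]_d) : open A -> measurable A.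
Proof. exact: sub_sigma_algebra. Qed.

Lemma closed_measurable_rV (A : set 'rV[R]_d) : closed A -> measurable A.
Proof.
move=> cA; rewrite -[A]setCK; apply: measurableC.
by apply: open_measurable_rV; exact: closed_openC.
Qed.

Lemma continuous_measurable_rV (f : 'rV[R]_d -> R) :
  continuous f -> measurable_fun setT f.
Proof.
move=> /continuousP cf; apply: (measurability _ (RGenOpens.measurableE R)).
move=> _ [_ [a [b ->] <-]]; rewrite setTI; apply: open_measurable_rV.
exact/cf/interval_open.
Qed.

Definition rV_of_tuple (t : d.-tuple R) : 'rV[R]_d := \row_i tnth t i.

Definition tuple_of_rV (x : 'rV[R]_d) : d.-tuple R := [tuple x ord0 i | i < d].

Lemma rV_of_tupleK : cancel rV_of_tuple tuple_of_rV.
Proof. by move=> t; apply/eq_from_tnth => i; rewrite tnth_mktuple mxE. Qed.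

Lemma measurable_tuple_of_rV : measurable_fun setT tuple_of_rV.
Proof.
apply/measurable_fun_tnthP => i.
rewrite (_ : _ \o _ = fun x : 'rV[R]_d => x ord0 i); last first.
  by apply/funext => x /=; rewrite tnth_mktuple.
by apply: continuous_measurable_rV; exact: coord_continuous.
Qed.

Lemma measurable_rV_of_tuple : measurable_fun setT rV_of_tuple.
Proof.
apply: (@measurability _ _ _ _ _ _ (@open 'rV[R]_d)) => //.
move=> _ [A oA <-]; rewrite setTI.
pose box (q : ('rV[rat]_d * nat)%type) : set 'rV[R]_d :=
  [set x | forall i, `|x ord0 i - ratr (q.1 ord0 i)| < q.2.+1%:R^-1].
pose F (q : ('rV[rat]_d * nat)%type) : set (d.-tuple R) :=
  if `[< box q `<=` A >] then rV_of_tuple @^-1` box q else set0.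
rewrite (_ : _ @^-1` _ = \bigcup_q F q); last first.
  apply/seteqP; split => [t /= At|t [q _]]; last first.
    by rewrite /F; case: ifPn => // /asboolP qA /qA.
  have /nbhs_ballP[e /= e0 eA] : nbhs (rV_of_tuple t) A by exact: open_nbhs_nbhs.
  have [k ke] : exists k : nat, k.+1%:R^-1 < e / 2.
    have [k _ /(_ _ (leqnn _)) /= kP] := near_infty_natSinv_lt (PosNum (divr_gt0 e0 (ltr0Sn _ 1))).
    by exists k.
  have k0 : 0 < k.+1%:R^-1 :> R by rewrite invr_gt0.
  have /choice[q qP] : forall i : 'I_d, exists q : rat,
      `|tnth t i - ratr q| < k.+1%:R^-1.
    move=> i; have [q] := @rat_in_itvoo R (tnth t i - k.+1%:R^-1) (tnth t i) ltac:(by rewrite ltrBlDr ltrDl).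
    rewrite in_itv/= => /andP[q1 q2]; exists q.
    by rewrite gtr0_norm ?subr_gt0// ltrBlDr addrC -ltrBlDr.
  have sub : box (\row_i q i, k) `<=` A.
    move=> x bx; apply: eA; split => // i j; rewrite (ord1 i) /ball/= /ball_ mxE.
    have := bx j; rewrite /= mxE => bxj.
    rewrite -(subrKA (ratr (q j))) (le_lt_trans (ler_normD _ _))//.
    rewrite [e]splitr ltrD//; first exact: lt_trans (qP j) ke.
    by rewrite distrC; exact: lt_trans bxj ke.
  exists (\row_i q i, k) => //; rewrite /F; case: ifPn => [_|/asboolP//].
  by move=> i /=; rewrite !mxE.
apply: countable_bigcupT_measurable => // q.
rewrite /F; case: ifPn => // _.
rewrite (_ : _ @^-1` _ = \bigcap_(i : 'I_d)
  ((fun t : d.-tuple R => tnth t i) @^-1`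
    [set y | `|y - ratr (q.1 ord0 i)| < q.2.+1%:R^-1])); last first.
  apply/seteqP; split => [t /= tq i _ /=|t tq i].
    by have := tq i; rewrite mxE.
  by rewrite mxE; exact: tq.
apply: fin_bigcap_measurable; first exact: finite_finset.
move=> i _; rewrite -[X in measurable X]setTI; apply: measurable_tnth => //.
have -> : [set y : R | `|y - ratr (q.1 ord0 i)| < q.2.+1%:R^-1] =
    ball (ratr (q.1 ord0 i) : R) (q.2.+1%:R^-1 : R).
  by apply/seteqP; split => y /=; rewrite /ball/= distrC.
exact: measurable_ball.
Qed.

End borel_rV.

Section lebesgue_rV.
Context {R : realType} {d : nat}.

(* Lebesgue measure on [R^d], represented by the row vectors ['rV[R]_d] with
   their library topology and Borel sigma-algebra. *)
Definition lebesgue_rV : set 'rV[R]_d -> \bar R :=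
  pushforward (power_measure (@lebesgue_measure R) (n:=d)) (@rV_of_tuple R d).

Let lebesgue_rV_ex : exists m : {sigma_finite_measure set 'rV[R]_d -> \bar R},
  (m : set _ -> \bar R) = lebesgue_rV.
Proof.
have sf : sigma_finite setT (power_measure (@lebesgue_measure R) (n:=d)).
  exact: sigma_finiteT.
exact: (sigma_finite_transport sf measurable_rV_of_tuple
  measurable_tuple_of_rV (@rV_of_tupleK R d)).
Qed.

Let lebesgue_rV0 : lebesgue_rV set0 = 0%E.
Proof. by have [m <-] := lebesgue_rV_ex; exact: measure0. Qed.

Let lebesgue_rV_ge0 A : (0 <= lebesgue_rV A)%E.
Proof. by have [m <-] := lebesgue_rV_ex; exact: measure_ge0. Qed.

Let lebesgue_rV_sigma_additive : semi_sigma_additive lebesgue_rV.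
Proof.
by have [m <-] := lebesgue_rV_ex; exact: measure_semi_sigma_additive.
Qed.

HB.instance Definition _ := isMeasure.Build _ _ _ lebesgue_rV
  lebesgue_rV0 lebesgue_rV_ge0 lebesgue_rV_sigma_additive.

Let lebesgue_rV_sigma_finite : sigma_finite setT lebesgue_rV.
Proof. by have [m <-] := lebesgue_rV_ex; exact: sigma_finiteT. Qed.

HB.instance Definition _ := Measure_isSigmaFinite.Build _ _ _ lebesgue_rV
  lebesgue_rV_sigma_finite.

End lebesgue_rV.

Section probability_notions.
Context {R : realType} {dO : measure_display} {Omega : measurableType dO}.
Variable P : probability Omega R.

(* [q] is a version of the conditional probability of [A] given [F]. *)
Definition cond_prob (F : set (set Omega)) (A : set Omega) (q : Omega -> \bar R) :=
  (forall B : set \bar R, measurable B -> F (q @^-1` B)) /\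
  (forall G, F G -> P (G `&` A) = (\int[P]_(w in G) q w)%E).

Definition independent_classes (F G : set (set Omega)) :=
  forall A B, F A -> G B -> P (A `&` B) = (P A * P B)%E.

Definition independent_seq (E : nat -> Omega -> R) :=
  forall (N : nat) (B : nat -> set R), (forall i, measurable (B i)) ->
    P (\bigcap_(i in `I_N) (E i @^-1` B i)) = (\prod_(i < N) P (E i @^-1` B i))%E.

(* The natural filtration of a process indexed by [0, +oo[. *)
Definition natural_filtration {dS} {S : measurableType dS}
    (X : R -> Omega -> S) (s : R) : set (set Omega) :=
  <<s [set G | exists u A, [/\ 0 <= u <= s, measurable A & G = X u @^-1` A]] >>.

(* Continuous-time (time-homogeneous) Markov chain with transition
   probabilities [p]: the Markov property with respect to the natural
   filtration, the sample paths being right-continuous step functions. *)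
Definition markov_chain {dS} {S : measurableType dS}
    (p : R -> R.-pker S ~> S) (X : R -> Omega -> S) :=
  [/\ forall t, 0 <= t -> measurable_fun setT (X t),
      forall s t A, 0 <= s -> 0 <= t -> measurable A ->
        cond_prob (natural_filtration X s) (X (s + t) @^-1` A)
          (fun w => p t (X s w) A) &
      {ae P, forall w t, 0 <= t -> \forall u \near t^'+, X u w = X t w}].

End probability_notions.

Section model.
Context {R : realType} {d : nat}.
Implicit Types (f g : 'rV[R]_d -> R) (A : set 'rV[R]_d).

Definition enorm (x : 'rV[R]_d) : R := Num.sqrt (\sum_i x ord0 i ^+ 2).

Definition eball (c : 'rV[R]_d) (r : R) : set 'rV[R]_d :=
  [set y | enorm (y - c) <= r].

Definition supp f : set 'rV[R]_d := closure [set x | f x != 0].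

Definition Sc f : Prop :=
  [/\ measurable_fun setT f, forall x, 0 <= f x <= 1 & compact (supp f)].

(* [A^r]; the minimum in [min_{y in A} |x - y| <= r] is attained when [A] is
   compact, and [A^r] is empty when [A] is. *)
Definition fatten A (r : R) : set 'rV[R]_d :=
  [set x | exists2 y, A y & enorm (x - y) <= r].

Definition uniform_on A (B : set 'rV[R]_d) : \bar R :=
  ((fine (lebesgue_rV A))^-1%:E * lebesgue_rV (B `&` A))%E.

Definition test_fun (n : nat) (psi : n.-tuple 'rV[R]_d -> R) f : R :=
  \int[power_measure (@lebesgue_rV R d) (n:=n)]_x
    (psi x * \prod_(i < n) f (tnth x i)).

Variables rad U : R.

Definition rate f : \bar R := lebesgue_rV (fatten (supp f) rad).

Definition update f (c : 'rV[R]_d) (e : bool) : 'rV[R]_d -> R :=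
  fun x => f x + U * \1_(eball c rad) x * (e%:R - f x).

Definition updates (n : nat) f (c : n.-tuple 'rV[R]_d) (e : n.-tuple bool) :=
  foldl (fun g ce => update g ce.1 ce.2) f (zip c e).

(* The sigma-algebra carried by the state space: the largest one for which the
   state reached from any [f] in [Sc] after finitely many updates is a
   measurable function of their centres. It contains the product sigma-algebra
   ([measurable_eval] below), and, unlike the latter, makes [f |-> rate f]
   measurable on [Sc], as is needed for measurable transition kernels. The
   carrier is the whole function space, but only its trace on [Sc] is
   constrained. *)
Definition state_events : set (set ('rV[R]_d -> R)) :=
  [set A | forall f, Sc f -> forall n (e : n.-tuple bool),
     measurable [set c : n.-tuple 'rV[R]_d | A (updates f c e)]].

Definition state := g_sigma_algebraType state_events.

Lemma state_events_sigma_algebra : sigma_algebra setT state_events.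
Proof.
split.
- move=> f _ n e.
  exact: measurable0.
- move=> A mA f fS n e; rewrite setTD.
  by apply: measurableC; exact: mA.
- move=> F mF f fS n e.
  by apply: bigcupT_measurable => i; exact: mF.
Qed.

Lemma measurable_stateE : @measurable _ state = state_events.
Proof. exact/sigma_algebra_id/state_events_sigma_algebra. Qed.

Let measurable_enormB (x : 'rV[R]_d) :
  measurable_fun setT (fun c : 'rV[R]_d => enorm (x - c)).
Proof.
apply: (@measurableT_comp _ _ _ _ _ _ (@Num.sqrt R) _
    (fun c : 'rV[R]_d => \sum_i (x - c) ord0 i ^+ 2)).
  by apply: continuous_measurable_fun; exact: sqrt_continuous.
apply: measurable_sum => i; apply: measurable_funX.
rewrite (_ : (fun _ => _) = fun c : 'rV[R]_d => x ord0 i - c ord0 i).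
  apply: measurable_funB => //.
  apply: continuous_measurable_rV => c.
  exact: (@coord_continuous R 1 d ord0 i c).
by apply/funext => c; rewrite !mxE.
Qed.

Let measurable_updates (x : 'rV[R]_d) {dT} (T : measurableType dT) n
    (e : n.-tuple bool) (G : T -> 'rV[R]_d -> R) (c : T -> n.-tuple 'rV[R]_d) :
  measurable_fun setT (fun w => G w x) -> measurable_fun setT c ->
  measurable_fun setT (fun w => updates (G w) (c w) e x).
Proof.
elim: n => [|n IH] in e G c *.
  move=> mG _; rewrite (_ : (fun _ => _) = fun w => G w x)//.
  by apply/funext => w; rewrite /updates (tuple0 (c w)) (tuple0 e).
move=> mG mc.
pose G' w := update (G w) (thead (c w)) (thead e).
pose c' w : n.-tuple 'rV[R]_d := [tuple of behead (c w)].
rewrite (_ : (fun _ => _) =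
    fun w => updates (G' w) (c' w) [tuple of behead e] x); last first.
  by apply/funext => w; rewrite /updates {1}(tuple_eta (c w)) {1}(tuple_eta e).
have mc0 : measurable_fun setT (fun w => thead (c w)).
  apply: (@measurableT_comp _ _ _ _ _ _ (fun t => tnth t ord0) _ c) => //.
  exact: measurable_tnth.
apply: IH; last first.
  apply: (@measurableT_comp _ _ _ _ _ _ (fun t : n.+1.-tuple 'rV[R]_d =>
    [tuple of behead t]) _ c) => //.
  exact: measurable_behead.
apply: measurable_funD => //; apply: measurable_funM; last first.
  exact: measurable_funB.
apply: measurable_funM => //.
pose B := [set w | enorm (x - thead (c w)) <= rad].
rewrite (_ : (fun _ => _) = \1_B :> (T -> R)).
  apply: measurable_indic.
  rewrite (_ : B = (fun w => enorm (x - thead (c w))) @^-1` `]-oo, rad]).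
    rewrite -[X in measurable X]setTI.
    have : measurable_fun setT (fun w => enorm (x - thead (c w))).
      exact: (measurableT_comp (measurable_enormB x) mc0).
    by apply => //; exact: measurable_itv.
  by apply/seteqP; split => w; rewrite /B/= in_itv.
by apply/funext => w; rewrite !indicE; congr (_%:R); apply/idP/idP; rewrite !inE.
Qed.

Lemma measurable_eval (x : 'rV[R]_d) :
  measurable_fun setT (fun f : state => f x).
Proof.
move=> _ B mB; rewrite setTI; apply: sub_sigma_algebra => f [mf _ _] n e.
rewrite -[X in measurable X]setTI.
by apply: (measurable_updates e (G := fun=> f) (c := id)).
Qed.

Section construction.
Context {dO : measure_display} {Omega : measurableType dO}.
Variable P : probability Omega R.
Variables (f : 'rV[R]_d -> R).
(* Indices are shifted by one: [C n], [V n], [E n] stand for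
   [C_{n+1}], [V_{n+1}], [E_{n+1}]. *)
Variables (C : nat -> Omega -> 'rV[R]_d) (V E : nat -> Omega -> R).

(* The mark [epsilon], equal to 0 in the degenerate state [g = 0] (which the
   update then leaves unchanged, even if [v = 0]). *)
Definition mark (g : 'rV[R]_d -> R) (c : 'rV[R]_d) (v : R) : bool :=
  `[< g <> cst 0 >] && (v <= g c).

Fixpoint chain (n : nat) : Omega -> state :=
  match n with
  | 0 => fun=> f
  | m.+1 => fun w => update (chain m w) (C m w) (mark (chain m w) (C m w) (V m w))
  end.

(* [P_n], the sigma-algebra of the first [n] steps of the chain. *)
Definition past (n : nat) : set (set Omega) :=
  <<s [set G | [\/ exists i B, [/\ (i < n)%N, measurable B & G = C i @^-1` B],
                   exists i B, [/\ (i < n)%N, measurable B & G = V i @^-1` B] |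
                   exists i B, [/\ (i <= n)%N, measurable B & G = chain i @^-1` B]]] >>.

(* In the degenerate state the centre is the arbitrary fixed point [c0]. *)
Definition center_law (c0 : 'rV[R]_d) (g : 'rV[R]_d -> R) (B : set 'rV[R]_d) :=
  if `[< g = cst 0 >] then \d_c0 B else uniform_on (fatten (supp g) rad) B.

Record slfv_construction (c0 : 'rV[R]_d) : Prop := {
  measurable_C : forall n, measurable_fun setT (C n) ;
  measurable_V : forall n, measurable_fun setT (V n) ;
  measurable_E : forall n, measurable_fun setT (E n) ;
  law_C : forall n B, measurable B ->
    cond_prob P (past n) (C n @^-1` B) (fun w => center_law c0 (chain n w) B) ;
  law_V : forall n B, measurable B ->
    P (V n @^-1` B) = uniform_prob (@ltr01 R) B ;
  indep_V : forall n, independent_classes P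
    <<s past n `|` preimage_set_system setT (C n) measurable >>
    (preimage_set_system setT (V n) measurable) ;
  law_E : forall n B, measurable B -> P (E n @^-1` B) = exponential_prob 1 B ;
  indep_E : independent_seq P E ;
  indep_E_chain : independent_classes P
    <<s \bigcup_n past n >>
    <<s \bigcup_n preimage_set_system setT (E n) measurable >>
}.

Definition holding_time (e : R) (l : \bar R) : \bar R :=
  if (l == 0)%E then +oo%E else (e / fine l)%:E.

Definition jump_time (n : nat) (w : Omega) : \bar R :=
  (\sum_(i < n) holding_time (E i w) (rate (chain i w)))%E.

Definition non_explosive : Prop :=
  P [set w | jump_time n w @[n --> \oo] --> +oo%E] = 1%E.

(* The index [n] is unique when the [E i w] are positive; the null function is
   a cemetery state after an explosion. *)
Definition process (t : R) (w : Omega) : state :=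
  match pselect (exists n,
    (jump_time n w <= t%:E)%E && (t%:E < jump_time n.+1 w)%E) with
  | left h => chain (ex_minn h) w
  | right _ => cst 0
  end.

End construction.

End model.

(* Main.v *)
Require Import Defs.
From HB Require Import structures.
From mathcomp Require Import all_boot all_order all_algebra.
From mathcomp Require Import all_classical all_reals all_analysis.
From mathcomp Require Import measurable_realfun.
From mathcomp Require Import ring lra.

Set Implicit Arguments.
Unset Strict Implicit.
Unset Printing Implicit Defensive.

Import Order.TTheory GRing.Theory Num.Theory.
Import numFieldNormedType.Exports.

Local Open Scope classical_set_scope.
Local Open Scope ring_scope.

(* An update enlarges the support by at most a ball of radius [rad], so the rate
   of the [n]-th state is at most [a + b n] and [T_n >= \sum_(i < n) E_i / (a + b i)].
   The Laplace transform of the right-hand side tends to 0 because the harmonic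
   series diverges: the process does not explode.

   For the Markov property at time [s], on the event that [n] jumps occurred
   before [s], the natural filtration at [s] is the sigma-algebra of the first
   [n] steps of the chain and of the first [n] holding times, restricted to
   [{E_n > rate (Y_n) (s - T_n)}]. The memoryless property of the exponential
   law then restarts the process at [Y_n], and the law of the state reached [m]
   jumps later satisfies a recursion in [m] over the one-step kernel of the chain.

   For the generator, two jumps before time [t] have probability [O(t^2)].
   Otherwise [X_t] is [Y_1] if [E_0 <= rate f * t] and [f] if not, so that
   [E (I (X_t) - I f) = rate f * t * E (I (Y_1) - I f) + O(t^2)]. The factor
   [rate f] cancels the density of the first centre [c], and expanding
   [\prod_i (1_(~` B) f + 1_B h) (x_i)] over the sets [I] of the indices [i] for
   which [x_i] lies in the ball [B] around [c], with [h] successively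
   [(1 - U) f + U], [(1 - U) f] and [f], gives the integrand. *)

(** * Kernels and exponential variables *)

(** The transition kernel is quantified before [f] and the probability space, so it cannot be read
    off the process: it is built by recursion from the one-step kernel, on the whole function space,
    and compared with the process afterwards. That it loses no mass is never proved analytically;
    the Markov identity on the full state space shows that the defect vanishes along the process.

    Conditioning is replaced by disintegration. A sub-sigma-algebra of [Omega] becomes a measurable
    type into which the identity is a random variable, each conditional law becomes a kernel on that
    type, and identities checked on a family stable under intersection extend to all nonnegative
    integrands.

    Measurability is the recurring obstacle, since the states are functions. A random state is
    handled through measurable centres and finitely many marks, a map out of the state space through
    its composites with [updates].

    The recursion keeps the first holding time as an argument: at time [s] the current one has
    partly elapsed, so it must not be integrated out before the memoryless property is applied. *)

Section probability_kernel_of_fun.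
Context d1 d2 (X : measurableType d1) (Y : measurableType d2) (R : realType).
Variable k : X -> set Y -> \bar R.
Hypothesis k0 : forall x, k x set0 = 0%E.
Hypothesis k_ge0 : forall x A, (0 <= k x A)%E.
Hypothesis k_sigma_additive : forall x, semi_sigma_additive (k x).
Hypothesis measurable_k : forall A, measurable A -> measurable_fun setT (k ^~ A).
Hypothesis k1 : forall x, k x setT = 1%E.

HB.instance Definition _ x := isMeasure.Build _ _ _ (k x)
  (k0 x) (k_ge0 x) (@k_sigma_additive x).

Let mk : X -> {measure set Y -> \bar R} := k.

HB.instance Definition _ := isKernel.Build _ _ _ _ _ mk measurable_k.
HB.instance Definition _ := Kernel_isProbability.Build _ _ _ _ _ mk k1.

Lemma probability_kernel_of_fun :
  exists p : R.-pker X ~> Y, forall x A, p x A = k x A.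
Proof. by exists mk. Qed.

End probability_kernel_of_fun.

Section push_measure.
Context d1 d2 (X : measurableType d1) (Y : measurableType d2) (R : realType).
Variables (phi : X -> Y) (mphi : measurable_fun setT phi).
Variable mu : {measure set X -> \bar R}.

Definition push_measure : {measure set Y -> \bar R} :=
  measure_function_pushforward__canonical__measure_function_Measure mu mphi.

Lemma push_measureE A : push_measure A = mu (phi @^-1` A).
Proof. by []. Qed.

Lemma integral_push_measure (f : Y -> \bar R) :
  measurable_fun setT f -> (forall y, 0 <= f y)%E ->
  (\int[push_measure]_y f y = \int[mu]_x f (phi x))%E.
Proof.
by move=> mf f0; rewrite ge0_integral_pushforward//= preimage_setT.
Qed.

End push_measure.

Section disintegration.
Context d d1 d2 (T : measurableType d) (T1 : measurableType d1)
  (T2 : measurableType d2) (R : realType).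
Variables (P : probability T R) (X : T -> T1) (Z : T -> T2).
Hypotheses (mX : measurable_fun setT X) (mZ : measurable_fun setT Z).

(** The joint law of [X] and [Z] and the composition of the law of [X] with [k] agree on rectangles,
    a generating family stable under intersection, hence everywhere. With [X] the identity into a
    sub-sigma-algebra of the sample space, the integrand may depend on a whole past. *)
Lemma disintegration (k : R.-pker T1 ~> T2) (F : T1 * T2 -> \bar R) :
  (forall G B, measurable G -> measurable B ->
    P (X @^-1` G `&` Z @^-1` B) = (\int[P]_(w in X @^-1` G) k (X w) B)%E) ->
  (forall z, 0 <= F z)%E -> measurable_fun setT F ->
  (\int[P]_w F (X w, Z w) = \int[P]_w \int[k (X w)]_z F (X w, z))%E.
Proof.
move=> XZ F0 mF.
(* The law of [X], as a kernel from the one-point space so that kernel composition applies. *)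
have [l lE] : exists l : R.-pker unit ~> T1,
    forall x A, l x A = push_measure mX P A.
  apply: probability_kernel_of_fun.
  - by move=> _; exact: measure0.
  - by move=> _ A; exact: measure_ge0.
  - by move=> _; exact: measure_semi_sigma_additive.
  - by move=> A mA; exact: measurable_cst.
  - by move=> _; rewrite push_measureE preimage_setT; exact: probability_setT.
have mpair x : measurable_fun setT (pair x : T2 -> T1 * T2).
  exact: measurable_pair1.
(* The first coordinate has to survive the composition: [k'] sends [x] to the law of [(x, z)] with
   [z] of law [k x]. *)
have [k' k'E] : exists k' : R.-pker (unit * T1)%type ~> (T1 * T2)%type,
    forall x A, k' x A = push_measure (mpair x.2) (k x.2) A.
  apply: probability_kernel_of_fun.
  - by move=> x; exact: measure0.
  - by move=> x A; exact: measure_ge0.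
  - by move=> x; exact: measure_semi_sigma_additive.
  - move=> A mA; rewrite [X in measurable_fun _ X](_ : _ =
        (fun x => k x (xsection A x)) \o snd).
      apply: measurableT_comp => //; apply: measurable_fun_xsection_finite_kernel.
      by rewrite inE.
    by apply/funext => -[u x]; rewrite push_measureE/= xsectionE.
  - by move=> x; rewrite push_measureE preimage_setT; exact: prob_kernel.
have mXZ : measurable_fun setT (fun w => (X w, Z w)) by exact/measurable_fun_pair.
pose C : set (set (T1 * T2)) :=
  [set A `*` B | A in measurable & B in measurable].
have rect A : measurable A -> push_measure mXZ P A = kcomp l k' tt A.
  apply: (@measure_unique _ R _ C (fun=> setT) _ _ _ _
    (push_measure mXZ P) (mkcomp l k' tt)) => //.
  - by rewrite measurable_prod_measurableType.
  - move=> _ _ [A1 mA1 [B1 mB1 <-]] [A2 mA2 [B2 mB2 <-]]; rewrite -setXI.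
    exists (A1 `&` A2); first exact: measurableI.
    by exists (B1 `&` B2) => //; exact: measurableI.
  - by move=> _; exists setT => //; exists setT => //; rewrite setXTT.
  - by rewrite bigcup_const//; exists 0%N.
  - move=> _ [A1 mA1 [B1 mB1 <-]].
    rewrite push_measureE/=.
    have -> : (fun w => (X w, Z w)) @^-1` (A1 `*` B1) =
      X @^-1` A1 `&` Z @^-1` B1 by [].
    rewrite XZ// integral_mkcond.
    transitivity (\int[push_measure mX P]_y k' (tt, y) (A1 `*` B1))%E; last first.
      by apply: eq_measure_integral => D mD _; rewrite lE.
    rewrite integral_push_measure//; last first.
      exact: (measurableT_comp (measurable_kernel k' _ (measurableX mA1 mB1))).
    apply: eq_integral => w _ /=.
    rewrite k'E push_measureE/= patchE.
    case: ifPn => [|]; rewrite ?inE ?notin_setE/= => XA.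
      rewrite (_ : (pair (X w) @^-1` _) = B1)//.
      by apply/seteqP; split => y //= -[].
    rewrite (_ : (pair (X w) @^-1` _) = set0).
      by apply/esym; exact: (measure0 (k (X w))).
    by apply/seteqP; split => y //= -[].
  - move=> _; rewrite (_ : push_measure mXZ P setT = 1%E) ?ltry//.
    by rewrite push_measureE preimage_setT; exact: probability_setT.
have mIk : measurable_fun setT (fun x => \int[k x]_y F (x, y))%E.
  exact: measurable_fun_integral_sfinite_kernel.
rewrite -(integral_push_measure mXZ)//.
transitivity (\int[kcomp l k' tt]_z F z)%E.
  by apply: eq_measure_integral => A mA _; exact: rect.
rewrite integral_kcomp//.
transitivity (\int[push_measure mX P]_x (\int[k x]_y F (x, y)))%E.
  transitivity (\int[l tt]_x (\int[k x]_y F (x, y)))%E.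
    apply: eq_integral => x _.
    rewrite -(integral_push_measure (mpair x) (k x))//.
    by apply: eq_measure_integral => A mA _; rewrite k'E.
  by apply: eq_measure_integral => A mA _; rewrite lE.
rewrite integral_push_measure// => x.
by apply: integral_ge0.
Qed.

End disintegration.

Section exponential.
Context {R : realType}.

Let expo_ex : exists m : probability (measurableTypeR R) R,
  forall A, m A = exponential_prob 1 A.
Proof.
unshelve eexists; first by refine (exponential_prob 1); exact: ltr01.
by [].
Qed.

Definition expo : probability (measurableTypeR R) R := projT1 (cid expo_ex).

Lemma expoE A : expo A = exponential_prob 1 A.
Proof. exact: (projT2 (cid expo_ex)). Qed.

Lemma expo_le0 : expo `]-oo, 0]%classic = 0%E.
Proof.
rewrite expoE /exponential_prob.
rewrite (_ : `]-oo, 0]%classic = `]-oo, 0[%classic `|` [set 0 : R]); last first.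
  by rewrite setUitv1.
rewrite ge0_integral_setU//=; last 3 first.
- apply/measurable_funTS/measurable_EFinP; exact: measurable_exponential_pdf.
- by move=> x _; rewrite lee_fin exponential_pdf_ge0.
- apply/disj_setPLR => x /= /[swap] -> ; by rewrite in_itv/= ltxx.
rewrite integral_set1 adde0 integral0_eq// => x /=; rewrite in_itv/= => x0.
by rewrite lt0_exponential_pdf.
Qed.

(** The truncation at 0 is there for negative levels, which occur in [expo_memoryless] as
    differences [b - a] of arbitrary sign. *)
Lemma expo_gt (a : R) : expo `]a, +oo[%classic = (expR (- Num.max a 0))%:E.
Proof.
have gt0 (b : R) : 0 <= b -> expo `]b, +oo[%classic = (expR (- b))%:E.
  move=> b0.
  rewrite (_ : `]b, +oo[%classic = ~` `]-oo, b]%classic); last by rewrite setCitvl.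
  rewrite probability_setC//.
  move: b0; rewrite le_eqVlt => /predU1P[<-|b0].
    by rewrite expo_le0 sube0 oppr0 expR0.
  have : expo (`]-oo, 0]%classic `|` `[0, b]%classic) = expo `[0, b]%classic.
    apply/eqP; rewrite eq_le; apply/andP; split.
      apply: (le_trans (measureU2 _ _ _)) => //.
      by rewrite [X in (X + _)%E]expo_le0 add0e.
    by apply: le_measure; rewrite ?inE//; exact: measurableU.
  rewrite (_ : _ `|` _ = `]-oo, b]%classic); last first.
    apply/seteqP; split => x /=; rewrite !in_itv/=.
      by move=> [|]; lra.
    by move=> xb; have [x0|x0] := leP x 0; [left|right; rewrite xb ltW].
  move=> ->; rewrite expoE exponential_prob_itv0c// mulN1r -EFinB.
  by rewrite opprB addrC subrK.
have [a0|a0] := leP a 0; last exact/gt0/ltW.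
have : (expo `]0%R, +oo[%classic <= expo `]a, +oo[%classic)%E.
  apply: le_measure; rewrite ?inE//.
  by move=> x /=; rewrite !in_itv/= !andbT; exact: le_lt_trans.
rewrite (gt0 0)// oppr0 expR0 => a1; apply/eqP; rewrite eq_le a1 andbT.
exact: probability_le1.
Qed.

Lemma expo_le (a : R) : 0 <= a -> expo `]-oo, a]%classic = (1 - expR (- a))%:E.
Proof.
move=> a0; have : expo `]a, +oo[%classic = (expR (- a))%:E by rewrite expo_gt max_l.
by rewrite EFinB => <-; rewrite -probability_setC// setCitvr.
Qed.

(** The law restricted to []a, +oo[] and [expR (- a)] times its translate by [a] give the same mass
    to every half-line []b, +oo[], and these generate the Borel sets. *)
Lemma expo_memoryless (a : R) (h : R -> \bar R) : 0 <= a ->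
  measurable_fun setT h -> (forall x, 0 <= h x)%E ->
  (\int[expo]_(u in `]a, +oo[) h u =
   (expR (- a))%:E * \int[expo]_(u in `]0%R, +oo[) h (a + u)%R)%E.
Proof.
move=> a0 mh h0.
have ma : measurable_fun setT (fun u : measurableTypeR R => (a + u : measurableTypeR R)).
  exact: measurable_funD.
have ea : 0 <= expR (- a) by exact: expR_ge0.
pose m1 : {measure set (measurableTypeR R) -> \bar R} := mrestr expo (measurable_itv `]a, +oo[).
pose m2 : {measure set (measurableTypeR R) -> \bar R} := mscale (NngNum ea) (push_measure ma expo).
have m1E B : m1 B = expo (B `&` `]a, +oo[%classic) by [].
have m2E B : m2 B = ((expR (- a))%:E * expo (+%R a @^-1` B))%E by [].
have m12 A : measurable A -> m1 A = m2 A.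
  move=> mA; refine (@measure_unique _ R (measurableTypeR R) (@RGenOInfty.G R)
    (fun k => `](- k%:R), +oo[%classic) _ _ _ _ m1 m2 _ _ A mA).
  - exact: RGenOInfty.measurableE.
  - move=> _ _ [x ->] [y ->]; exists (Num.max x y).
    apply/seteqP; split => z /=; rewrite !in_itv/= !andbT gt_max.
      by move=> [-> ->].
    by move=> /andP[].
  - by move=> i; eexists.
  - rewrite -subTset => x _; exists (Num.bound `|x|) => //=.
    rewrite in_itv/= andbT ltrNl (le_lt_trans (ler_norm _))// normrN.
    exact/archi_boundP/normr_ge0.
  - move=> _ [b ->]; rewrite m1E m2E.
    rewrite (_ : _ `&` _ = `]Num.max a b, +oo[%classic); last first.
      apply/seteqP; split => z /=; rewrite !in_itv/= !andbT gt_max.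
        by move=> [-> ->].
      by move=> /andP[].
    rewrite (_ : _ @^-1` _ = `]b - a, +oo[%classic); last first.
      by apply/seteqP; split => z /=; rewrite !in_itv/= !andbT ltrBlDl.
    rewrite !expo_gt -EFinM -expRD; congr (expR _)%:E.
    rewrite -opprD; congr (- _).
    by rewrite /Num.max; do ![case: ifP]; lra.
  - move=> k; rewrite m1E (le_lt_trans _ (ltry 1))//.
    by apply: probability_le1; exact: measurableI.
transitivity (\int[m2]_(u in `]a, +oo[) h u)%E.
  apply: eq_measure_integral => A mA Aa; rewrite -m12// m1E.
  by rewrite setIidl.
have mhr : measurable_fun (setT : set (measurableTypeR R)) (h \_ `]a, +oo[).
  by apply/(measurable_restrictT _ _).1 => //; exact: measurable_funTS.
rewrite integral_mkcond ge0_integral_mscale//; last first.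
- by move=> x _; apply: erestrict_ge0.
rewrite integral_push_measure//; last first.
- by move=> x; apply: erestrict_ge0.
congr (_ * _)%E; rewrite [RHS]integral_mkcond; apply: eq_integral => x _.
by rewrite !patchE !mem_setE !in_itv/= !andbT ltrDl.
Qed.

End exponential.

(** * Balls, fattenings and Lebesgue measure *)

Section geometry.
Context {R : realType} {d : nat}.
Implicit Types (x y c : 'rV[R]_d) (A B : set 'rV[R]_d) (r : R).

Lemma enorm_sym x y : enorm (x - y) = enorm (y - x).
Proof.
rewrite /enorm; congr Num.sqrt; apply: eq_bigr => i _.
by rewrite !mxE -sqrrN opprB.
Qed.

Lemma enorm0 : enorm (0 : 'rV[R]_d) = 0.
Proof.
by rewrite /enorm big1 ?sqrtr0// => i _; rewrite mxE expr0n.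
Qed.

Lemma continuous_enorm : continuous (@enorm R d).
Proof.
move=> x; apply: (@continuous_comp _ _ _ (fun x : 'rV[R]_d => \sum_i x ord0 i ^+ 2)
    (@Num.sqrt R)); last exact: sqrt_continuous.
apply: cvg_big; [exact: add_continuous|exact: nbhs_filter|move=> i _].
have xi := @coord_continuous R 1 d ord0 i x.
exact: (@cvgM _ _ _ (nbhs_filter x) _ _ _ _ xi xi).
Qed.

Lemma coord_le_enorm x i : `|x ord0 i| <= enorm x.
Proof.
rewrite -sqrtr_sqr; apply: ler_wsqrtr; rewrite (bigD1 i)//= lerDl.
by apply: sumr_ge0 => j _; exact: sqr_ge0.
Qed.

(** The divisor [d.+1] replaces the optimal square root of [d]: [d] squares of size
    [(r / d.+1) ^+ 2] add up to at most [r ^+ 2], and [d = 0] needs no separate case. *)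
Lemma enorm_le x r : 0 <= r ->
  (forall i, `|x ord0 i| <= r / d.+1%:R) -> enorm x <= r.
Proof.
move=> r0 xr; rewrite [leRHS](_ : r = Num.sqrt (r ^+ 2)); last by rewrite sqrtr_sqr ger0_norm.
apply: ler_wsqrtr.
apply: (@le_trans _ _ (\sum_(i < d) (r / d.+1%:R) ^+ 2)).
  apply: ler_sum => i _; rewrite -(real_normK (num_real (x ord0 i))).
  by rewrite ler_sqr ?nnegrE// divr_ge0.
rewrite sumr_const card_ord -[_ *+ d]mulr_natr expr_div_n -mulrA.
apply: ler_piMr; first exact: sqr_ge0.
rewrite mulrC ler_pdivrMr ?exprn_gt0// mul1r -natrX ler_nat.
by rewrite (leq_trans (leqnSn d))// -{1}(expn1 d.+1) leq_pexp2l.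
Qed.

Lemma eballc c r : 0 <= r -> eball c r c.
Proof. by move=> r0; rewrite /eball/= subrr enorm0. Qed.

Lemma closed_eball c r : closed (eball c r).
Proof.
have /continuous_closedP ce : continuous (fun x => enorm (x - c)).
  move=> x; apply: (@continuous_comp _ _ _ (fun x => x - c) (@enorm R d)).
    by apply: continuousB => //; exact: cst_continuous.
  exact: continuous_enorm.
by have := ce [set t | t <= r]; apply; exact: closed_le.
Qed.

Lemma compact_coord_bounded A : compact A ->
  exists2 M, 0 < M & forall x, A x -> forall i, `|x ord0 i| <= M.
Proof.
move=> /compact_bounded [M [Mr AM]].
exists (`|M| + 1) => [|x Ax i]; first by rewrite ltr_wpDl.
apply: le_trans (AM (`|M| + 1) _ _ Ax); last first.
  by rewrite (le_lt_trans (ler_norm M))// ltrDl.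
have /mapP[j Hj ->] : `|x ord0 i| \in [seq `|x y.1 y.2| | y : 'I_1 * 'I_d].
  by apply/mapP; exists (ord0, i) => //=; rewrite mem_enum.
by rewrite [leRHS]/Num.Def.normr /= mx_normrE; apply/bigmax_geP; right => /=; exists j.
Qed.

Lemma coord_bounded_compact A (M : R) : closed A ->
  (forall x, A x -> forall i, `|x ord0 i| <= M) -> compact A.
Proof.
move=> cA AM; apply: bounded_closed_compact => //.
exists `|M|; split; first exact: num_real.
move=> K MK x Ax /=; rewrite [leLHS]/Num.Def.normr /= mx_normrE.
apply/bigmax_leP; split => [|[i j] _ /=].
  by rewrite (le_trans _ (ltW MK)).
by rewrite (ord1 i) (le_trans (AM _ Ax _))// (le_trans (ler_norm _) (ltW MK)).
Qed.

Lemma compact_eball c r : compact (eball c r).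
Proof.
apply: (@coord_bounded_compact _ (r + \sum_i `|c ord0 i|)).
  exact: closed_eball.
move=> x xc i; rewrite -[x ord0 i](subrK (c ord0 i)).
rewrite (le_trans (ler_normD _ _))// lerD//.
  by rewrite (le_trans _ xc)// (le_trans _ (coord_le_enorm _ i))// !mxE.
by rewrite (bigD1 i)//= lerDl sumr_ge0.
Qed.

Lemma rV_hausdorff : hausdorff_space 'rV[R]_d.
Proof. exact: norm_hausdorff. Qed.

(** The fattening is the image under addition of the product of [A] with the closed ball around
    0. *)
Lemma compact_fatten A r : compact A -> compact (fatten A r).
Proof.
move=> cA.
rewrite (_ : fatten A r =
    (fun p : 'rV[R]_d * 'rV[R]_d => p.1 + p.2) @` (A `*` eball 0 r)).
  apply: continuous_compact; last by apply: compact_setX => //; exact: compact_eball.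
  apply: continuous_subspaceT => p.
  exact: cvgD cvg_fst cvg_snd.
apply/seteqP; split => [x [y Ay xy]|_ [[y z] [/= Ay yz] <-]].
  exists (y, x - y) => /=; last by rewrite addrC subrK.
  by split => //; rewrite /eball/= subr0.
by exists y => //=; rewrite addrAC subrr add0r; move: yz; rewrite /eball/= subr0.
Qed.

Lemma measurable_compact A : compact A -> measurable A.
Proof.
move=> cA; apply: closed_measurable_rV.
exact: (compact_closed rV_hausdorff).
Qed.

Lemma measurable_fatten A r : compact A -> measurable (fatten A r).
Proof. by move=> cA; apply: measurable_compact; exact: compact_fatten. Qed.

Lemma fatten0 r : fatten set0 r = set0 :> set 'rV[R]_d.
Proof. by apply/seteqP; split => x // [y]. Qed.

Lemma fattenU A B r : fatten (A `|` B) r = fatten A r `|` fatten B r.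
Proof.
apply/seteqP; split => [x [y [Ay|By] xy]|x [[y Ay xy]|[y By xy]]].
- by left; exists y.
- by right; exists y.
- by exists y => //; left.
- by exists y => //; right.
Qed.

Lemma fatten_eball c r s x :
  fatten (eball c r) s x <-> fatten (eball 0 r) s (x - c).
Proof.
split=> [[y yc xy]|[y yc xy]].
  exists (y - c); first by rewrite /eball/= subr0.
  by rewrite opprB addrA subrK.
exists (y + c); first by rewrite /eball/= addrK -(subr0 y).
by rewrite opprD addrA [x - y - c]addrAC.
Qed.

Lemma power_measure_box n (A : 'I_n -> set R) :
  (forall i, measurable (A i)) ->
  power_measure (@lebesgue_measure R) (n:=n) [set t | forall i, A i (tnth t i)] =
  (\prod_(i < n) lebesgue_measure (A i))%E.
Proof.
elim: n => [|n IH] in A *.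
  by move=> _; rewrite big_ord0 /= diracE mem_set// => -[].
move=> mA; rewrite big_ord_recl /=.
under eq_integral => x _.
  rewrite (_ : [set t : n.-tuple R | _] =
      if x \in A ord0 then [set t | forall i, A (lift ord0 i) (tnth t i)] else set0); last first.
    case: ifPn; rewrite ?inE ?notin_setE => Ax.
      apply/seteqP; split => t /= h.
        by move=> i; have := h (lift ord0 i); rewrite tnthS.
      move=> i; case: (unliftP ord0 i) => [j|] ->; last by rewrite tnth0.
      by rewrite tnthS.
    by apply/seteqP; split => t //= /(_ ord0); rewrite tnth0.
  rewrite (_ : power_measure _ _ = (\prod_(i < n) lebesgue_measure (A (lift ord0 i)) *
      (\1_(A ord0) x)%:E)%E); last first.
    rewrite indicE; case: ifPn => Ax; last by rewrite mule0; exact: measure0.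
    by rewrite mule1 (IH (fun i => A (lift ord0 i))).
  over.
rewrite ge0_integralZl//; last 2 first.
- by apply/measurable_EFinP; apply: measurable_indic; exact: mA.
- by apply: prode_ge0.
by rewrite integral_indic ?setIT 1?muleC//; exact: mA.
Qed.

(** Volumes of Euclidean balls are never computed. Cubes inside balls give positive rates; cubes
    outside give finite measure to compact sets and bound the growth of the rate. *)
Definition cube c r := [set x : 'rV[R]_d | forall i, `|x ord0 i - c ord0 i| <= r].

Lemma lebesgue_cube c r : 0 <= r -> lebesgue_rV (cube c r) = ((r *+ 2) ^+ d)%:E.
Proof.
move=> r0; rewrite /lebesgue_rV /pushforward.
rewrite (_ : _ @^-1` _ = [set t | forall i,
    [set` `[c ord0 i - r, c ord0 i + r]] (tnth t i)]); last first.
  apply/seteqP; split => t /= h i; have := h i; rewrite mxE /= in_itv/= ler_distl; lra.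
rewrite (power_measure_box (A := fun i => `[c ord0 i - r, c ord0 i + r]%classic))//.
under eq_bigr => i _.
  rewrite lebesgue_measure_itv/= lte_fin.
  rewrite (_ : (if _ then _ else _) = (r *+ 2)%:E); last first.
    case: ltP => h; last by congr EFin; lra.
    by rewrite -EFinB; congr EFin; lra.
  over.
by rewrite prodEFin/= prodr_const card_ord.
Qed.

Lemma cube_eball c r : 0 <= r -> cube c (r / d.+1%:R) `<=` eball c r.
Proof.
by move=> r0 x xc; apply: enorm_le => // i; rewrite !mxE; exact: xc.
Qed.

Lemma measurable_coord i : measurable_fun setT (fun x : 'rV[R]_d => x ord0 i).
Proof. by apply: continuous_measurable_rV; exact: coord_continuous. Qed.

Lemma measurable_cube c r : measurable (cube c r).
Proof.
rewrite (_ : cube c r = \bigcap_(i : 'I_d)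
    ((fun x : 'rV[R]_d => `|x ord0 i - c ord0 i|) @^-1` `]-oo, r])); last first.
  apply/seteqP; split => [x xc i _|x xc i]; first by rewrite /= in_itv/=.
  by have := xc i I; rewrite /= in_itv/=.
apply: fin_bigcap_measurable; first exact: finite_finset.
move=> i _; rewrite -[X in measurable X]setTI.
suff : measurable_fun setT (fun x : 'rV[R]_d => `|x ord0 i - c ord0 i|) by apply.
apply: measurableT_comp => //.
by apply: measurable_funB => //; exact: measurable_coord.
Qed.

Lemma lebesgue_eball_gt0 c r : 0 < r -> (0 < lebesgue_rV (eball c r))%E.
Proof.
move=> r0; apply: (@lt_le_trans _ _ (lebesgue_rV (cube c (r / d.+1%:R)))).
  rewrite lebesgue_cube; last by rewrite divr_ge0// ltW.
  by rewrite lte_fin exprn_gt0// pmulrn_rgt0// divr_gt0.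
apply: le_measure; rewrite ?inE.
- exact: measurable_cube.
- by apply: closed_measurable_rV; exact: closed_eball.
- by apply: cube_eball; exact: ltW.
Qed.

Lemma lebesgue_compact_lty A : compact A -> (lebesgue_rV A < +oo)%E.
Proof.
move=> cA; have [M M0 AM] := compact_coord_bounded cA.
apply: (@le_lt_trans _ _ (lebesgue_rV (cube 0 M))).
  apply: le_measure; rewrite ?inE.
  - exact: measurable_compact.
  - exact: measurable_cube.
  - by move=> x Ax i; rewrite mxE subr0; exact: AM.
by rewrite lebesgue_cube ?ltry// ltW.
Qed.

Lemma measurable_fun_rV dT (T : measurableType dT) (G : T -> 'rV[R]_d) :
  (forall i, measurable_fun setT (fun w => G w ord0 i)) -> measurable_fun setT G.
Proof.
move=> mG; rewrite (_ : G = @rV_of_tuple R d \o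
    (fun w => [tuple G w ord0 i | i < d])); last first.
  by apply/funext => w; apply/rowP => i; rewrite mxE tnth_mktuple.
apply: measurableT_comp; first exact: measurable_rV_of_tuple.
apply/measurable_fun_tnthP => i.
rewrite (_ : _ \o _ = fun w => G w ord0 i)//.
by apply/funext => w /=; rewrite tnth_mktuple.
Qed.

Lemma measurable_subrV dT (T : measurableType dT) (G H : T -> 'rV[R]_d) :
  measurable_fun setT G -> measurable_fun setT H ->
  measurable_fun setT (fun w => G w - H w).
Proof.
move=> mG mH; apply: measurable_fun_rV => i.
rewrite (_ : (fun w => _) = fun w => G w ord0 i - H w ord0 i); last first.
  by apply/funext => w; rewrite !mxE.
by apply: measurable_funB; apply: (measurableT_comp (measurable_coord i)).
Qed.

Lemma measurable_eball_preimage dT (T : measurableType dT)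
    (G H : T -> 'rV[R]_d) r :
  measurable_fun setT G -> measurable_fun setT H ->
  measurable [set w | eball (G w) r (H w)].
Proof.
move=> mG mH.
rewrite (_ : [set w | _] = (fun w => H w - G w) @^-1` (eball 0 r)); last first.
  by apply/seteqP; split => w; rewrite /eball/= subr0.
rewrite -[X in measurable X]setTI; apply: measurable_subrV => //.
by apply: closed_measurable_rV; exact: closed_eball.
Qed.

End geometry.

(** * States and updates *)

Section states.
Context {R : realType} {d : nat}.
Variables rad U : R.
Hypotheses (rad0 : 0 < rad) (U01 : 0 < U < 1).
Local Notation state := (@state R d rad U).
Local Notation update := (@update R d rad U).
Local Notation updates := (@updates R d rad U _).
Implicit Types (f g : 'rV[R]_d -> R) (c x : 'rV[R]_d) (e : bool).

Lemma updateE f c e x :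
  update f c e x = if x \in eball c rad then (1 - U) * f x + U * e%:R else f x.
Proof.
rewrite /update indicE; case: ifPn => _; rewrite ?mulr1 ?mulr0 ?mul0r ?addr0//.
ring.
Qed.

Lemma subset_supp f : [set x | f x != 0] `<=` supp f.
Proof. exact: subset_closure. Qed.

(** On the ball, mark 0 multiplies by [1 - U], which is positive, so the set of nonzero points is
    unchanged; mark 1 adds [U] and makes every value positive. The ball being closed, taking
    closures adds nothing to it. *)
Lemma supp_update f c e : (forall x, 0 <= f x) ->
  supp (update f c e) = if e then supp f `|` eball c rad else supp f.
Proof.
move=> f0; rewrite /supp; have /andP[U0 U1] := U01.
rewrite (_ : [set x | update f c e x != 0] =
    [set x | f x != 0] `|` (if e then eball c rad else set0)).
  case: ifPn => _; rewrite ?setU0// closureU.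
  by rewrite -((closure_id (eball c rad)).1 (@closed_eball _ _ _ _)).
apply/seteqP; split => x /=; rewrite updateE; case: e => /=;
  case: ifPn; rewrite ?inE ?notin_setE => xc.
- by move=> _; right.
- by move=> fx; left.
- by rewrite mulr0 addr0 mulf_eq0 => /norP[_ ?]; left.
- by left.
- by move=> _; rewrite mulr1 gt_eqF// ltr_wpDl// mulr_ge0// subr_ge0 ltW.
- by case=> // /xc.
- by case=> // fx; rewrite mulr0 addr0 mulf_neq0// subr_eq0 gt_eqF.
- by case.
Qed.

Lemma Sc_ge0 f : Sc f -> forall x, 0 <= f x.
Proof. by move=> [_ f01 _] x; have /andP[] := f01 x. Qed.

Lemma Sc_update f c e : Sc f -> Sc (update f c e).
Proof.
move=> Sf; have f0 := Sc_ge0 Sf; move: Sf => [mf f01 cf].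
have /andP[U0 U1] := U01; split.
- apply: measurable_funD => //; apply: measurable_funM; last exact: measurable_funB.
  apply: measurable_funM => //; apply: measurable_indic.
  by apply: closed_measurable_rV; exact: closed_eball.
- move=> x; rewrite updateE; have /andP[fx0 fx1] := f01 x.
  case: ifPn => _; last by rewrite fx0.
  by case: e; rewrite ?mulr1 ?mulr0; apply/andP; split; nra.
- rewrite supp_update//; case: ifPn => // _.
  by apply: compactU => //; exact: compact_eball.
Qed.

Lemma Sc0 : Sc (cst 0 : 'rV[R]_d -> R).
Proof.
split => //; first by move=> x; rewrite lexx ler01.
rewrite /supp (_ : [set x | _] = set0) ?closure0//; first exact: compact0.
by apply/seteqP; split => x //=; rewrite eqxx.
Qed.

Lemma updates_nil f (c : 0.-tuple 'rV[R]_d) (e : 0.-tuple bool) :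
  updates f c e = f.
Proof. by rewrite /Defs.updates (tuple0 c) (tuple0 e). Qed.

Lemma updates_cons n f c (cs : n.-tuple 'rV[R]_d) e (es : n.-tuple bool) :
  updates f [tuple of c :: cs] [tuple of e :: es] = updates (update f c e) cs es.
Proof. by []. Qed.

Lemma updates_rcons n f c (cs : n.-tuple 'rV[R]_d) e (es : n.-tuple bool) :
  updates f [tuple of rcons cs c] [tuple of rcons es e] = update (updates f cs es) c e.
Proof.
by rewrite /Defs.updates /= zip_rcons ?size_tuple// foldl_rcons.
Qed.

Lemma Sc_updates n f (cs : n.-tuple 'rV[R]_d) (es : n.-tuple bool) :
  Sc f -> Sc (updates f cs es).
Proof.
elim: n f cs es => [|n IH] f cs es Sf; first by rewrite updates_nil.
rewrite (tuple_eta cs) (tuple_eta es) updates_cons.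
exact/IH/Sc_update.
Qed.

Lemma update_eq0 f c e : Sc f ->
  update f c e = cst 0 <-> f = cst 0 /\ e = false.
Proof.
move=> Sf; have f0 := Sc_ge0 Sf; have /andP[U0 U1] := U01; split; last first.
  move=> [-> ->]; apply/funext => x.
  by rewrite updateE; case: ifPn => _; rewrite ?mulr0 ?addr0.
move=> fe; have e0 : e = false.
  apply/negP => e1; have := congr1 (fun h => h c) fe.
  rewrite updateE e1 mem_set; last by apply: eballc; exact: ltW.
  rewrite mulr1 /= => /eqP; rewrite gt_eqF// ltr_wpDl// mulr_ge0// subr_ge0.
  exact: ltW.
split=> //; apply/funext => x; have := congr1 (fun h => h x) fe.
rewrite updateE e0 mulr0 addr0; case: ifPn => // _ /eqP.
by rewrite mulf_eq0 subr_eq0 gt_eqF//= => /eqP.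
Qed.

(** Degeneracy depends on [f] and the marks only, never on the centres. For fixed marks, a function
    of the centres therefore stays in one of the two cases throughout. *)
Lemma updates_eq0 n f (cs : n.-tuple 'rV[R]_d) (es : n.-tuple bool) : Sc f ->
  updates f cs es = cst 0 <-> f = cst 0 /\ all negb es.
Proof.
elim: n f cs es => [|n IH] f cs es Sf.
  by rewrite updates_nil (tuple0 es); split => [|[]].
rewrite (tuple_eta cs) (tuple_eta es) updates_cons IH; last exact: Sc_update.
rewrite update_eq0//=; split; first by move=> [[-> ->]].
by move=> [-> /andP[/negbTE ->]].
Qed.

Lemma fatten_supp_update f c e x : Sc f ->
  fatten (supp (update f c e)) rad x <->
  fatten (supp f) rad x \/ e /\ fatten (eball 0 rad) rad (x - c).
Proof.
move=> Sf; rewrite supp_update; last exact: Sc_ge0.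
case: e; last by split => [|[|[]]]//; left.
rewrite fattenU; split.
  by move=> [|/fatten_eball]; [left|right].
by move=> [|[_ ?]]; [left|right; apply/fatten_eball].
Qed.

Lemma tnth_lift0 (T : Type) n (t : n.+1.-tuple T) i :
  tnth t (lift ord0 i) = tnth [tuple of behead t] i.
Proof. by rewrite {1}(tuple_eta t) tnthS. Qed.

(** Unfolding the updates, the fattened support is that of [f] together with one translate of a
    fixed compact set for each mark equal to 1. Each piece is measurable jointly in the centres and
    the point, which is what Fubini needs for [measurable_rate]. *)
Lemma measurable_fatten_supp_updates dT (T : measurableType dT) n f
    (cs : T -> n.-tuple 'rV[R]_d) (es : n.-tuple bool) (x : T -> 'rV[R]_d) :
  Sc f -> measurable_fun setT cs -> measurable_fun setT x ->
  measurable [set w | fatten (supp (updates f (cs w) es)) rad (x w)].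
Proof.
move=> Sf mcs mx.
have h (c : T -> 'rV[R]_d) A : measurable_fun setT c -> compact A ->
    measurable [set w | fatten A rad (c w)].
  move=> mc cA; rewrite -[X in measurable X]setTI; apply: mc => //.
  exact: measurable_fatten.
rewrite (_ : [set w | _] = [set w | fatten (supp f) rad (x w)] `|`
    \bigcup_(i : 'I_n) (if tnth es i then
      [set w | fatten (eball 0 rad) rad (x w - tnth (cs w) i)] else set0)).
  apply: measurableU; first by apply: h => //; have [] := Sf.
  apply: countable_bigcupT_measurable => // i; case: ifPn => // _.
  apply: h; last exact: compact_eball.
  apply: measurable_subrV => //.
  exact: (measurableT_comp (@measurable_tnth _ _ _ i)).
apply/seteqP; split => w /=.
- elim: n f Sf cs es mcs => [|n IH] f Sf cs es mcs; first by rewrite updates_nil; left.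
  rewrite (tuple_eta (cs w)) (tuple_eta es) updates_cons.
  have mb : measurable_fun setT (fun w => [tuple of behead (cs w)]).
    exact: (measurableT_comp (@measurable_behead _ _ _)).
  move=> /(IH _ (Sc_update _ _ Sf) (fun w => [tuple of behead (cs w)]) _ mb).
  move=> [/fatten_supp_update -/(_ Sf)[?|[e0 ?]]|[i _]]; first by left.
    by right; exists ord0 => //; rewrite tnth0 e0.
  move=> H; right; exists (lift ord0 i) => //; rewrite tnthS.
  move: H; case: ifP => // _ /=.
  by rewrite tnth_lift0.
- elim: n f Sf cs es mcs => [|n IH] f Sf cs es mcs; first by rewrite updates_nil => -[//|[[]]].
  rewrite (tuple_eta es) => H.
  rewrite (tuple_eta (cs w)) updates_cons.
  have mb : measurable_fun setT (fun w => [tuple of behead (cs w)]).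
    exact: (measurableT_comp (@measurable_behead _ _ _)).
  apply: (IH _ (Sc_update _ _ Sf) (fun w => [tuple of behead (cs w)]) _ mb).
  case: H => [H|[i _]].
    by left; apply/fatten_supp_update => //; left.
  case: (unliftP ord0 i) => [j|] ->.
    rewrite tnthS; case: ifPn => // ej H; right; exists j => //; rewrite ej /=.
    by move: H; rewrite /= tnth_lift0.
  rewrite tnth0; case: ifPn => // e0 H; left.
  by apply/fatten_supp_update => //; right.
Qed.

Lemma measurable_updates_eval dT (T : measurableType dT) n
    (es : n.-tuple bool) (G : T -> 'rV[R]_d -> R) (cs : T -> n.-tuple 'rV[R]_d)
    (x : T -> 'rV[R]_d) :
  measurable_fun setT (fun w => G w (x w)) ->
  measurable_fun setT cs -> measurable_fun setT x ->
  measurable_fun setT (fun w => updates (G w) (cs w) es (x w)).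
Proof.
move=> + + mx; elim: n es G cs => [|n IH] es G cs mG mcs.
  by under eq_fun do rewrite updates_nil.
rewrite (_ : (fun _ => _) = fun w => updates (update (G w) (thead (cs w)) (thead es))
   [tuple of behead (cs w)] [tuple of behead es] (x w)); last first.
  by apply/funext => w; rewrite {1}(tuple_eta (cs w)) {1}(tuple_eta es).
apply: IH; last exact: (measurableT_comp (@measurable_behead _ _ _)).
apply: measurable_funD => //; apply: measurable_funM; last exact: measurable_funB.
apply: measurable_funM => //.
rewrite (_ : (fun _ => _) = \1_[set w | eball (thead (cs w)) rad (x w)]); last first.
  by apply/funext => w; rewrite !indicE; congr (_%:R); apply/idP/idP; rewrite !inE.
apply: measurable_indic; apply: measurable_eball_preimage => //.
exact: (measurableT_comp (@measurable_tnth _ _ _ ord0)).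
Qed.

End states.

(** * Measurability on the state space and growth of the rate *)

Section state_maps.
Context {R : realType} {d : nat}.
Variables rad U : R.
Hypotheses (rad0 : 0 < rad) (U01 : 0 < U < 1).
Local Notation state := (@state R d rad U).
Local Notation update := (@update R d rad U).
Local Notation updates := (@updates R d rad U _).
Local Notation rate := (@rate R d rad).
Implicit Types (f g : 'rV[R]_d -> R) (c x : 'rV[R]_d).

(* The composites of these maps with measurable functions of the state are
   measurable, since the sigma-algebra of the state space is the final one for
   the maps [updates f ^~ e]. *)
Definition reachable_map f dT (T : measurableType dT) (Y : T -> 'rV[R]_d -> R) :=
  exists n (cs : T -> n.-tuple 'rV[R]_d) (es : T -> n.-tuple bool),
    [/\ measurable_fun setT cs, forall e, measurable [set w | es w = e] &
        forall w, Y w = updates f (cs w) (es w)].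

Lemma reachable_map_cst f dT (T : measurableType dT) :
  @reachable_map f _ T (fun=> f).
Proof.
exists 0%N, (fun=> [tuple]), (fun=> [tuple]); split => //.
by move=> e; rewrite [e]tuple0 (_ : [set _ | _] = setT)//; apply/seteqP; split.
Qed.

Lemma reachable_map_updates f n (e : n.-tuple bool) :
  @reachable_map f _ (n.-tuple 'rV[R]_d) (fun c : n.-tuple 'rV[R]_d => updates f c e).
Proof.
exists n, id, (fun=> e); split => // e'.
have [->|ee'] := eqVneq e e'.
  by rewrite (_ : [set _ | _] = setT)//; apply/seteqP; split.
by rewrite (_ : [set _ | _] = set0)//; apply/seteqP; split => // w /= /eqP; rewrite (negbTE ee').
Qed.

Lemma reachable_map_update f dT (T : measurableType dT) (Y : T -> 'rV[R]_d -> R)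
    (x : T -> 'rV[R]_d) (b : T -> bool) :
  reachable_map f Y -> measurable_fun setT x -> measurable (b @^-1` [set true]) ->
  reachable_map f (fun w => update (Y w) (x w) (b w)).
Proof.
move=> [n [cs [es [mcs mes YE]]]] mx mb.
exists n.+1, (fun w => [tuple of rcons (cs w) (x w)]),
  (fun w => [tuple of rcons (es w) (b w)]); split.
- apply/measurable_fun_tnthP => i /=.
  case: (unliftP ord_max i) => [j|] ->.
    rewrite (_ : _ \o _ = (fun t => tnth t j) \o cs).
      exact: (measurableT_comp (@measurable_tnth _ _ _ j)).
    apply/funext => w /=; rewrite (tnth_nth (x w)) (tnth_nth (x w)) /=.
    by rewrite nth_rcons size_tuple /bump (leqNgt n j) ltn_ord add0n ltn_ord.
  rewrite (_ : _ \o _ = x)//; apply/funext => w /=.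
  by rewrite (tnth_nth (x w)) /= nth_rcons size_tuple ltnn eqxx.
- move=> e; pose e1 : n.-tuple bool := [tuple of belast (thead e) (behead e)].
  pose e2 := last (thead e) (behead e).
  have eE : e = [tuple of rcons e1 e2].
    by apply: val_inj; rewrite /= -lastI {1}(tuple_eta e).
  rewrite (_ : [set _ | _] = [set w | es w = e1] `&` (b @^-1` [set e2])).
    apply: measurableI => //; case: e2 {eE} => //.
    rewrite (_ : _ @^-1` _ = ~` (b @^-1` [set true])); first exact: measurableC.
    by apply/seteqP; split => w /=; case: (b w).
  apply/seteqP; split => w /=; rewrite eE.
    by move=> /(congr1 val) /= /rcons_inj [? ?]; split => //; exact: val_inj.
  by move=> [-> ->].
- by move=> w; rewrite updates_rcons YE.
Qed.

Lemma reachable_map_comp f dT (T : measurableType dT) dT' (T' : measurableType dT')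
    (Y : T -> 'rV[R]_d -> R) (h : T' -> T) :
  reachable_map f Y -> measurable_fun setT h -> reachable_map f (Y \o h).
Proof.
move=> [n [cs [es [mcs mes YE]]]] mh; exists n, (cs \o h), (es \o h); split.
- exact: measurableT_comp.
- move=> e; rewrite (_ : [set _ | _] = h @^-1` [set w | es w = e])//.
  by rewrite -[X in measurable X]setTI; exact: mh.
- by move=> w /=; rewrite YE.
Qed.

Section reachable.
Variables (f : 'rV[R]_d -> R) (Sf : Sc f).
Context dT (T : measurableType dT) (Y : T -> 'rV[R]_d -> R).
Hypothesis rY : reachable_map f Y.

(** Random marks take finitely many values; on each piece they are frozen, as in the definition of
    [state_events]. *)
Let split_tuple n (es : T -> n.-tuple bool) (A : T -> Prop) :
  (forall e, measurable [set w | es w = e]) ->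
  (forall e, exists B, measurable B /\ forall w, es w = e -> A w <-> B w) ->
  measurable A.
Proof.
move=> mes /choice[B BP].
rewrite (_ : A = \bigcup_e ([set w | es w = e] `&` B e)).
  apply: countable_bigcupT_measurable => // e; apply: measurableI => //.
  by have [? _] := BP e.
apply/seteqP; split => w.
  by move=> Aw; exists (es w) => //; split => //; apply/(BP (es w)).2.
by move=> [e _ [<- Bw]]; apply/(BP (es w)).2.
Qed.

Lemma measurable_reachable_map : measurable_fun setT (Y : T -> state).
Proof.
case: rY => n [cs [es [mcs mes YE]]] _ A mA; rewrite setTI.
apply: (split_tuple mes) => e.
exists (cs @^-1` [set c | A (updates f c e)]); split.
  rewrite -[X in measurable X]setTI; apply: mcs => //.
  by move: mA; rewrite measurable_stateE; apply.
by move=> w we; rewrite /= YE we.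
Qed.

Lemma measurable_reachable_map_eval (x : T -> 'rV[R]_d) :
  measurable_fun setT x -> measurable_fun setT (fun w => Y w (x w)).
Proof.
case: rY => n [cs [es [mcs mes YE]]] mx _ A mA; rewrite setTI.
apply: (split_tuple mes) => e.
exists ((fun w => updates f (cs w) e (x w)) @^-1` A); split.
  rewrite -[X in measurable X]setTI; apply: measurable_updates_eval => //.
  by apply: measurableT_comp => //; case: Sf.
by move=> w we; rewrite /= YE we.
Qed.

End reachable.

Lemma measurable_state_fun dT (T : measurableType dT) (h : state -> T) :
  (forall f n (e : n.-tuple bool), Sc f ->
    measurable_fun setT (fun c : n.-tuple 'rV[R]_d => h (updates f c e))) ->
  measurable_fun setT h.
Proof.
move=> mh _ B mB; rewrite setTI measurable_stateE => f Sf n e.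
by rewrite -[X in measurable X]setTI; exact: (mh f n e Sf measurableT).
Qed.

Lemma measurable_state0 : measurable ([set cst 0] : set state).
Proof.
rewrite measurable_stateE => f Sf n e.
rewrite (_ : [set _ | _] = [set _ | f = cst 0 /\ all negb e]).
  have [h|h] := pselect (f = cst 0 /\ all negb e).
    by rewrite (_ : [set _ | _] = setT)//; apply/seteqP; split.
  by rewrite (_ : [set _ | _] = set0)//; apply/seteqP; split.
by apply/seteqP; split => c /= /(updates_eq0 rad0 U01 _ _ Sf).
Qed.

Lemma rate0 : rate (cst 0) = 0%E.
Proof.
rewrite /Defs.rate /supp (_ : [set x | _] = set0) ?closure0 ?fatten0 ?measure0//.
by apply/seteqP; split => x //=; rewrite eqxx.
Qed.

Lemma rate_ge0 g : (0 <= rate g)%E.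
Proof. exact: measure_ge0. Qed.

Lemma rate_fin g : Sc g -> rate g \is a fin_num.
Proof.
move=> [_ _ cg]; rewrite ge0_fin_numE ?rate_ge0//.
exact/lebesgue_compact_lty/compact_fatten.
Qed.

Lemma rate_gt0 g : Sc g -> g <> cst 0 -> (0 < rate g)%E.
Proof.
move=> [_ _ cg] g0; have [x gx] : exists x, g x != 0.
  by apply: contra_notP g0 => h; apply/funext => x; apply/eqP/negPn/negP => gx; apply: h; exists x.
apply: (lt_le_trans (lebesgue_eball_gt0 x rad0)); apply: le_measure; rewrite ?inE.
- by apply: closed_measurable_rV; exact: closed_eball.
- exact: measurable_fatten.
- by move=> y xy; exists x => //; exact: subset_supp.
Qed.

(** Volume of the cube of half-side [rad *+ 2], which contains the ball of radius [rad] around a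
    centre, fattened by [rad]. *)
Definition rate_jump : R := (rad *+ 4) ^+ d.

Lemma rate_jump_ge0 : 0 <= rate_jump.
Proof. by rewrite exprn_ge0// mulrn_wge0// ltW. Qed.

Lemma rate_update g c e : Sc g -> (rate (update g c e) <= rate g + rate_jump%:E)%E.
Proof.
move=> Sg; have rad20 : 0 <= rad *+ 2 by rewrite mulrn_wge0// ltW.
have := lebesgue_cube c rad20; rewrite -mulrnA => <-.
apply: le_trans (measureU2 _ _ _); last 2 first.
- by apply: measurable_fatten; case: Sg.
- exact: measurable_cube.
apply: le_measure; rewrite ?inE.
- by apply: measurable_fatten; have [] := Sc_update rad U01 c e Sg.
- apply: measurableU; last exact: measurable_cube.
  by apply: measurable_fatten; case: Sg.
- move=> x /(fatten_supp_update rad U01 _ _ _ Sg)[|[_]]; first by left.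
  move=> [y y0 xy]; right => i.
  have := coord_le_enorm (x - c - y) i; have := coord_le_enorm (y - 0) i.
  rewrite !mxE subr0 mulr2n => h1 h2.
  rewrite -(subrK (y ord0 i) (x ord0 i - c ord0 i)).
  rewrite (le_trans (ler_normD _ _))// lerD//.
    exact: le_trans xy.
  exact: le_trans y0.
Qed.

Lemma measurable_rate : measurable_fun setT (rate : state -> \bar R).
Proof.
apply: measurable_state_fun => f n e Sf.
have mA : measurable [set p : n.-tuple 'rV[R]_d * 'rV[R]_d |
    fatten (supp (updates f p.1 e)) rad p.2].
  exact: measurable_fatten_supp_updates.
have := measurable_fun_xsection (@lebesgue_rV R d) mA.
congr (measurable_fun _ _); apply/funext => c; rewrite /Defs.rate/= xsectionE.
by [].
Qed.

End state_maps.

Lemma nneseries_semi_sigma_additive d (T : measurableType d) (R : realType)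
    (m : set T -> \bar R) : (forall A, 0 <= m A)%E ->
  (forall F : (set T)^nat, (forall n, measurable (F n)) -> trivIset setT F ->
    m (\bigcup_n F n) = \sum_(n <oo) m (F n))%E ->
  semi_sigma_additive m.
Proof.
move=> m0 mU F mF tF _; rewrite mU//.
by apply: is_cvg_nneseries => n _ _; exact: m0.
Qed.

(** Inversion jumps at 0, where its value is 0 by convention; measurability is inherited from the
    power function with exponent -1, which has the same value there. *)
Lemma ge0_measurable_inv d (T : measurableType d) (R : realType) (f : T -> R) :
  (forall x, 0 <= f x) -> measurable_fun setT f ->
  measurable_fun setT (fun x => (f x)^-1).
Proof.
move=> f0 mf; rewrite (_ : (fun x => _) = (@powR R ^~ (-1)) \o f).
  exact: (measurableT_comp (@measurable_powR R (-1)) mf).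
by apply/funext => x /=; rewrite powR_inv1.
Qed.

(** * The one-step kernel *)

Section step.
Context {R : realType} {d : nat}.
Variables rad U : R.
Hypotheses (rad0 : 0 < rad) (U01 : 0 < U < 1).
Local Notation state := (@state R d rad U).
Local Notation update := (@update R d rad U).
Local Notation updates := (@updates R d rad U _).
Local Notation rate := (@rate R d rad).
Implicit Types (f g : 'rV[R]_d -> R) (h : state -> \bar R).

(** Average over the uniform variable deciding the mark. In the null state the weight of mark 1 is
    0, in agreement with the guard in [mark]. *)
Definition update_mean h g c : \bar R :=
  ((g c)%:E * h (update g c true) + (1 - g c)%:E * h (update g c false))%E.

(** A kernel has to be given on the whole function space: the state stays put where no uniform
    centre makes sense, that is off [Sc] and at the null function. *)
Definition step h (g : state) : \bar R :=
  if `[< Sc g /\ g <> cst 0 >] then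
    ((fine (rate g))^-1%:E *
     \int[@lebesgue_rV R d]_(c in fatten (supp g) rad) update_mean h g c)%E
  else h g.

Lemma measurable_fine_rate : measurable_fun setT (fun g : state => fine (rate g)).
Proof.
by apply: (measurableT_comp (fine_measurable measurableT)); exact: measurable_rate.
Qed.

Lemma measurable_inv_rate : measurable_fun setT (fun g : state => (fine (rate g))^-1).
Proof.
apply: ge0_measurable_inv measurable_fine_rate => g.
by rewrite fine_ge0// measure_ge0.
Qed.

Lemma update_mean_ge0 h g c : Sc g -> (forall y, 0 <= h y)%E ->
  (0 <= update_mean h g c)%E.
Proof.
move=> [_ g01 _] h0; have /andP[g0 g1] := g01 c.
by apply: adde_ge0; apply: mule_ge0; rewrite ?lee_fin ?subr_ge0.
Qed.

Lemma measurable_update_mean h f dT (T : measurableType dT)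
    (Y : T -> 'rV[R]_d -> R) (x : T -> 'rV[R]_d) :
  Sc f -> reachable_map rad U f Y -> measurable_fun setT x ->
  measurable_fun setT h ->
  measurable_fun setT (fun w => update_mean h (Y w) (x w)).
Proof.
move=> Sf rY mx mh.
have mY : measurable_fun setT (fun w => Y w (x w)).
  exact: (measurable_reachable_map_eval Sf rY).
have mU (e : bool) : measurable_fun setT (fun w => h (update (Y w) (x w) e)).
  have mY' : measurable_fun setT ((fun w => update (Y w) (x w) e) : T -> state).
    apply: (measurable_reachable_map Sf); apply: reachable_map_update => //.
    case: e; first by rewrite (_ : _ @^-1` _ = setT)//; apply/seteqP; split.
    by rewrite (_ : _ @^-1` _ = set0)//; apply/seteqP; split.
  exact: (measurableT_comp mh mY').
apply: emeasurable_funD; apply: emeasurable_funM => //; apply/measurable_EFinP => //.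
exact: measurable_funB.
Qed.

Lemma measurable_update_mean_cst h g : Sc g -> measurable_fun setT h ->
  measurable_fun setT (update_mean h g).
Proof.
move=> Sg mh.
apply: (@measurable_update_mean h g _ 'rV[R]_d (fun=> g) id) => //.
exact: reachable_map_cst.
Qed.

Lemma step_ge0 h g : (forall y, 0 <= h y)%E -> (0 <= step h g)%E.
Proof.
move=> h0; rewrite /step; case: ifPn => // /asboolP[Sg _].
apply: mule_ge0; first by rewrite lee_fin invr_ge0 fine_ge0// measure_ge0.
by apply: integral_ge0 => c _; exact: update_mean_ge0.
Qed.

(** For fixed [f] and marks, either all states are null and [step h] is [h], or none is. In the
    latter case the domain of integration varies with the centres, so its indicator is moved into
    the integrand and Tonelli applies. *)
Lemma measurable_step h : (forall y, 0 <= h y)%E -> measurable_fun setT h ->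
  measurable_fun setT (step h).
Proof.
move=> h0 mh; apply: measurable_state_fun => f n e Sf.
have rY := @reachable_map_updates R d rad U f n e.
have [z|nz] := pselect (f = cst 0 /\ all negb e).
  rewrite (_ : (fun c => _) = fun c => h (updates f c e)).
    exact: (measurableT_comp mh (measurable_reachable_map Sf rY)).
  apply/funext => c; rewrite /step; case: ifPn => // /asboolP[_].
  by move=> /(_ ((updates_eq0 rad0 U01 _ _ Sf).2 z)).
pose A := [set p : n.-tuple 'rV[R]_d * 'rV[R]_d |
    fatten (supp (updates f p.1 e)) rad p.2].
pose F (p : n.-tuple 'rV[R]_d * 'rV[R]_d) :=
  ((update_mean h (updates f p.1 e) p.2) * (\1_A p)%:E)%E.
have F0 p : (0 <= F p)%E.
  apply: mule_ge0; last by rewrite lee_fin.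
  by apply: update_mean_ge0 => //; exact: Sc_updates.
have mF : measurable_fun setT F.
  apply: emeasurable_funM.
    apply: (@measurable_update_mean h f _ _
      (fun p : n.-tuple 'rV[R]_d * 'rV[R]_d => updates f p.1 e) snd) => //.
    exact: (reachable_map_comp rY).
  apply/measurable_EFinP; apply: measurable_indic.
  exact: measurable_fatten_supp_updates.
rewrite (_ : (fun c => _) = fun c : n.-tuple 'rV[R]_d =>
  (((fine (rate (updates f c e)))^-1)%:E * \int[@lebesgue_rV R d]_x F (c, x))%E).
  apply: emeasurable_funM.
    apply/measurable_EFinP.
    rewrite (_ : (fun c => _) = (fun g : state => (fine (rate g))^-1) \o
      (fun c => updates f c e))//.
    exact: (measurableT_comp measurable_inv_rate
      (measurable_reachable_map Sf rY)).
  exact: (@measurable_fun_fubini_tonelli_F _ _ _ _ _ (@lebesgue_rV R d) F).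
apply/funext => c; rewrite /step ifT; last first.
  apply/asboolP; split; first exact: Sc_updates.
  by move=> /(updates_eq0 rad0 U01 _ _ Sf).
congr (_ * _)%E; rewrite integral_mkcond; apply: eq_integral => x _.
rewrite patchE /F indicE /A.
rewrite (_ : ((c, x) \in _) = (x \in fatten (supp (updates f c e)) rad)); last first.
  by apply/idP/idP; rewrite !inE.
by case: ifPn; rewrite ?mule1 ?mule0.
Qed.

Lemma step_cst1 g : step (fun=> 1%E) g = 1%E.
Proof.
rewrite /step; case: ifPn => // /asboolP[Sg g0].
have r0 := rate_gt0 rad0 Sg g0; have rf := rate_fin rad Sg.
rewrite (eq_integral (cst 1%E)); last first.
  by move=> c _; rewrite /update_mean !mule1 -EFinD addrC subrK.
rewrite integral_cst ?mul1e; last by apply: measurable_fatten; case: Sg.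
rewrite -[X in (_ * X)%E](fineK rf) -EFinM mulVf// gt_eqF//.
by rewrite fine_gt0// r0 ltey_eq rf.
Qed.

Lemma step_nneseries (h : nat -> state -> \bar R) g :
  (forall n y, 0 <= h n y)%E -> (forall n, measurable_fun setT (h n)) ->
  step (fun y => \sum_(n <oo) h n y)%E g = (\sum_(n <oo) step (h n) g)%E.
Proof.
move=> h0 mh; rewrite /step; case: ifPn => // /asboolP[Sg g0].
rewrite nneseriesZl; last first.
  by move=> n _; apply: integral_ge0 => c _; exact: update_mean_ge0.
congr (_ * _)%E; rewrite -integral_nneseries.
- apply: eq_integral => c _; rewrite /update_mean.
  have [_ /(_ c)/andP[gc0 gc1] _] := Sg.
  by rewrite nneseriesD ?nneseriesZl// => n _ _; rewrite mule_ge0// lee_fin ?subr_ge0.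
- by apply: measurable_fatten; case: Sg.
- by move=> n; apply: measurable_funTS; exact: measurable_update_mean_cst.
- by move=> n c _; exact: update_mean_ge0.
Qed.

Lemma step_kernel : exists K : R.-pker state ~> state,
  forall g A, K g A = step (fun y => (\1_A y)%:E) g.
Proof.
have h0 A (y : state) : (0 <= (\1_A y)%:E :> \bar R)%E by rewrite lee_fin.
have mh (A : set state) : measurable A -> measurable_fun setT (fun y => (\1_A y)%:E : \bar R).
  by move=> mA; apply/measurable_EFinP; exact: measurable_indic.
apply: probability_kernel_of_fun.
- move=> g; rewrite /step/update_mean; case: ifPn => _; last by rewrite indic0.
  rewrite integral0_eq ?mule0// => c _.
  by rewrite !indic0 !mule0 adde0.
- by move=> g A; exact: step_ge0.
- move=> g; apply: nneseries_semi_sigma_additive => [A|F mF tF].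
    exact: step_ge0.
  rewrite -step_nneseries => //; last by move=> n; exact: mh.
  by congr step; apply/funext => y; rewrite indic_bigcup.
- by move=> A mA; apply: measurable_step => //; exact: mh.
- by move=> g; under eq_fun do rewrite indicT; exact: step_cst1.
Qed.

End step.

(** * Transition probabilities of a pure jump process *)

Section integral_le1.
Local Open Scope ereal_scope.
Context d (T : measurableType d) (R : realType).
Variable m : {measure set T -> \bar R}.

Lemma integral_le1 (f : T -> \bar R) : m setT = 1 -> measurable_fun setT f ->
  (forall x, 0 <= f x) -> (forall x, f x <= 1) -> \int[m]_x f x <= 1.
Proof.
move=> m1 mf f0 f1; apply: (@le_trans _ _ (\int[m]_x cst 1 x)).
  by apply: ge0_le_integral.
by rewrite integral_cst// m1 mul1e.
Qed.

End integral_le1.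

Section jump_kernel.
Local Open Scope ereal_scope.
Context {dS : measure_display} {S : measurableType dS} {R : realType}.
Variables (K : R.-pker S ~> S) (q : S -> R) (s0 : S).
Hypotheses (q_ge0 : forall g, (0 <= q g)%R) (mq : measurable_fun setT q).

(* [jumps_given m A g t u] is the probability that the jump process started
   from [g] jumps exactly [m] times before time [t] and is then in [A], given
   that the first holding time is [u / q g]; no jump occurs if [q g = 0]. *)
Fixpoint jumps_given (m : nat) (A : set S) (g : S) (t u : R) : \bar R :=
  match m with
  | 0 => if (0 <= t)%R && (q g * t < u)%R then (\1_A g)%:E else 0
  | m'.+1 => if (u <= q g * t)%R then
      \int[K g]_y \int[expo]_v jumps_given m' A y (t - u / q g)%R v else 0
  end.

Definition jumps m A g t := \int[expo]_u jumps_given m A g t u.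

Lemma jumps_given_ge0 m A g t u : 0 <= jumps_given m A g t u.
Proof.
elim: m g t u => [|m IH] g t u /=; case: ifPn => // _.
by apply: integral_ge0 => y _; apply: integral_ge0.
Qed.

Lemma jumps_ge0 m A g t : 0 <= jumps m A g t.
Proof. by apply: integral_ge0 => u _; exact: jumps_given_ge0. Qed.

Let measurable_jumps_of (f : S -> R -> R -> \bar R) :
  (forall g t u, 0 <= f g t u) ->
  measurable_fun setT (fun z : S * R * R => f z.1.1 z.1.2 z.2) ->
  measurable_fun setT (fun z : S * R => \int[expo]_u f z.1 z.2 u).
Proof.
move=> f0 mf.
exact: (@measurable_fun_fubini_tonelli_F _ _ _ (measurableTypeR R) _ (@expo R)
  (fun z : (S * R) * measurableTypeR R => f z.1.1 z.1.2 z.2)).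
Qed.

(** [K] with idle parameters for the time and the holding variable, the form in which integrals
    against a kernel are known to be measurable in all parameters jointly. *)
Let Kfst_ex : exists k : R.-pker (S * R * R)%type ~> S, forall z A, k z A = K z.1.1 A.
Proof.
apply: probability_kernel_of_fun.
- by move=> z; exact: (measure0 (K z.1.1)).
- by move=> z A; exact: (measure_ge0 (K z.1.1)).
- by move=> z; exact: (@measure_semi_sigma_additive _ _ _ (K z.1.1)).
- by move=> A mA; apply: (measurableT_comp (measurable_kernel K _ mA)); exact: measurableT_comp.
- by move=> z; exact: (prob_kernel z.1.1).
Qed.

(** An elapsed time [r] without jump lengthens the horizon by [r] and the first holding variable by
    [q g * r]; after the first jump only [t - u / q g] matters, and it is unchanged. If [q g = 0],
    no jump is possible because [u] is positive. *)
Lemma jumps_given_shift m A g r t u : (0 <= r)%R -> (0 <= t)%R -> (0 < u)%R ->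
  jumps_given m A g (r + t)%R (q g * r + u)%R = jumps_given m A g t u.
Proof.
move=> r0 t0 u0; case: m => [|m] /=.
  by rewrite addr_ge0// t0 mulrDr ltrD2l.
rewrite mulrDr lerD2l; case: ifPn => // ut; do 2 apply: eq_integral => ? _.
have q0 : q g != 0%R.
  by apply: contraTN ut => /eqP ->; rewrite mul0r -ltNge.
by congr jumps_given; rewrite mulrDl mulrAC divff// mul1r; lra.
Qed.

Lemma measurable_jumps_given m A : measurable A ->
  measurable_fun setT (fun z : S * R * R => jumps_given m A z.1.1 z.1.2 z.2).
Proof.
move=> mA.
have mg : measurable_fun setT (fun z : S * R * R => z.1.1) by exact: measurableT_comp.
have mt : measurable_fun setT (fun z : S * R * R => z.1.2) by exact: measurableT_comp.
have mu : measurable_fun setT (fun z : S * R * R => z.2) by exact: measurable_snd.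
have mqg : measurable_fun setT (fun z : S * R * R => q z.1.1) by exact: measurableT_comp.
have mqt : measurable_fun setT (fun z : S * R * R => q z.1.1 * z.1.2)%R.
  exact: measurable_funM.
elim: m => [|m IH] /=.
  apply: measurable_fun_ifT => //.
    apply: measurable_and; first exact: measurable_fun_ler.
    exact: measurable_fun_ltr.
  apply/measurable_EFinP; apply: (measurableT_comp _ mg).
  exact: measurable_indic.
apply: measurable_fun_ifT => //; first exact: measurable_fun_ler.
have [k kE] := Kfst_ex.
rewrite (_ : (fun z => _) = fun z : S * R * R =>
    \int[k z]_y jumps m A y (z.1.2 - z.2 / q z.1.1)%R); last first.
  by apply/funext => z; apply: eq_measure_integral => B mB _; rewrite kE.
apply: (@measurable_fun_integral_sfinite_kernel _ _ _ _ _
  (fun p : (S * R * R) * S => jumps m A p.2 (p.1.1.2 - p.1.2 / q p.1.1.1)%R)).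
  by move=> p; exact: jumps_ge0.
have mJ := measurable_jumps_of (@jumps_given_ge0 m A) IH.
have m1 : measurable_fun setT (fun p : (S * R * R) * S => p.1).
  exact: measurable_fst.
have m2 : measurable_fun setT (fun p : (S * R * R) * S =>
    (p.2, (p.1.1.2 - p.1.2 / q p.1.1.1)%R)).
  apply/measurable_fun_pair; first exact: measurable_snd.
  apply: measurable_funB; first exact: (measurableT_comp mt m1).
  apply: measurable_funM; first exact: (measurableT_comp mu m1).
  by apply: ge0_measurable_inv => //; exact: (measurableT_comp mqg m1).
exact: (measurableT_comp mJ m2).
Qed.

Lemma measurable_jumps m A : measurable A ->
  measurable_fun setT (fun z : S * R => jumps m A z.1 z.2).
Proof.
by move=> mA; apply: measurable_jumps_of (measurable_jumps_given m mA); exact: jumps_given_ge0.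
Qed.

Lemma measurable_jumps_given_last m A g t : measurable A ->
  measurable_fun setT (jumps_given m A g t : measurableTypeR R -> \bar R).
Proof.
move=> mA; exact: (measurableT_comp (measurable_jumps_given m mA) (measurable_pair1 (g, t))).
Qed.

Lemma measurable_jumps_first m A t : measurable A ->
  measurable_fun setT (fun g => jumps m A g t).
Proof.
move=> mA; exact: (measurableT_comp (measurable_jumps m mA) (measurable_pair2 t)).
Qed.

Lemma jumps_given_nneseries m (F : (set S)^nat) g t u :
  (forall n, measurable (F n)) -> trivIset setT F ->
  jumps_given m (\bigcup_n F n) g t u = \sum_(n <oo) jumps_given m (F n) g t u.
Proof.
move=> mF tF; elim: m g t u => [|m IH] g t u /=.
  by case: ifPn => _; rewrite ?indic_bigcup// eseries0.
case: ifPn => _; last by rewrite eseries0.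
under eq_integral => y _ do under eq_integral => v _ do rewrite IH.
under eq_integral => y _.
  rewrite integral_nneseries//.
  - over.
  - by move=> n; exact: measurable_jumps_given_last.
  - by move=> n v _; exact: jumps_given_ge0.
rewrite integral_nneseries//.
- by move=> n; exact: measurable_jumps_first.
- by move=> n y _; exact: jumps_ge0.
Qed.

Lemma jumps_nneseries m (F : (set S)^nat) g t :
  (forall n, measurable (F n)) -> trivIset setT F ->
  jumps m (\bigcup_n F n) g t = \sum_(n <oo) jumps m (F n) g t.
Proof.
move=> mF tF; rewrite /jumps -integral_nneseries//.
- by apply: eq_integral => u _; exact: jumps_given_nneseries.
- by move=> n; exact: measurable_jumps_given_last.
- by move=> n v _; exact: jumps_given_ge0.
Qed.

Lemma jumps_set0 m g t : jumps m set0 g t = 0.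
Proof.
apply: integral0_eq => u _; elim: m g t u => [|m IH] g t u /=.
  by rewrite indic0; case: ifP.
case: ifP => // _; apply: integral0_eq => y _; exact: integral0_eq.
Qed.

(** If [u] exceeds [q g * t], only the term without jump survives. Otherwise that term vanishes and
    the others are an average, over the next state and holding variable, of sums already bounded by
    1. *)
Lemma sum_jumps_given_le1 N g t u : \sum_(m < N) jumps_given m setT g t u <= 1.
Proof.
elim: N g t u => [|N IH] g t u; first by rewrite big_ord0.
rewrite big_ord_recl /=; have [ut|ut] := leP u (q g * t)%R; last first.
  rewrite big1 ?adde0; last by [].
  by case: ifPn => // _; rewrite indicT.
rewrite andbF add0e.
rewrite -(@ge0_integral_sum _ _ _ (K g) setT measurableT _
  (fun (m : 'I_N) y => jumps m setT y (t - u / q g)%R)); last 2 first.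
- by move=> m; exact: measurable_jumps_first.
- by move=> m y _; exact: jumps_ge0.
apply: integral_le1.
- exact: prob_kernel.
- by apply: emeasurable_sum => m; exact: measurable_jumps_first.
- by move=> y; apply: sume_ge0 => m _; exact: jumps_ge0.
move=> y; rewrite /jumps -(@ge0_integral_sum _ _ _ expo setT measurableT _
  (fun (m : 'I_N) v => jumps_given m setT y (t - u / q g)%R v)); last 2 first.
- by move=> m; exact: measurable_jumps_given_last.
- by move=> m v _; exact: jumps_given_ge0.
apply: integral_le1.
- exact: probability_setT.
- by apply: emeasurable_sum => m; exact: measurable_jumps_given_last.
- by move=> v; apply: sume_ge0 => m _; exact: jumps_given_ge0.
- by move=> v; exact: IH.
Qed.

Definition jump_mass A g t := \sum_(m <oo) jumps m A g t.

Lemma jump_mass_ge0 A g t : 0 <= jump_mass A g t.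
Proof. by apply: nneseries_ge0 => m _ _; exact: jumps_ge0. Qed.

Lemma jump_mass_le1 g t : jump_mass setT g t <= 1.
Proof.
apply: lime_le; first by apply: is_cvg_nneseries => m _ _; exact: jumps_ge0.
apply: nearW => N; rewrite big_mkord.
rewrite /jumps -(@ge0_integral_sum _ _ _ expo setT measurableT _
  (fun (m : 'I_N) v => jumps_given m setT g t v)); last 2 first.
- by move=> m; exact: measurable_jumps_given_last.
- by move=> m v _; exact: jumps_given_ge0.
apply: integral_le1.
- exact: probability_setT.
- by apply: emeasurable_sum => m; exact: measurable_jumps_given_last.
- by move=> v; apply: sume_ge0 => m _; exact: jumps_given_ge0.
- by move=> v; exact: sum_jumps_given_le1.
Qed.

Lemma measurable_jump_mass A t : measurable A ->
  measurable_fun setT (fun g => jump_mass A g t).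
Proof.
move=> mA; rewrite (_ : (fun g => _) = fun g => \sum_(i <oo | i \in xpredT) jumps i A g t)//.
apply: ge0_emeasurable_sum.
- by move=> k x _ _; exact: jumps_ge0.
- by move=> k _; exact: measurable_jumps_first.
Qed.

(* The mass possibly lost by explosion is put on [s0], which makes a probability
   kernel out of [jump_mass] without any condition on [q]. *)
Lemma jump_kernel_ex t : exists p : R.-pker S ~> S, forall g A,
  p g A = jump_mass A g t + (1 - jump_mass setT g t) * (\1_A s0)%:E.
Proof.
have fm g : jump_mass setT g t \is a fin_num.
  rewrite ge0_fin_numE ?jump_mass_ge0//.
  exact: le_lt_trans (jump_mass_le1 _ _) (ltry _).
have defect0 g : 0 <= 1 - jump_mass setT g t.
  by rewrite sube_ge0 ?jump_mass_le1// fm.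
have h0 g A : 0 <= jump_mass A g t + (1 - jump_mass setT g t) * (\1_A s0)%:E.
  by rewrite adde_ge0 ?jump_mass_ge0// mule_ge0// lee_fin.
apply: probability_kernel_of_fun => //.
- move=> g; rewrite indic0 mule0 adde0 /jump_mass eseries0// => m _ _.
  exact: jumps_set0.
- move=> g; apply: nneseries_semi_sigma_additive => // F mF tF.
  rewrite nneseriesD; last 2 first.
  - by move=> n _ _; exact: jump_mass_ge0.
  - by move=> n _ _; rewrite mule_ge0// lee_fin.
  congr (_ + _).
    rewrite /jump_mass nneseries_interchange; last by move=> i j; exact: jumps_ge0.
    by apply: eq_eseriesr => m _; exact: jumps_nneseries.
  have df : 1 - jump_mass setT g t \is a fin_num by rewrite fin_numB fm.
  rewrite -(fineK df) nneseriesZl; last by move=> n _; rewrite lee_fin.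
  by rewrite indic_bigcup.
- move=> A mA; apply: emeasurable_funD; first exact: measurable_jump_mass.
  apply: emeasurable_funM => //; apply: emeasurable_funB => //.
  exact: measurable_jump_mass.
- by move=> g; rewrite indicT mule1 addeC subeK.
Qed.

End jump_kernel.

(** * Sub-sigma-algebras and independence *)

Section density.
Context d (T : measurableType d) (R : realType).
Variables (mu : {measure set T -> \bar R}) (f : T -> \bar R).
Hypotheses (mf : measurable_fun setT f) (f0 : forall x, (0 <= f x)%E).

Let density (A : set T) := (\int[mu]_(x in A) f x)%E.

Let density0 : density set0 = 0%E.
Proof. by rewrite /density integral_set0. Qed.

Let density_ge0 A : (0 <= density A)%E.
Proof. exact: integral_ge0. Qed.

Let density_sigma_additive : semi_sigma_additive density.
Proof.
apply: nneseries_semi_sigma_additive => // F mF tF.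
rewrite /density ge0_integral_bigcup//; exact: measurable_funTS.
Qed.

HB.instance Definition _ := isMeasure.Build _ _ _ density
  density0 density_ge0 density_sigma_additive.

Lemma density_measure : exists m : {measure set T -> \bar R},
  forall A, m A = (\int[mu]_(x in A) f x)%E.
Proof. by exists density. Qed.

End density.

Lemma generated_measure_unique d (T : measurableType d) (R : realType)
    (G : set (set T)) (m1 m2 : {measure set T -> \bar R}) :
  G `<=` measurable -> setI_closed G -> G setT ->
  (forall A, G A -> m1 A = m2 A) -> (m1 setT < +oo)%E ->
  forall A, <<s G >> A -> m1 A = m2 A.
Proof.
move=> GT GI GsT m12 m1oo.
apply: (@g_sigma_algebra_measure_unique _ R T G GT (fun=> setT)) => //.
by rewrite bigcup_const//; exists 0%N.
Qed.

Section sub_sigma_algebras.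
Context d (T : measurableType d) (R : realType).
Variable P : probability T R.
Implicit Types F G H : set (set T).

Lemma measurable_sub_id G : G `<=` measurable ->
  measurable_fun setT (id : T -> g_sigma_algebraType G).
Proof.
move=> GT _ A mA; rewrite setTI; apply: smallest_sub mA => //.
exact: sigma_algebra_measurable.
Qed.

Lemma measurable_sub_sub F G : F `<=` <<s G >> ->
  measurable_fun setT (id : g_sigma_algebraType G -> g_sigma_algebraType F).
Proof.
move=> FG _ A mA; rewrite setTI; apply: smallest_sub mA => //.
exact: smallest_sigma_algebra.
Qed.

Lemma measurable_sub_fun F d' (S : measurableType d') (h : T -> S) :
  F `<=` measurable ->
  measurable_fun setT (h : g_sigma_algebraType F -> S) ->
  measurable_fun setT h.
Proof. by move=> FT mh; exact: (measurableT_comp mh (measurable_sub_id FT)). Qed.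

(** Independence is disintegration with a constant kernel, applied to the identity into each of the
    two sub-sigma-algebras. *)
Lemma integral_independent F G (phi : T -> \bar R) D :
  F `<=` measurable -> G `<=` measurable ->
  (forall A B, <<s F >> A -> <<s G >> B -> P (A `&` B) = (P A * P B)%E) ->
  measurable_fun setT (phi : g_sigma_algebraType F -> \bar R) ->
  (forall w, 0 <= phi w)%E -> <<s G >> D ->
  (\int[P]_(w in D) phi w = P D * \int[P]_w phi w)%E.
Proof.
move=> FT GT FG mphi phi0 GD.
have mF := measurable_sub_id FT; have mG := measurable_sub_id GT.
have [k kE] : exists k : R.-pker (g_sigma_algebraType F) ~> (g_sigma_algebraType G),
    forall x A, k x A = push_measure mG P A.
  apply: probability_kernel_of_fun.
  - by move=> x; exact: measure0.
  - by move=> x A; exact: measure_ge0.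
  - by move=> x; exact: measure_semi_sigma_additive.
  - by move=> A mA; exact: measurable_cst.
  - by move=> x; exact: probability_setT.
pose psi (z : g_sigma_algebraType F * g_sigma_algebraType G) : \bar R :=
  (phi z.1 * (\1_D z.2)%:E)%E.
have psi0 z : (0 <= psi z)%E by rewrite mule_ge0// lee_fin.
have mD : measurable (D : set (g_sigma_algebraType G)) by [].
have mpsi : measurable_fun setT psi.
  apply: emeasurable_funM; first exact: (measurableT_comp mphi (@measurable_fst _ _ _ _)).
  apply/measurable_EFinP.
  exact: (measurableT_comp (measurable_indic mD) (@measurable_snd _ _ _ _)).
have mDT : measurable (D : set T).
  by apply: smallest_sub GD => //; exact: sigma_algebra_measurable.
transitivity (\int[P]_w psi (w, w))%E.
  rewrite integral_mkcond; apply: eq_integral => w _.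
  by rewrite patchE /psi/= indicE; case: ifPn; rewrite ?mule1 ?mule0.
rewrite (@disintegration _ _ _ T (g_sigma_algebraType F) (g_sigma_algebraType G)
  R P id id mF mG k psi)//; last first.
  move=> A B mA mB /=; rewrite FG//.
  rewrite (eq_integral (cst (P B))); last by move=> w _; rewrite kE.
  rewrite integral_cst//; first by rewrite muleC.
  by apply: smallest_sub mA => //; exact: sigma_algebra_measurable.
rewrite muleC -ge0_integralZr//; last exact: measurable_sub_fun mphi.
apply: eq_integral => w _; rewrite /psi/= ge0_integralZl//; last first.
  by apply/measurable_EFinP; exact: measurable_indic.
by rewrite integral_indic// setIT kE.
Qed.

End sub_sigma_algebras.

Lemma integral_uniform_le (R : realType) (a : R) (x y : \bar R) :
  0 <= a <= 1 -> (0 <= x)%E -> (0 <= y)%E ->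
  (\int[uniform_prob (@ltr01 R)]_v (if (v <= a)%R then x else y) =
   a%:E * x + (1 - a)%:E * y)%E.
Proof.
move=> /andP[a0 a1] x0 y0.
have mle : measurable_fun setT (fun v : measurableTypeR R => (v <= a)%R).
  by apply: measurable_fun_ler.
rewrite integral_uniform; last 2 first.
- exact: measurable_fun_ifT.
- by move=> v; case: ifP.
rewrite subr0 invr1 mul1e.
rewrite (_ : `[0, 1]%classic = `[0, a]%classic `|` `]a, 1]%classic); last first.
  apply/seteqP; split => v /=; rewrite !in_itv/=.
    by move=> /andP[v0 v1]; have [va|va] := leP v a; [left|right]; rewrite ?v0 ?v1 ?andbT.
  by move=> [|] /andP[? ?]; apply/andP; split; lra.
rewrite ge0_integral_setU//=; last 3 first.
- by apply: measurable_funTS; exact: measurable_fun_ifT.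
- by move=> v _; case: ifP.
- apply/disj_setPS => v [] /=; rewrite !in_itv/=; lra.
congr (_ + _)%E.
  rewrite (eq_integral (cst x)) => [|v]; last first.
    by rewrite inE/= in_itv/= => /andP[_ ->].
  rewrite integral_cst// muleC; congr (_ * _)%E.
  have := @lebesgue_measure_itv R `[0, a]; rewrite /= lte_fin => ->.
  case: ltP => ha; first by rewrite sube0.
  by rewrite (_ : a = 0)//; lra.
rewrite (eq_integral (cst y)) => [|v]; last first.
  by rewrite inE/= in_itv/= => /andP[av _]; rewrite leNgt av.
rewrite integral_cst// muleC; congr (_ * _)%E.
have := @lebesgue_measure_itv R `]a, 1]; rewrite /= lte_fin => ->.
case: ltP => ha; first by rewrite -EFinB.
by rewrite (_ : 1 - a = 0)//; lra.
Qed.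

(** Infinite [x] is covered too: both sides are then 0, by the convention for [fine]. *)
Lemma fineZl (R : realType) (r : R) (x : \bar R) : fine (r%:E * x)%E = r * fine x.
Proof.
have [->|r0] := eqVneq r 0; first by rewrite mul0e mul0r.
case: x => [x| |]; first by [].
  have [r0'|r0'] := ltP 0 r.
    by rewrite gt0_muley ?lte_fin//= mulr0.
  by rewrite lt0_muley ?lte_fin ?lt_neqAle ?r0//= mulr0.
have [r0'|r0'] := ltP 0 r.
  by rewrite gt0_muleNy ?lte_fin//= mulr0.
by rewrite lt0_muleNy ?lte_fin ?lt_neqAle ?r0//= mulr0.
Qed.

(** * Test functions *)

Section test_functions.
Context {R : realType} {d : nat}.
Variables rad U : R.
Hypotheses (rad0 : 0 < rad) (U01 : 0 < U < 1).
Local Notation state := (@state R d rad U).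
Local Notation update := (@update R d rad U).
Local Notation updates := (@updates R d rad U _).
Local Notation rate := (@rate R d rad).
Local Notation leb := (@lebesgue_rV R d).
Implicit Types (f g : 'rV[R]_d -> R).
Variables (n : nat) (psi : n.-tuple 'rV[R]_d -> R).
Local Notation mun := (power_measure leb (n:=n)).
Hypothesis ipsi : mun.-integrable setT (EFin \o psi).
Local Notation J := (test_fun psi).

Definition test_bound : R := \int[mun]_x `|psi x|.

Let mpsi : measurable_fun setT psi.
Proof. by apply/measurable_EFinP; exact: measurable_int ipsi. Qed.

Lemma prod_Sc_bounded g (x : n.-tuple 'rV[R]_d) : Sc g ->
  `|\prod_(i < n) g (tnth x i)| <= 1.
Proof.
move=> [_ g01 _]; rewrite ger0_norm; last first.
  by apply: prodr_ge0 => i _; have /andP[] := g01 (tnth x i).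
by apply: numdomain.Num.Theory.prodr_ile1 => i _; exact: g01.
Qed.

Lemma measurable_test_integrand g : measurable_fun setT g ->
  measurable_fun setT (fun x : n.-tuple 'rV[R]_d => psi x * \prod_(i < n) g (tnth x i)).
Proof.
move=> mg; apply: measurable_funM => //; apply: measurable_prod => i _.
exact: (measurableT_comp mg (@measurable_tnth _ _ _ i)).
Qed.

Lemma integrable_test_integrand g : Sc g ->
  mun.-integrable setT (EFin \o (fun x => psi x * \prod_(i < n) g (tnth x i))).
Proof.
move=> Sg; apply: (le_integrable measurableT _ _ ipsi).
  by apply/measurable_EFinP; apply: measurable_test_integrand; case: Sg.
move=> x _ /=; rewrite lee_fin normrM ler_piMr//.
exact: prod_Sc_bounded.
Qed.

Lemma test_bound_ge0 : 0 <= test_bound.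
Proof. by apply: Rintegral_ge0. Qed.

Lemma test_fun_bounded g : Sc g -> `|J g| <= test_bound.
Proof.
move=> Sg; apply: (le_trans (le_normr_Rintegral measurableT (integrable_test_integrand Sg))).
apply: le_Rintegral => //.
- exact: (integrable_norm (integrable_test_integrand Sg)).
- exact: (integrable_norm ipsi).
- by move=> x _; rewrite normrM ler_piMr// prod_Sc_bounded.
Qed.

Lemma measurable_test_fun : measurable_fun setT (J : state -> R).
Proof.
apply: measurable_state_fun => f m e Sf.
pose F (p : m.-tuple 'rV[R]_d * n.-tuple 'rV[R]_d) : \bar R :=
  (psi p.2 * \prod_(i < n) updates f p.1 e (tnth p.2 i))%:E.
have mF : measurable_fun setT F.
  apply/measurable_EFinP; apply: measurable_funM.
    exact: (measurableT_comp mpsi).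
  apply: measurable_prod => i _.
  apply: (@measurable_updates_eval R d rad U _ _ m e (fun=> f) fst) => //.
    apply: (measurableT_comp (f := f)); first by case: Sf.
    exact: (measurableT_comp (@measurable_tnth _ _ _ i)).
  exact: (measurableT_comp (@measurable_tnth _ _ _ i)).
(* Tonelli only concerns nonnegative integrands, so the positive and negative parts are treated
   separately. *)
rewrite (_ : (fun c => _) = fun c => fine
   ((\int[mun]_x (F^\+%E (c, x)) - \int[mun]_x (F^\-%E (c, x)))%E)); last first.
  apply/funext => c; rewrite /test_fun /Rintegral; congr fine.
  by rewrite [LHS]integralE; congr (_ - _)%E; apply: eq_integral => x _;
    rewrite ?funeposE ?funenegE.
have mG : measurable_fun setT (fun c =>
    \int[mun]_x (F^\+%E (c, x)) - \int[mun]_x (F^\-%E (c, x)))%E.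
  apply: emeasurable_funB.
  - apply: (@measurable_fun_fubini_tonelli_F _ _ _ _ _ mun (F^\+%E)) => //.
    exact: measurable_funepos.
  - apply: (@measurable_fun_fubini_tonelli_F _ _ _ _ _ mun (F^\-%E)) => //.
    exact: measurable_funeneg.
exact: (measurableT_comp (fine_measurable measurableT) mG).
Qed.

(** Mean change of the test function under a jump centred at [c]. It is the inner integral of the
    generator formula, by [generator_integrand]. *)
Definition jump_gain f c : R :=
  f c * (J (update f c true) - J f) + (1 - f c) * (J (update f c false) - J f).

Let prod_split (f h : 'rV[R]_d -> R) (c : 'rV[R]_d) (x : n.-tuple 'rV[R]_d) :
  \prod_(i < n) (if tnth x i \in eball c rad then h (tnth x i) else f (tnth x i)) =
  \sum_(I : {set 'I_n})
    (\prod_(j in ~: I) (\1_(~` eball c rad) (tnth x j) * f (tnth x j)))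
    * (\prod_(i in I) \1_(eball c rad) (tnth x i))
    * \prod_(i in I) h (tnth x i).
Proof.
transitivity (\prod_(i < n) (\1_(eball c rad) (tnth x i) * h (tnth x i)
    + \1_(~` eball c rad) (tnth x i) * f (tnth x i))).
  apply: eq_bigr => i _; rewrite !indicE in_setC.
  by case: ifP; rewrite ?mul1r ?mul0r ?addr0 ?add0r.
rewrite bigA_distr; apply: eq_bigr => I _.
rewrite (bigID (mem I)) /= -mulrA mulrC; congr (_ * _).
  apply: eq_big => [i|i]; first by rewrite inE.
  by move=> /negbTE ->.
by rewrite -big_split/=; apply: eq_bigr => i ->.
Qed.

Lemma generator_integrand f c : Sc f ->
  \int[mun]_x
      ((\sum_(I : {set 'I_n})
         (\prod_(j in ~: I) (\1_(~` eball c rad) (tnth x j) * f (tnth x j)))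
         * (\prod_(i in I) \1_(eball c rad) (tnth x i))
         * (f c * (\prod_(i in I) ((1 - U) * f (tnth x i) + U)
                   - \prod_(i in I) f (tnth x i))
            + (1 - f c) * (\prod_(i in I) ((1 - U) * f (tnth x i))
                           - \prod_(i in I) f (tnth x i))))
       * psi x) = jump_gain f c.
Proof.
move=> Sf.
pose A g (x : n.-tuple 'rV[R]_d) := psi x * \prod_(i < n) g (tnth x i).
have iA g : Sc g -> mun.-integrable setT (EFin \o A g) by exact: integrable_test_integrand.
have iD e : mun.-integrable setT (EFin \o (fun x => A (update f c e) x - A f x)).
  rewrite (_ : EFin \o _ = ((EFin \o A (update f c e)) \- (EFin \o A f))%E)//.
  apply: integrableB => //; apply: iA => //; exact: Sc_update.
have iZ r e : mun.-integrable setT (EFin \o (fun x => r * (A (update f c e) x - A f x))).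
  rewrite (_ : EFin \o _ = (fun x => r%:E * (A (update f c e) x - A f x)%R%:E)%E)//.
  exact: (integrableZl measurableT r (iD e)).
transitivity (\int[mun]_x (f c * (A (update f c true) x - A f x) +
    (1 - f c) * (A (update f c false) x - A f x))).
  apply: eq_Rintegral => x _.
  have fE : \prod_(i < n) f (tnth x i) = \prod_(i < n)
      (if tnth x i \in eball c rad then f (tnth x i) else f (tnth x i)).
    by apply: eq_bigr => i _; rewrite if_same.
  have uE e : \prod_(i < n) update f c e (tnth x i) = \prod_(i < n)
      (if tnth x i \in eball c rad then (1 - U) * f (tnth x i) + U * e%:R
       else f (tnth x i)).
    by apply: eq_bigr => i _; rewrite updateE.
  rewrite /A !uE fE (prod_split f f).
  rewrite !(prod_split f (fun y => (1 - U) * f y + U * _%:R)) -!mulrBr.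
  rewrite mulrCA (mulrCA (1 - f c)) -mulrDr mulrC.
  congr (_ * _); rewrite -!sumrB !mulr_sumr -big_split/=; apply: eq_bigr => I _.
  rewrite -!mulrBr !(mulrCA _ (_ * _)) -mulrDr; congr (_ * (_ * (_ - _) + _ * (_ - _))).
    by apply: eq_bigr => i _; rewrite mulr1.
  by apply: eq_bigr => i _; rewrite mulr0 addr0.
have Su e := Sc_update rad U01 c e Sf.
rewrite RintegralD//; [|exact: iZ..].
rewrite (RintegralZl _ measurableT (iD true)) (RintegralZl _ measurableT (iD false)).
by rewrite (RintegralB measurableT (iA _ (Su true)) (iA _ Sf))
  (RintegralB measurableT (iA _ (Su false)) (iA _ Sf)).
Qed.
(** Here [f] vanishes on the ball around [c]: mark 1 has weight 0 and mark 0 changes nothing. This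
    is why the generator may integrate over all [c] although centres are drawn from the fattened
    support. *)
Lemma jump_gain_eq0 f c : Sc f -> ~ fatten (supp f) rad c -> jump_gain f c = 0.
Proof.
move=> Sf fc.
have fB x : x \in eball c rad -> f x = 0.
  rewrite inE => cx; apply: contra_notP fc => /eqP fx.
  by exists x; [exact: subset_supp|rewrite enorm_sym].
have f0 : f c = 0 by apply: fB; rewrite inE; apply: eballc; exact: ltW.
rewrite /jump_gain f0 mul0r add0r.
rewrite (_ : update f c false = f) ?subrr ?mulr0//.
by apply/funext => x; rewrite updateE; case: ifP => // /fB ->; rewrite !mulr0 addr0.
Qed.

(* [test_fun psi] shifted to be nonnegative on [Sc]; the truncation only
   matters off [Sc]. *)
Definition shifted_test_fun (g : state) : \bar R := (Num.max (J g + test_bound) 0)%:E.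

Lemma shifted_test_fun_ge0 g : (0 <= shifted_test_fun g)%E.
Proof. by rewrite lee_fin le_max lexx orbT. Qed.

Lemma measurable_shifted_test_fun : measurable_fun setT shifted_test_fun.
Proof.
apply/measurable_EFinP; apply: measurable_maxr => //.
by apply: measurable_funD => //; exact: measurable_test_fun.
Qed.

Lemma shifted_test_funE g : Sc g -> shifted_test_fun g = (J g + test_bound)%:E.
Proof.
move=> Sg; rewrite /shifted_test_fun max_l// -lerBlDr sub0r.
by have := test_fun_bounded Sg; rewrite ler_norml => /andP[].
Qed.

Lemma update_mean_shifted f c : Sc f ->
  update_mean shifted_test_fun f c = (jump_gain f c + (J f + test_bound))%:E.
Proof.
move=> Sf; rewrite /update_mean !shifted_test_funE; [|exact: Sc_update..].
by rewrite -!EFinM -EFinD /jump_gain; congr EFin; ring.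
Qed.

(** The factor [rate f] undoes the normalisation of the uniform law in [step], and the shift by
    [test_bound] cancels. For null [f] both sides are 0, the fattened support being empty. *)
Lemma Rintegral_jump_gain f : Sc f ->
  (\int[leb]_c jump_gain f c)%R =
  fine (rate f) * (fine (step shifted_test_fun f) - (J f + test_bound)).
Proof.
move=> Sf; pose A := fatten (supp f) rad.
have mA : measurable A by apply: measurable_fatten; case: Sf.
rewrite (_ : (\int[leb]_c jump_gain f c)%R = \int[leb]_(c in A) jump_gain f c); last first.
  rewrite [RHS]Rintegral_mkcond; apply: eq_Rintegral => c _.
  rewrite patchE; case: ifPn => // /negP cA; rewrite jump_gain_eq0// => fc.
  by apply: cA; rewrite inE.
have [f0|f0] := pselect (f = cst 0).
  rewrite f0 rate0 /= mul0r /A f0 (_ : fatten _ _ = set0) ?Rintegral_set0//.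
  apply/seteqP; split => x // [y].
  rewrite /supp (_ : [set z | _] = set0) ?closure0//.
  by apply/seteqP; split => z //=; rewrite eqxx.
have rf := rate_fin rad Sf; have r0 := rate_gt0 rad0 Sf f0.
have r0' : fine (rate f) != 0 by rewrite gt_eqF// fine_gt0// r0 ltey_eq rf.
have mg : measurable_fun A (EFin \o (fun c => jump_gain f c + (J f + test_bound))).
  apply: measurable_funTS.
  rewrite (_ : _ \o _ = update_mean shifted_test_fun f).
    by apply: measurable_update_mean_cst => //; exact: measurable_shifted_test_fun.
  by apply/funext => c; rewrite /= update_mean_shifted.
have icst r : leb.-integrable A (EFin \o cst r).
  apply/integrableP; split; first exact/measurable_EFinP.
  rewrite (_ : (fun _ => _) = cst `|r|%:E)//.
  by rewrite integral_cst// lte_mul_pinfty// ltey_eq rf.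
(* The quantity is a convex combination of values of the test function, each lying in
   [[- test_bound, test_bound]] before the shift. *)
have jb c : 0 <= jump_gain f c + (J f + test_bound) <= 2 * test_bound.
  have [_ /(_ c)/andP[fc0 fc1] _] := Sf.
  have := test_fun_bounded (Sc_update rad U01 c true Sf).
  have := test_fun_bounded (Sc_update rad U01 c false Sf).
  rewrite !ler_norml /jump_gain => /andP[h1 h2] /andP[h3 h4].
  by apply/andP; split; nra.
have ig : leb.-integrable A (EFin \o (fun c => jump_gain f c + (J f + test_bound))).
  apply: (le_integrable mA mg _ (icst (2 * test_bound))) => c _ /=.
  have /andP[j0 j1] := jb c.
  by rewrite lee_fin !ger0_norm//; exact: le_trans j1.
rewrite /step ifT; last exact/asboolP.
under eq_integral do rewrite update_mean_shifted//.
rewrite fineM//; last exact: integrable_fin_num.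
rewrite mulrBr mulrA mulfV// mul1r.
transitivity (\int[leb]_(c in A) ((jump_gain f c + (J f + test_bound)) - (J f + test_bound))).
  by apply: eq_Rintegral => c _; rewrite addrK.
rewrite RintegralB//; [|exact: icst]; congr (_ - _).
by rewrite Rintegral_cst// mulrC.
Qed.

End test_functions.

(** * The chain *)

Section chain_law.
Context {R : realType} {d : nat}.
Variables rad U : R.
Hypotheses (rad0 : 0 < rad) (U01 : 0 < U < 1).
Local Notation state := (@state R d rad U).
Local Notation update := (@update R d rad U).
Local Notation rate := (@rate R d rad).
Variables (f : 'rV[R]_d -> R) (Sf : Sc f).
Context {dO : measure_display} {Omega : measurableType dO}.
Variables (P : probability Omega R) (c0 : 'rV[R]_d).
Variables (C : nat -> Omega -> 'rV[R]_d) (V E : nat -> Omega -> R).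
Hypothesis con : slfv_construction rad U P f C V E c0.
Local Notation Y := (chain rad U f C V).
Local Notation past := (past rad U f C V).
Local Notation Opast n := (g_sigma_algebraType (past n)).

Lemma sigma_algebra_past n : sigma_algebra setT (past n).
Proof. exact: smallest_sigma_algebra. Qed.

Lemma measurable_pastE n : @measurable _ (Opast n) = past n.
Proof. by apply: sigma_algebra_id; exact: sigma_algebra_past. Qed.

Lemma Sc_chain n w : Sc (Y n w).
Proof. by elim: n => //= n IH; exact: Sc_update. Qed.

Lemma measurable_past_fun n dT (T : measurableType dT) (h : Omega -> T) :
  (forall B, measurable B -> past n (h @^-1` B)) ->
  measurable_fun setT (h : Opast n -> T).
Proof. by move=> hn _ B mB; rewrite setTI measurable_pastE; exact: hn. Qed.

Lemma measurable_C_past n i : (i < n)%N -> measurable_fun setT (C i : Opast n -> _).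
Proof.
move=> ni; apply: measurable_past_fun => B mB.
by apply: sub_sigma_algebra; constructor 1; exists i, B.
Qed.

Lemma measurable_V_past n i : (i < n)%N -> measurable_fun setT (V i : Opast n -> _).
Proof.
move=> ni; apply: measurable_past_fun => B mB.
by apply: sub_sigma_algebra; constructor 2; exists i, B.
Qed.

Lemma past_mono m n : (m <= n)%N -> past m `<=` past n.
Proof.
move=> mn; apply: smallest_sub; first exact: sigma_algebra_past.
move=> _ [] [i [B [im mB ->]]]; apply: sub_sigma_algebra.
- by constructor 1; exists i, B; split => //; exact: leq_trans mn.
- by constructor 2; exists i, B; split => //; exact: leq_trans mn.
- by constructor 3; exists i, B; split => //; exact: leq_trans mn.
Qed.

Lemma measurable_mark dT (T : measurableType dT) (Z : T -> 'rV[R]_d -> R)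
    (c : T -> 'rV[R]_d) (v : T -> R) :
  reachable_map rad U f Z -> measurable_fun setT c -> measurable_fun setT v ->
  measurable ((fun w => mark (Z w) (c w) (v w)) @^-1` [set true]).
Proof.
move=> rZ mc mv.
rewrite (_ : _ @^-1` _ = ~` (Z @^-1` [set cst 0]) `&`
    ((fun w => v w <= Z w (c w)) @^-1` [set true])); last first.
  apply/seteqP; split => w /=; rewrite /mark.
    by move=> /andP[/asboolP].
  by move=> [/asboolP -> ->].
apply: measurableI.
  apply: measurableC; rewrite -[X in measurable X]setTI.
  by apply: (measurable_reachable_map Sf rZ) => //; exact: measurable_state0.
rewrite -[X in measurable X]setTI.
by apply: measurable_fun_ler => //; exact: (measurable_reachable_map_eval Sf rZ).
Qed.

(** Reachability, rather than mere measurability of [Y n], is the right induction hypothesis: the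
    next mark evaluates [Y n] at the random point [C n]. *)
Lemma reachable_chain n : reachable_map rad U f (Y n : Opast n -> _).
Proof.
elim: n => [|n IH]; first exact: reachable_map_cst.
have rY : reachable_map rad U f (Y n : Opast n.+1 -> _).
  have sid : measurable_fun setT (id : Opast n.+1 -> Opast n).
    apply: measurable_sub_sub => A An; apply: sub_sigma_algebra.
    exact: past_mono An.
  exact: (reachable_map_comp IH sid).
apply: (reachable_map_update rY); first exact: measurable_C_past.
by apply: measurable_mark => //; [exact: measurable_C_past|exact: measurable_V_past].
Qed.

Lemma reachable_chain_comp n dT (T : measurableType dT) (h : T -> Opast n) :
  measurable_fun setT h -> reachable_map rad U f (fun w => Y n (h w)).
Proof. by move=> mh; exact: (reachable_map_comp (reachable_chain n) mh). Qed.

Lemma measurable_chain_past n : measurable_fun setT (Y n : Opast n -> state).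
Proof. exact: (measurable_reachable_map Sf (reachable_chain n)). Qed.

(** The construction assumes measurability of the centres and uniform variables but not of the
    chain, although [past] is generated by the chain as well; the induction supplies it one state at
    a time. *)
Lemma past_measurable n : past n `<=` measurable.
Proof.
elim: n => [|n IH].
  apply: smallest_sub; first exact: sigma_algebra_measurable.
  move=> _ [] [i [B [ni mB ->]]]; [by []|by []|].
  move: ni; rewrite leqn0 => /eqP ->.
  by rewrite -[X in measurable X]setTI; exact: measurable_cst.
have mid : measurable_fun setT (id : Omega -> Opast n) by exact: measurable_sub_id.
have mY i : (i <= n)%N -> measurable_fun setT (Y i : Omega -> state).
  move=> ni; apply: (measurable_sub_fun _ (@measurable_chain_past i)).
  by move=> A /(past_mono ni); exact: IH.
apply: smallest_sub; first exact: sigma_algebra_measurable.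
move=> _ [] [i [B [ni mB ->]]]; rewrite -[X in measurable X]setTI.
- exact: (measurable_C con).
- exact: (measurable_V con).
- move: ni; rewrite leq_eqVlt => /predU1P[->|ni]; last exact: mY.
  have rY := reachable_chain_comp mid.
  apply: (measurable_reachable_map Sf (Y := Y n.+1)) => //=.
  apply: (reachable_map_update rY); first exact: (measurable_C con).
  by apply: measurable_mark => //; [exact: (measurable_C con)|exact: (measurable_V con)].
Qed.

Lemma measurable_past_id n : measurable_fun setT (id : Omega -> Opast n).
Proof. by apply: measurable_sub_id; exact: past_measurable. Qed.

Lemma measurable_chain n : measurable_fun setT (Y n : Omega -> state).
Proof. exact: (measurable_sub_fun (@past_measurable n) (@measurable_chain_past n)). Qed.

Lemma past_setT n : past n setT.
Proof. by rewrite -measurable_pastE. Qed.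

Lemma past_setI n A B : past n A -> past n B -> past n (A `&` B).
Proof. by rewrite -measurable_pastE; exact: measurableI. Qed.

(** Since [V n] is independent of [past n] and [C n] together, the mark is, given these, a Bernoulli
    variable of parameter [Y n w (C n w)]. *)
Lemma integral_update n (G : set Omega) (h : state -> \bar R) : past n G ->
  (forall y, 0 <= h y)%E -> measurable_fun setT h ->
  (\int[P]_(w in G) h (Y n.+1 w) =
   \int[P]_(w in G) update_mean h (Y n w) (C n w))%E.
Proof.
move=> nG h0 mh.
pose Q := past n `|` preimage_set_system setT (C n) measurable.
have QT : Q `<=` measurable.
  move=> A [/past_measurable//|[B mB <-]]; exact: (measurable_C con).
have mQ := measurable_sub_id QT.
have QC : measurable_fun setT (C n : g_sigma_algebraType Q -> _).
  by move=> _ B mB; apply: sub_sigma_algebra; right; exists B.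
have Qp : measurable_fun setT (id : g_sigma_algebraType Q -> Opast n).
  by apply: measurable_sub_sub => A An; apply: sub_sigma_algebra; left.
have [k kE] : exists k : R.-pker (g_sigma_algebraType Q) ~> (measurableTypeR R),
    forall x A, k x A = uniform_prob (@ltr01 R) A.
  apply: probability_kernel_of_fun.
  - by move=> x; exact: measure0.
  - by move=> x A; exact: measure_ge0.
  - by move=> x; exact: measure_semi_sigma_additive.
  - by move=> A mA; exact: measurable_cst.
  - by move=> x; exact: probability_setT.
pose F (z : g_sigma_algebraType Q * measurableTypeR R) : \bar R :=
  (h (update (Y n z.1) (C n z.1) (mark (Y n z.1) (C n z.1) z.2)) * (\1_G z.1)%:E)%E.
have F0 z : (0 <= F z)%E by rewrite mule_ge0// lee_fin.
have mf1 : measurable_fun setT (fun z : g_sigma_algebraType Q * measurableTypeR R => z.1).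
  exact: measurable_fst.
have mF : measurable_fun setT F.
  have rY := reachable_chain_comp (measurableT_comp Qp mf1).
  have mC := measurableT_comp QC mf1.
  apply: emeasurable_funM.
    have rU := reachable_map_update rY mC (measurable_mark rY mC (@measurable_snd _ _ _ _)).
    exact: (measurableT_comp mh (measurable_reachable_map Sf rU)).
  apply/measurable_EFinP.
  have mG : measurable (G : set (g_sigma_algebraType Q)).
    by apply: sub_sigma_algebra; left.
  exact: (measurableT_comp (measurable_indic mG) mf1).
transitivity (\int[P]_w F (w, V n w))%E.
  rewrite integral_mkcond; apply: eq_integral => w _.
  by rewrite patchE /F/= indicE; case: ifPn; rewrite ?mule1 ?mule0.
rewrite (@disintegration _ _ _ Omega (g_sigma_algebraType Q) (measurableTypeR R)
  R P id (V n) mQ (measurable_V con n) k F)//; last first.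
  move=> A B mA mB /=.
  rewrite (indep_V con (n := n))//; last by exists B => //; rewrite setTI.
  rewrite (eq_integral (cst (uniform_prob (@ltr01 R) B))); last by move=> w _; rewrite kE.
  rewrite integral_cst//; first by rewrite (law_V con)// muleC.
  by apply: smallest_sub mA => //; exact: sigma_algebra_measurable.
rewrite [RHS]integral_mkcond; apply: eq_integral => w _.
transitivity (\int[uniform_prob (@ltr01 R)]_v F (w, v))%E.
  by apply: eq_measure_integral => B mB _; rewrite kE.
rewrite patchE /F/= indicE; case: ifPn => _; last by rewrite integral0_eq// => v _; rewrite mule0.
under eq_integral do rewrite mule1.
(* In the null state the comparison with [V n] would still give mark 1 for nonpositive values of
   [v]; the guard in [mark] forces mark 0 for all of them. *)
have [Y0|Y0] := pselect (Y n w = cst 0).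
  rewrite /update_mean Y0 mul0e add0e subr0 mul1e.
  rewrite (eq_integral (cst (h (update (cst 0) (C n w) false)))); last first.
    by move=> v _; rewrite /mark asboolF//; exact.
  rewrite integral_cst// [X in (_ * X)%E](_ : _ = 1%E) ?mule1//.
  exact: probability_setT.
have [_ /(_ (C n w)) Y01 _] := Sc_chain n w.
rewrite /update_mean -integral_uniform_le//.
apply: eq_integral => v _; rewrite /mark asboolT//=.
by case: (v <= _)%R.
Qed.

(** The mark has been averaged in [integral_update]; it remains to integrate the centre against its
    conditional law given [past n]. *)
Lemma integral_chain_step n (G : set Omega) (h : state -> \bar R) : past n G ->
  (forall y, 0 <= h y)%E -> measurable_fun setT h ->
  (\int[P]_(w in G) h (Y n.+1 w) = \int[P]_(w in G) step h (Y n w))%E.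
Proof.
move=> nG h0 mh; rewrite integral_update//.
have mD w : measurable (fatten (supp (Y n w)) rad).
  by apply: measurable_fatten; have [] := Sc_chain n w.
have [k kE] : exists k : R.-pker (Opast n) ~> 'rV[R]_d,
    forall w B, k w B = center_law rad c0 (Y n w) B.
  apply: probability_kernel_of_fun.
  - move=> w; rewrite /center_law; case: ifPn => _; first exact: measure0.
    by rewrite /uniform_on set0I measure0 mule0.
  - move=> w B; rewrite /center_law; case: ifPn => _; first exact: measure_ge0.
    by rewrite /uniform_on mule_ge0// lee_fin invr_ge0 fine_ge0// measure_ge0.
  - move=> w; have [Y0|Y0] := pselect (Y n w = cst 0).
      rewrite [X in semi_sigma_additive X](_ : _ = \d_c0).
        exact: measure_semi_sigma_additive.
      by apply/funext => B; rewrite /center_law asboolT.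
    have l0 : 0 <= (fine (lebesgue_rV (fatten (supp (Y n w)) rad)))^-1.
      by rewrite invr_ge0 fine_ge0// measure_ge0.
    rewrite [X in semi_sigma_additive X](_ : _ =
      mscale (NngNum l0) (mrestr (@lebesgue_rV R d) (mD w))).
      exact: measure_semi_sigma_additive.
    by apply/funext => B; rewrite /center_law asboolF.
  - move=> B mB; apply: measurable_past_fun => A mA.
    exact: ((law_C con n mB).1 A mA).
  - move=> w; rewrite /center_law; case: ifPn => [_|/asboolP Y0].
      exact: probability_setT.
    rewrite /uniform_on setTI.
    have rf := rate_fin rad (Sc_chain n w).
    have r0 := rate_gt0 rad0 (Sc_chain n w) Y0.
    rewrite -[X in (_ * X)%E](fineK rf) -EFinM mulVf// gt_eqF//.
    by rewrite fine_gt0// r0 ltey_eq rf.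
pose F (z : Opast n * 'rV[R]_d) : \bar R :=
  (update_mean h (Y n z.1) z.2 * (\1_G z.1)%:E)%E.
have F0 z : (0 <= F z)%E.
  by rewrite mule_ge0// ?lee_fin// update_mean_ge0//; exact: Sc_chain.
have mf1 : measurable_fun setT (fun z : Opast n * 'rV[R]_d => z.1).
  exact: measurable_fst.
have mG : measurable (G : set (Opast n)) by rewrite measurable_pastE.
have mF : measurable_fun setT F.
  apply: emeasurable_funM.
    apply: (measurable_update_mean (x := snd) Sf (reachable_chain_comp mf1)) => //.
  by apply/measurable_EFinP; exact: (measurableT_comp (measurable_indic mG) mf1).
transitivity (\int[P]_w F (w, C n w))%E.
  rewrite integral_mkcond; apply: eq_integral => w _.
  by rewrite patchE /F/= indicE; case: ifPn; rewrite ?mule1 ?mule0.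
rewrite (@disintegration _ _ _ Omega (Opast n) 'rV[R]_d R P id (C n)
  (@measurable_past_id n) (measurable_C con n) k F)//; last first.
  move=> A B mA mB /=.
  have nA : past n A by rewrite -measurable_pastE.
  rewrite ((law_C con n mB).2 A nA).
  by apply: eq_integral => w _; rewrite kE.
rewrite [RHS]integral_mkcond; apply: eq_integral => w _.
rewrite patchE /F/= indicE; case: ifPn => _; last by rewrite integral0_eq// => v _; rewrite mule0.
under eq_integral do rewrite mule1.
have mum : measurable_fun setT (update_mean h (Y n w)).
  by apply: measurable_update_mean_cst => //; exact: Sc_chain.
rewrite /step; case: asboolP => [[SY Y0]|Y0].
  have l0 : 0 <= (fine (rate (Y n w)))^-1 by rewrite invr_ge0 fine_ge0// measure_ge0.
  transitivity (\int[mscale (NngNum l0) (mrestr (@lebesgue_rV R d) (mD w))]_c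
      update_mean h (Y n w) c)%E.
    apply: eq_measure_integral => B mB _; rewrite kE /center_law asboolF//.
  rewrite ge0_integral_mscale//; last by move=> c _; exact: update_mean_ge0.
  congr (_ * _)%E.
  rewrite (@ge0_negligible_integral _ _ _ _ setT (~` fatten (supp (Y n w)) rad))//.
  - rewrite setTD setCK; apply: eq_measure_integral => B mB BD.
    by rewrite -[in RHS](setIidl BD).
  - exact: measurableC.
  - by move=> c _; exact: update_mean_ge0.
  - transitivity (@lebesgue_rV R d set0); last exact: (measure0 (@lebesgue_rV R d)).
    by rewrite -(setICl (fatten (supp (Y n w)) rad)).
have {}Y0 : Y n w = cst 0.
  by apply: contra_notP Y0 => Y0; split => //; exact: Sc_chain.
(* The arbitrary point [c0] leaves no trace: an update of the null function with mark 0 is null for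
   any centre. *)
transitivity (\int[\d_c0]_c update_mean h (Y n w) c)%E.
  by apply: eq_measure_integral => B mB _; rewrite kE /center_law asboolT.
rewrite integral_dirac// diracT mul1e /update_mean Y0 mul0e add0e subr0 mul1e.
by rewrite (update_eq0 rad0 U01 c0 _ (@Sc0 R d)).2.
Qed.

Variable K : R.-pker state ~> state.
Hypothesis KE : forall g A, K g A = step (fun y => (\1_A y)%:E) g.

Lemma chain_kernel_past n (G : set Omega) (A : set state) : past n G -> measurable A ->
  P (G `&` Y n.+1 @^-1` A) = (\int[P]_(w in G) K (Y n w) A)%E.
Proof.
move=> nG mA; under eq_integral do rewrite KE.
rewrite -integral_chain_step//; last first.
- by apply/measurable_EFinP; exact: measurable_indic.
have mG := past_measurable nG.
have mYA : measurable (Y n.+1 @^-1` A).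
  by rewrite -[X in measurable X]setTI; exact: measurable_chain.
rewrite setIC -integral_indic//.
Qed.

(** * Joint law of the chain and the holding times *)

(** Intersections of an event of the chain with a box for the first [m] holding variables: stable
    under intersection, and independence can be read off directly. The two indices are separate
    because a jump reveals the holding variable first and the new state next. *)
Definition hist_gen n m : set (set Omega) :=
  [set G | exists G1 (B : nat -> set R), [/\ past n G1,
    forall i, measurable (B i) &
    G = G1 `&` \bigcap_(i in `I_m) (E i @^-1` B i)]].
Local Notation Ohist n m := (g_sigma_algebraType (hist_gen n m)).
Local Notation Hist n m := <<s hist_gen n m >>.

Lemma measurable_E_preimage i B : measurable B -> measurable (E i @^-1` B).
Proof. by move=> mB; rewrite -[X in measurable X]setTI; exact: (measurable_E con). Qed.

Lemma measurable_capE m (B : nat -> set R) : (forall i, measurable (B i)) ->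
  measurable (\bigcap_(i in `I_m) (E i @^-1` B i)).
Proof.
by move=> mB; apply: bigcap_measurableType => // i _; exact: measurable_E_preimage.
Qed.

Lemma hist_gen_measurable n m : hist_gen n m `<=` measurable.
Proof.
move=> _ [G1 [B [nG1 mB ->]]]; apply: measurableI; first exact: past_measurable nG1.
exact: measurable_capE.
Qed.

Lemma hist_measurable n m : Hist n m `<=` measurable.
Proof.
apply: smallest_sub; first exact: sigma_algebra_measurable.
exact: hist_gen_measurable.
Qed.

Lemma measurable_hist_id n m : measurable_fun setT (id : Omega -> Ohist n m).
Proof. by apply: measurable_sub_id; exact: hist_gen_measurable. Qed.

Lemma hist_gen_setI n m : setI_closed (hist_gen n m).
Proof.
move=> _ _ [G1 [B1 [nG1 mB1 ->]]] [G2 [B2 [nG2 mB2 ->]]].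
exists (G1 `&` G2), (fun i => B1 i `&` B2 i); split.
- exact: past_setI.
- by move=> i; exact: measurableI.
- rewrite setIACA; congr (_ `&` _).
  apply/seteqP; split => [w [h1 h2] i im|w h]; first by split; [exact: h1|exact: h2].
  by split=> i im; have [] := h i im.
Qed.

Lemma past_hist n m G : past n G -> hist_gen n m G.
Proof.
move=> nG; exists G, (fun=> setT); split => //.
by rewrite bigcapT ?setIT//; apply/seteqP; split.
Qed.

Lemma hist_gen_mono n n' m m' : (n <= n')%N -> (m <= m')%N ->
  hist_gen n m `<=` hist_gen n' m'.
Proof.
move=> nn' mm' _ [G1 [B [nG1 mB ->]]].
exists G1, (fun i => if (i < m)%N then B i else setT); split.
- exact: past_mono nG1.
- by move=> i; case: ifP.
- congr (_ `&` _); apply/seteqP; split => w h i /= im.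
    by case: ifPn => //; exact: h.
  by have := h i (leq_trans im mm'); rewrite /= im.
Qed.

Lemma E_hist_gen n m i B : (i < m)%N -> measurable B -> hist_gen n m (E i @^-1` B).
Proof.
move=> im mB; exists setT, (fun j => if j == i then B else setT); split.
- exact: past_setT.
- by move=> j; case: ifP.
- rewrite setTI; apply/seteqP; split => [w wB j _ /=|w /(_ i im)/=]; last by rewrite eqxx.
  by case: eqP => // ->.
Qed.

Lemma measurable_hist_sub n n' m m' : (n <= n')%N -> (m <= m')%N ->
  measurable_fun setT (id : Ohist n' m' -> Ohist n m).
Proof.
move=> nn' mm'; apply: measurable_sub_sub => A An.
by apply: sub_sigma_algebra; exact: hist_gen_mono An.
Qed.

Lemma measurable_hist_past n m : measurable_fun setT (id : Ohist n m -> Opast n).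
Proof.
by apply: measurable_sub_sub => A An; apply: sub_sigma_algebra; exact: past_hist.
Qed.

Lemma measurable_chain_hist n m : measurable_fun setT (Y n : Ohist n m -> state).
Proof.
exact: (measurableT_comp (@measurable_chain_past n) (@measurable_hist_past n m)).
Qed.

Lemma measurable_E_hist n m i : (i < m)%N ->
  measurable_fun setT (E i : Ohist n m -> measurableTypeR R).
Proof.
by move=> im _ B mB; rewrite setTI; apply: sub_sigma_algebra; exact: E_hist_gen.
Qed.

Let Ealg := <<s \bigcup_n preimage_set_system setT (E n) measurable >>.

Lemma capE_alg m (B : nat -> set R) : (forall i, measurable (B i)) ->
  Ealg (\bigcap_(i in `I_m) (E i @^-1` B i)).
Proof.
move=> mB.
have : (@measurable _ (g_sigma_algebraType
    (\bigcup_n preimage_set_system setT (E n) measurable)))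
    (\bigcap_(i in `I_m) (E i @^-1` B i)).
  apply: bigcap_measurableType => // i _; apply: sub_sigma_algebra.
  by exists i => //; exists (B i) => //; rewrite setTI.
by [].
Qed.

Lemma past_capE_indep n m G (B : nat -> set R) :
  past n G -> (forall i, measurable (B i)) ->
  (P (G `&` \bigcap_(i in `I_m) (E i @^-1` B i)) =
   P G * P (\bigcap_(i in `I_m) (E i @^-1` B i)))%E.
Proof.
move=> nG mB; apply: (indep_E_chain con); last exact: capE_alg.
by apply: sub_sigma_algebra; exists n.
Qed.

(** On the generators, the condition on [E m] is one more side of the box: the box splits from the
    chain, then into its sides. Uniqueness of measures extends the product formula. *)
Lemma hist_E_indep n m G B : Hist n m G -> measurable B ->
  P (G `&` E m @^-1` B) = (P G * expo B)%E.
Proof.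
move=> HG mB; have mE := measurable_E_preimage m mB.
have eB0 : 0 <= fine (expo B) by exact: fine_ge0.
pose m1 : {measure set Omega -> \bar R} := mrestr P mE.
pose m2 : {measure set Omega -> \bar R} := mscale (NngNum eB0) P.
have m1E A : m1 A = P (A `&` E m @^-1` B) by [].
have m2E A : m2 A = (P A * expo B)%E.
  transitivity ((fine (expo B))%:E * P A)%E => //.
  by rewrite muleC fineK// fin_num_measure.
rewrite -m1E -m2E; move: G HG; apply: generated_measure_unique.
- exact: hist_gen_measurable.
- exact: hist_gen_setI.
- by apply: past_hist; exact: past_setT.
- move=> _ [G1 [B1 [nG1 mB1 ->]]]; rewrite m1E m2E.
  transitivity (P (G1 `&` \bigcap_(i in `I_m.+1)
      (E i @^-1` (if (i < m)%N then B1 i else B)))).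
    rewrite -setIA; congr (P (_ `&` _)).
    apply/seteqP; split => [w [h1 h2] i /=|w h].
      by rewrite ltnS leq_eqVlt => /predU1P[->|im]; rewrite ?ltnn// im; exact: h1.
    split; last by have := h m (ltnSn m); rewrite /= ltnn.
    by move=> i im; have := h i (ltnW im); rewrite /= im.
  have mBB i : measurable (if (i < m)%N then B1 i else B) by case: ifP.
  rewrite (past_capE_indep m.+1 nG1 mBB) (past_capE_indep m nG1 mB1) -muleA; congr (_ * _)%E.
  rewrite !(indep_E con)// big_ord_recr /= ltnn (law_E con)// expoE.
  by congr (_ * _)%E; apply: eq_bigr => i _; rewrite ltn_ord.
- by rewrite m1E; apply: le_lt_trans (ltry 1); apply: probability_le1; exact: measurableI.
Qed.

Lemma disintegration_E n m (F : Ohist n m * measurableTypeR R -> \bar R) :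
  (forall z, 0 <= F z)%E -> measurable_fun setT F ->
  (\int[P]_w F (w, E m w) = \int[P]_w \int[expo]_u F (w, u))%E.
Proof.
move=> F0 mF.
have [k kE] : exists k : R.-pker (Ohist n m) ~> (measurableTypeR R),
    forall x A, k x A = expo A.
  apply: probability_kernel_of_fun.
  - by move=> x; exact: measure0.
  - by move=> x A; exact: measure_ge0.
  - by move=> x; exact: measure_semi_sigma_additive.
  - by move=> A mA; exact: measurable_cst.
  - by move=> x; exact: probability_setT.
rewrite (@disintegration _ _ _ Omega (Ohist n m) (measurableTypeR R) R P id (E m)
  (@measurable_hist_id n m) (measurable_E con m) k F)//.
  by apply: eq_integral => w _; apply: eq_measure_integral => A mA _; rewrite kE.
move=> G B mG mB /=; rewrite (hist_E_indep mG)//.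
rewrite (eq_integral (cst (expo B))); last by move=> w _; rewrite kE.
rewrite integral_cst//; first by rewrite muleC.
exact: hist_measurable mG.
Qed.

(** Holding variables are independent of the whole chain, so knowing any number of them leaves the
    transition law unchanged. Both sides are measures in [G], the right one with a density, and are
    compared on the generators. *)
Lemma hist_chain_kernel n m G A : Hist n m G -> measurable A ->
  P (G `&` Y n.+1 @^-1` A) = (\int[P]_(w in G) K (Y n w) A)%E.
Proof.
move=> HG mA.
have mYA : measurable (Y n.+1 @^-1` A).
  by rewrite -[X in measurable X]setTI; exact: measurable_chain.
have mKA : measurable_fun setT (fun w => K (Y n w) A).
  exact: (measurableT_comp (measurable_kernel K _ mA) (measurable_chain n)).
have KA0 w : (0 <= K (Y n w) A)%E by exact: (measure_ge0 (K (Y n w))).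
have [nu nuE] := density_measure P mKA KA0.
pose m1 : {measure set Omega -> \bar R} := mrestr P mYA.
have m1E D : m1 D = P (D `&` Y n.+1 @^-1` A) by [].
rewrite -m1E -nuE; move: G HG; apply: generated_measure_unique.
- exact: hist_gen_measurable.
- exact: hist_gen_setI.
- by apply: past_hist; exact: past_setT.
- move=> _ [G1 [B1 [nG1 mB1 ->]]]; rewrite nuE m1E.
  have nG1Y : past n.+1 (G1 `&` Y n.+1 @^-1` A).
    apply: past_setI; first exact: (past_mono (leqnSn n)).
    rewrite -measurable_pastE -[X in measurable X]setTI.
    exact: measurable_chain_past.
  rewrite setIAC (past_capE_indep m nG1Y mB1).
  rewrite chain_kernel_past// setIC integral_mkcondr.
  have nG1' : measurable (G1 : set (Opast n)) by rewrite measurable_pastE.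
  rewrite [RHS](@integral_independent _ Omega R P (past n)
    (\bigcup_n preimage_set_system setT (E n) measurable))//.
  + by rewrite muleC [in LHS]integral_mkcond.
  + exact: past_measurable.
  + by move=> _ [i _ [B mB <-]]; rewrite setTI; exact: measurable_E_preimage.
  + move=> D1 D2 nD1 eD2; apply: (indep_E_chain con) => //.
    apply: sub_sigma_algebra; exists n => //.
    by rewrite -measurable_pastE.
  + apply/(measurable_restrictT _ _).1 => //; apply: measurable_funTS.
    exact: (measurableT_comp (measurable_kernel K _ mA) (@measurable_chain_past n)).
  + by move=> w; exact: erestrict_ge0.
  + exact: capE_alg.
- by rewrite m1E; apply: le_lt_trans (ltry 1); apply: probability_le1; exact: measurableI.
Qed.

Lemma disintegration_chain n m (F : Ohist n m * state -> \bar R) :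
  (forall z, 0 <= F z)%E -> measurable_fun setT F ->
  (\int[P]_w F (w, Y n.+1 w) = \int[P]_w \int[K (Y n w)]_y F (w, y))%E.
Proof.
move=> F0 mF.
have [k kE] : exists k : R.-pker (Ohist n m) ~> state,
    forall x A, k x A = K (Y n x) A.
  apply: probability_kernel_of_fun.
  - by move=> x; exact: (measure0 (K (Y n x))).
  - by move=> x A; exact: (measure_ge0 (K (Y n x))).
  - by move=> x; exact: (@measure_semi_sigma_additive _ _ _ (K (Y n x))).
  - move=> A mA.
    exact: (measurableT_comp (measurable_kernel K _ mA) (@measurable_chain_hist n m)).
  - by move=> x; exact: (prob_kernel (Y n x)).
rewrite (@disintegration _ _ _ Omega (Ohist n m) state R P id (Y n.+1)
  (@measurable_hist_id n m) (measurable_chain n.+1) k F)//.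
  by apply: eq_integral => w _; apply: eq_measure_integral => A mA _; rewrite kE.
move=> G B mG mB /=; rewrite (hist_chain_kernel mG)//.
by apply: eq_integral => w _; rewrite kE.
Qed.

(** * Jump times and the number of jumps in a time window *)

Local Notation rt := (fun g : state => fine (rate g)).
Local Notation hold i w := (holding_time (E i w) (rate (Y i w))).

Lemma rt_ge0 (g : state) : 0 <= rt g.
Proof. by rewrite fine_ge0// measure_ge0. Qed.

Lemma measurable_rt : measurable_fun setT (rt : state -> R).
Proof. exact: measurable_fine_rate. Qed.

(** The exponential law makes the holding variables positive only almost surely; off this event the
    jump times need not increase. *)
Let Epos := [set w : Omega | forall i, 0 < E i w].

Lemma measurable_Epos : measurable Epos.
Proof.
rewrite (_ : Epos = \bigcap_i (E i @^-1` `]0, +oo[)).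
  by apply: bigcapT_measurable => i; exact: measurable_E_preimage.
apply/seteqP; split => w h i; first by rewrite /= in_itv/= andbT.
by have := h i I; rewrite /= in_itv/= andbT.
Qed.

Lemma null_EposC : P (~` Epos) = 0%E.
Proof.
rewrite (_ : ~` Epos = \bigcup_i (E i @^-1` `]-oo, 0])).
  apply/eqP; rewrite -measure_le0.
  apply: (@le_trans _ _ (\sum_(i <oo) P (E i @^-1` `]-oo, 0%R]%classic))%E).
    apply: measure_sigma_subadditive => //.
    - by move=> i; exact: measurable_E_preimage.
    - by apply: bigcup_measurable => i _; exact: measurable_E_preimage.
  by rewrite eseries0// => i _ _; rewrite (law_E con)// -expoE expo_le0.
apply/seteqP; split => w.
  move=> /existsNP[i /negP]; rewrite -leNgt => wi; by exists i.
move=> [i _ wi] /(_ i); have : E i w <= 0 by move: wi; rewrite /= in_itv/=.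
by rewrite leNgt => /negP.
Qed.

Lemma eq_probability_conull (W A B : set Omega) : measurable W -> P (~` W) = 0%E ->
  measurable A -> measurable B -> A `&` W = B `&` W -> P A = P B.
Proof.
move=> mW W0 mA mB AB.
have h D : measurable D -> P D = P (D `&` W).
  move=> mD; rewrite (measureDI P mD mW) [X in (X + _)%E](_ : _ = 0%E) ?add0e//.
  apply/eqP; rewrite -measure_le0 -W0; apply: le_measure; rewrite ?inE//.
  - exact: measurableD.
  - exact: measurableC.
by rewrite h// AB -h.
Qed.

(** Time from the [n]-th jump to [m] jumps later, so that [Ssum 0 m] is [jump_time m]. The offset
    lets an induction restart at each jump. *)
Definition Ssum n m (w : Omega) : \bar R :=
  (\sum_(i < m) hold (n + i)%N w)%E.

Lemma Ssum0 n w : Ssum n 0 w = 0%E.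
Proof. by rewrite /Ssum big_ord0. Qed.

Lemma SsumS n m w : Ssum n m.+1 w = (hold n w + Ssum n.+1 m w)%E.
Proof.
rewrite /Ssum big_ord_recl addn0; congr (_ + _)%E.
by apply: eq_bigr => i _; rewrite /= /bump/= addnS addSn.
Qed.

Lemma rate_rt n w : rate (Y n w) = (rt (Y n w))%:E.
Proof. by rewrite fineK//; apply: rate_fin; exact: Sc_chain. Qed.

Lemma holdE n w : hold n w =
  if rt (Y n w) == 0 then +oo%E else (E n w / rt (Y n w))%:E.
Proof. by rewrite /holding_time rate_rt/= eqe. Qed.

Lemma hold_gt0 n w : Epos w -> (0 < hold n w)%E.
Proof.
move=> Ew; rewrite holdE; case: ifPn => // r0.
by rewrite lte_fin divr_gt0// lt_neqAle eq_sym r0 rt_ge0.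
Qed.

(** The product form, used in [jumps_given], includes rate 0: the holding time is then infinite and
    the right-hand side reads [0 < E n w]. *)
Lemma hold_gt n w (r : R) : Epos w -> (r%:E < hold n w)%E = (rt (Y n w) * r < E n w).
Proof.
move=> Ew; rewrite holdE; case: ifPn => [/eqP ->|r0].
  by rewrite mul0r ltry Ew.
rewrite lte_fin ltr_pdivlMr 1?mulrC//.
by rewrite lt_neqAle eq_sym r0 rt_ge0.
Qed.

Lemma hold_gtNy n w : (-oo < hold n w)%E.
Proof. by rewrite holdE; case: ifP => // _; rewrite ltNyr. Qed.

Lemma Ssum_gtNy n m w : (-oo < Ssum n m w)%E.
Proof.
elim: m n => [|m IH] n; first by rewrite Ssum0.
by rewrite SsumS lteNye adde_eq_ninfty; apply/negP => /orP[] /eqP h;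
  have := hold_gtNy n w; have := IH n.+1; rewrite h.
Qed.

Lemma Ssum_ge0 n m w : Epos w -> (0 <= Ssum n m w)%E.
Proof. by move=> Ew; apply: sume_ge0 => i _; exact/ltW/hold_gt0. Qed.

(* [m] jumps occur in the time [r] following the [n]-th jump. *)
Definition window n m (r : Omega -> R) : set Omega :=
  [set w | (Ssum n m w <= (r w)%:E)%E && ((r w)%:E < Ssum n m.+1 w)%E].

Lemma window0 n r w : Epos w ->
  window n 0 r w <-> (0 <= r w) && (rt (Y n w) * r w < E n w).
Proof.
by move=> Ew; rewrite /window/= Ssum0 SsumS Ssum0 adde0 lee_fin hold_gt.
Qed.

(** The first jump consumes its holding time from [r]. At rate 0 both sides are false, so the
    conventional value of the division by 0 does no harm. *)
Lemma windowS n m r w : Epos w -> window n m.+1 r w <->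
  E n w <= rt (Y n w) * r w /\
  window n.+1 m (fun w => r w - E n w / rt (Y n w)) w.
Proof.
move=> Ew; have := hold_gt n (r w) Ew.
rewrite (leNgt (E n w)) => <-; rewrite /window/= !(SsumS n) holdE.
have := Ssum_gtNy n.+1 m.+1 w; have := Ssum_gtNy n.+1 m w.
have := Ssum_ge0 n.+1 m Ew.
move: (Ssum n.+1 m w) (Ssum n.+1 m.+1 w) => a b; case: ifPn => r0.
  move=> a0 aN bN; split; last by move=> []; rewrite ltry.
  by rewrite addye -?ltNye// leye_eq.
rewrite lte_fin -leNgt; move: a b => [a| |] [b| |]//=; rewrite ?lee_fin ?lte_fin.
- move=> a0 _ _; split; last by move=> [_ /andP[? ?]]; apply/andP; split; lra.
  by move=> /andP[? ?]; split; [lra|apply/andP; split; lra].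
- move=> a0 _ _; rewrite ?ltry ?andbT; split; first by move=> ?; split; lra.
  by move=> [_ ?]; lra.
- by move=> _ _ _; split => // -[].
- by move=> _ _ _; split => // -[].
Qed.

Lemma measurable_hold n m i : (i <= n)%N -> (i < m)%N ->
  measurable_fun setT ((fun w => hold i w) : Ohist n m -> \bar R).
Proof.
move=> ni im.
have mY : measurable_fun setT (Y i : Ohist n m -> state).
  exact: (measurableT_comp (@measurable_chain_hist i m) (measurable_hist_sub ni (leqnn m))).
have mr := measurableT_comp measurable_rt mY.
under eq_fun do rewrite holdE.
apply: measurable_fun_ifT => //.
  exact: measurable_fun_eqr.
apply/measurable_EFinP; apply: measurable_funM; first exact: measurable_E_hist.
by apply: ge0_measurable_inv => // w; exact: rt_ge0.
Qed.

Lemma measurable_Ssum n m k j : (k + m <= n.+1)%N -> (k + m <= j)%N ->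
  measurable_fun setT (Ssum k m : Ohist n j -> \bar R).
Proof.
move=> kn kj; apply: emeasurable_sum => i; apply: measurable_hold.
  by rewrite -ltnS (leq_trans _ kn)// ltn_add2l.
by rewrite (leq_trans _ kj)// ltn_add2l.
Qed.

Lemma measurable_SsumT k m : measurable_fun setT (Ssum k m).
Proof.
apply: measurable_sub_fun (@measurable_Ssum (k + m) m k (k + m) _ _) => //.
exact: hist_gen_measurable.
Qed.

Lemma measurable_window n m r : measurable_fun setT r -> measurable (window n m r).
Proof.
move=> mr; have mr' : measurable_fun setT (fun w => (r w)%:E) by exact/measurable_EFinP.
rewrite [window _ _ _](_ : _ = [set w | (Ssum n m w <= (r w)%:E)%E] `&`
  [set w | ((r w)%:E < Ssum n m.+1 w)%E]); last first.
  by apply/seteqP; split => w; [move=> /andP[]|move=> [? ?]; apply/andP].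
apply: measurableI.
  by rewrite -[X in measurable X]setTI; apply: measurable_lee => //; exact: measurable_SsumT.
by rewrite -[X in measurable X]setTI; apply: measurable_lte => //; exact: measurable_SsumT.
Qed.

Lemma measurable_chain_preimage n A : measurable A -> measurable (Y n @^-1` A).
Proof. by move=> mA; rewrite -[X in measurable X]setTI; exact: measurable_chain. Qed.

Local Notation jg := (jumps_given K rt).
Local Notation js := (jumps K rt).

Lemma integral_expo_gt0 (h : R -> \bar R) : measurable_fun setT h ->
  (forall u, 0 <= h u)%E ->
  (\int[expo]_u h u = \int[expo]_(u in `]0%R, +oo[) h u)%E.
Proof.
move=> mh h0.
rewrite (@ge0_negligible_integral _ (measurableTypeR R) R expo setT `]-oo, 0%R]%classic)//.
- by rewrite setTD setCitvl.
- exact: expo_le0.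
Qed.

(** Induction on [m], with [r] allowed to depend on [E n], since the time left after a jump does. In
    the inductive step the hypothesis at [n.+1] still contains [E n.+1] and [Y n.+1]; integrating
    them out in this order produces the two integrals of [jumps_given]. *)
Lemma window_law m n (G : set Omega) (r : Omega -> R) (A : set state) :
  Hist n n.+1 G -> measurable_fun setT (r : Ohist n n.+1 -> R) -> measurable A ->
  P (G `&` window n m r `&` Y (n + m) @^-1` A) =
  (\int[P]_(w in G) jg m A (Y n w) (r w) (E n w))%E.
Proof.
move=> + + mA; elim: m n G r => [|m IH] n G r HG mr.
  have mrT : measurable_fun setT r by apply: measurable_sub_fun mr; exact: hist_gen_measurable.
  have mG := hist_measurable HG.
  have mYA := measurable_chain_preimage n mA.
  pose X := [set w | (0 <= r w) && (rt (Y n w) * r w < E n w)].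
  have mrt : measurable_fun setT (fun w => rt (Y n w)).
    exact: (measurableT_comp measurable_rt (measurable_chain n)).
  have mX : measurable X.
    rewrite /X -[X in measurable X]setTI; apply: measurable_and => //.
      exact: measurable_fun_ler.
    apply: measurable_fun_ltr; last exact: (measurable_E con).
    exact: measurable_funM.
  rewrite addn0 (@eq_probability_conull Epos _ (X `&` Y n @^-1` A `&` G)) //.
  - rewrite -integral_indic//; last exact: measurableI.
    apply: eq_integral => w _ /=; rewrite indicE in_setI.
    have -> : (w \in X) = (0 <= r w) && (rt (Y n w) * r w < E n w).
      by apply/idP/idP; rewrite inE.
    by case: ifPn => //= _; rewrite indicE.
  - exact: measurable_Epos.
  - exact: null_EposC.
  - by apply: measurableI => //; apply: measurableI => //; exact: measurable_window.
  - by apply: measurableI => //; apply: measurableI.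
  - apply/seteqP; split => w [] [].
      by move=> [Gw /window0] + Aw Ew => /(_ Ew) Xw; split.
    by move=> [Xw Aw] Gw Ew; split => //; split => //; split => //; apply/window0.
pose r' w := r w - E n w / rt (Y n w).
pose G' := G `&` [set w | E n w <= rt (Y n w) * r w].
have mrt : measurable_fun setT ((fun w => rt (Y n w)) : Ohist n n.+1 -> R).
  exact: (measurableT_comp measurable_rt (@measurable_chain_hist n n.+1)).
have mEn : measurable_fun setT (E n : Ohist n n.+1 -> R) by exact: measurable_E_hist.
have mr' : measurable_fun setT (r' : Ohist n n.+1 -> R).
  apply: measurable_funB => //; apply: measurable_funM => //.
  by apply: ge0_measurable_inv => // w; exact: rt_ge0.
have HG' : Hist n n.+1 G'.
  have mG1 : measurable (G : set (Ohist n n.+1)) by [].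
  have : measurable (G' : set (Ohist n n.+1)).
    apply: measurableI => //; rewrite -[X in measurable X]setTI.
    apply: measurable_fun_ler => //; exact: measurable_funM.
  by [].
have sub a b : (n <= a)%N -> (n.+1 <= b)%N ->
    measurable_fun setT (id : Ohist a b -> Ohist n n.+1).
  exact: measurable_hist_sub.
have HG'2 a b : (n <= a)%N -> (n.+1 <= b)%N -> measurable (G' : set (Ohist a b)).
  by move=> na nb; have := sub a b na nb measurableT G' HG'; rewrite setTI.
have mr'2 a b : (n <= a)%N -> (n.+1 <= b)%N -> measurable_fun setT (r' : Ohist a b -> R).
  by move=> na nb; exact: (measurableT_comp mr' (sub a b na nb)).
(* The condition that the first jump occurs in time is known once [E n] is, and joins [G]; the rest
   is a window starting at the next jump. *)
transitivity (P (G' `&` window n.+1 m r' `&` Y (n.+1 + m) @^-1` A)).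
  have mrT : measurable_fun setT r by apply: measurable_sub_fun mr; exact: hist_gen_measurable.
  have mrT' : measurable_fun setT r' by apply: measurable_sub_fun mr'; exact: hist_gen_measurable.
  rewrite addnS addSn; apply: (@eq_probability_conull Epos).
  - exact: measurable_Epos.
  - exact: null_EposC.
  - apply: measurableI; last exact: measurable_chain_preimage.
    by apply: measurableI; [exact: hist_measurable HG|exact: measurable_window].
  - apply: measurableI; last exact: measurable_chain_preimage.
    by apply: measurableI; [exact: hist_measurable HG'|exact: measurable_window].
  - apply/seteqP; split => w [] [].
      by move=> [Gw /windowS] + Aw Ew => /(_ Ew)[? ?]; do !split.
    by move=> [[Gw ?] ?] Aw Ew; do !split => //; apply/windowS.
rewrite IH; last 2 first.
- exact: HG'2.
- exact: mr'2.
(* [E n.+1] is integrated out first, being independent of the new state and of all that precedes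
   it. *)
pose F1 (z : Ohist n.+1 n.+1 * measurableTypeR R) :=
  (jg m A (Y n.+1 z.1) (r' z.1) z.2 * (\1_G' z.1)%:E)%E.
transitivity (\int[P]_w F1 (w, E n.+1 w))%E.
  rewrite integral_mkcond; apply: eq_integral => w _.
  by rewrite patchE /F1/= indicE; case: ifPn; rewrite ?mule1 ?mule0.
have mfst : measurable_fun setT (fun z : Ohist n.+1 n.+1 * measurableTypeR R => z.1).
  exact: measurable_fst.
rewrite disintegration_E; last 2 first.
- by move=> z; rewrite mule_ge0 ?lee_fin// jumps_given_ge0.
- apply: emeasurable_funM; last first.
    apply/measurable_EFinP.
    exact: (measurableT_comp (measurable_indic (HG'2 n.+1 n.+1 (leqnSn n) (leqnn _))) mfst).
  have m2 : measurable_fun setT (fun z : Ohist n.+1 n.+1 * measurableTypeR R =>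
      (Y n.+1 z.1 : state, r' z.1, z.2 : R)).
    apply/measurable_fun_pair; last exact: measurable_snd.
    apply/measurable_fun_pair.
      exact: (measurableT_comp (@measurable_chain_hist n.+1 n.+1) mfst).
    exact: (measurableT_comp (mr'2 n.+1 n.+1 (leqnSn n) (leqnn _)) mfst).
  exact: (measurableT_comp (measurable_jumps_given K rt_ge0 measurable_rt m mA) m2).
(* Then the new state, whose law given the previous states and [E n] is [K (Y n w)]. *)
pose F2 (z : Ohist n n.+1 * state) := (js m A z.2 (r' z.1) * (\1_G' z.1)%:E)%E.
transitivity (\int[P]_w F2 (w, Y n.+1 w))%E.
  apply: eq_integral => w _; rewrite /F1/= /F2/= ge0_integralZr//.
  - exact: (measurable_jumps_given_last K rt_ge0 measurable_rt).
  - by move=> u _; exact: jumps_given_ge0.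
have mfst' : measurable_fun setT (fun z : Ohist n n.+1 * state => z.1).
  exact: measurable_fst.
rewrite disintegration_chain; last 2 first.
- by move=> z; rewrite mule_ge0 ?lee_fin// jumps_ge0.
- apply: emeasurable_funM; last first.
    apply/measurable_EFinP.
    exact: (measurableT_comp (measurable_indic (HG'2 n n.+1 (leqnn n) (leqnn _))) mfst').
  have m2 : measurable_fun setT (fun z : Ohist n n.+1 * state => (z.2, r' z.1)).
    apply/measurable_fun_pair; first exact: measurable_snd.
    exact: (measurableT_comp mr' mfst').
  exact: (measurableT_comp (measurable_jumps K rt_ge0 measurable_rt m mA) m2).
rewrite [RHS]integral_mkcond; apply: eq_integral => w _.
rewrite /F2/= ge0_integralZr//; last 2 first.
- exact: (measurable_jumps_first K rt_ge0 measurable_rt).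
- by move=> y _; exact: jumps_ge0.
rewrite patchE indicE /G' in_setI; case: (w \in G) => /=; last by rewrite mule0.
have -> : (w \in [set w | E n w <= rt (Y n w) * r w]) = (E n w <= rt (Y n w) * r w).
  by apply/idP/idP; rewrite inE.
by case: ifPn; rewrite ?mule1 ?mule0.
Qed.

(** On [G'] the holding time has lasted beyond [r]. Its excess is again exponential, and
    [jumps_given_shift] identifies the outcome with that of a process started afresh from [Y n] with
    horizon [t]. *)
Lemma window_memoryless m n (G : set Omega) (r : Omega -> R) (t : R) (A : set state) :
  Hist n n G -> measurable_fun setT (r : Ohist n n -> R) ->
  (forall w, G w -> 0 <= r w) -> 0 <= t -> measurable A ->
  let G' := G `&` [set w | rt (Y n w) * r w < E n w] in
  P (G' `&` window n m (fun w => r w + t) `&` Y (n + m) @^-1` A) =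
  (\int[P]_(w in G') js m A (Y n w) t)%E.
Proof.
move=> HG mr r0 t0 mA G'.
have mrt : measurable_fun setT ((fun w => rt (Y n w)) : Ohist n n -> R).
  exact: (measurableT_comp measurable_rt (@measurable_chain_hist n n)).
have sub : measurable_fun setT (id : Ohist n n.+1 -> Ohist n n).
  exact: measurable_hist_sub.
have mr1 : measurable_fun setT (r : Ohist n n.+1 -> R).
  exact: (measurableT_comp mr sub).
have mrt1 : measurable_fun setT ((fun w => rt (Y n w)) : Ohist n n.+1 -> R).
  exact: (measurableT_comp mrt sub).
have HG' : Hist n n.+1 G'.
  have mG1 : measurable (G : set (Ohist n n.+1)).
    by have := sub measurableT G HG; rewrite setTI.
  have : measurable (G' : set (Ohist n n.+1)).
    apply: measurableI => //; rewrite -[X in measurable X]setTI.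
    apply: measurable_fun_ltr => //; last exact: measurable_E_hist.
    exact: measurable_funM.
  by [].
rewrite window_law//; last exact: measurable_funD.
have mfst : measurable_fun setT (fun z : Ohist n n * measurableTypeR R => z.1).
  exact: measurable_fst.
have msnd : measurable_fun setT (fun z : Ohist n n * measurableTypeR R => z.2 : R).
  exact: measurable_snd.
pose X (z : Ohist n n * measurableTypeR R) := (z.1 \in G) && (rt (Y n z.1) * r z.1 < z.2).
have mX : measurable_fun setT X.
  apply: measurable_and.
    have mG : measurable (G : set (Ohist n n)) by [].
    have mGb : measurable_fun setT ((fun w => w \in G) : Ohist n n -> bool).
      by apply: measurable_fun_bool true _; rewrite setTI (_ : _ @^-1` _ = G)//;
        apply/seteqP; split => w /=; [exact: set_mem|exact: mem_set].
    exact: (measurableT_comp mGb mfst).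
  apply: measurable_fun_ltr => //.
  by apply: measurable_funM; [exact: (measurableT_comp mrt mfst)|exact: (measurableT_comp mr mfst)].
(* Both sides are integrals over [G'], whose condition on [E n] becomes a half-line once [E n] is
   integrated out. On the right the integrand is free of [u] and only the mass of the half-line
   remains. *)
have lift (H : Ohist n n -> R -> \bar R) :
    (forall w u, 0 <= H w u)%E ->
    measurable_fun setT (fun z : Ohist n n * measurableTypeR R => H z.1 z.2) ->
    (\int[P]_(w in G') H w (E n w) =
     \int[P]_(w in G) \int[expo]_(u in `](rt (Y n w) * r w)%R, +oo[) H w u)%E.
  move=> H0 mH.
  pose F (z : Ohist n n * measurableTypeR R) := (if X z then H z.1 z.2 else 0)%E.
  transitivity (\int[P]_w F (w, E n w))%E.
    rewrite integral_mkcond; apply: eq_integral => w _.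
    rewrite patchE /F /X/= /G' in_setI.
    have -> : (w \in [set w | rt (Y n w) * r w < E n w]) = (rt (Y n w) * r w < E n w).
      by apply/idP/idP; rewrite inE.
    by [].
  rewrite disintegration_E; last 2 first.
  - by move=> z; rewrite /F; case: ifP.
  - exact: measurable_fun_ifT.
  rewrite [RHS]integral_mkcond; apply: eq_integral => w _.
  rewrite patchE /F /X /=; case: (w \in G) => /=; last first.
    by rewrite integral0_eq.
  rewrite [RHS]integral_mkcond; apply: eq_integral => u _.
  by rewrite patchE mem_setE in_itv/= andbT.
rewrite (lift (fun w u => jg m A (Y n w) (r w + t) u)); last 2 first.
- by move=> w u; exact: jumps_given_ge0.
- have m2 : measurable_fun setT (fun z : Ohist n n * measurableTypeR R =>
      (Y n z.1 : state, r z.1 + t, z.2 : R)).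
    apply/measurable_fun_pair; last exact: measurable_snd.
    apply/measurable_fun_pair.
      exact: (measurableT_comp (@measurable_chain_hist n n) mfst).
    by apply: measurable_funD => //; exact: (measurableT_comp mr mfst).
  exact: (measurableT_comp (measurable_jumps_given K rt_ge0 measurable_rt m mA) m2).
rewrite (lift (fun w u => js m A (Y n w) t)); last 2 first.
- by move=> w u; exact: jumps_ge0.
- have mJ := measurable_jumps_first K rt_ge0 measurable_rt m t mA.
  exact: (measurableT_comp mJ (measurableT_comp (@measurable_chain_hist n n) mfst)).
apply: eq_integral => w; rewrite inE => Gw.
have rr0 : 0 <= rt (Y n w) * r w by rewrite mulr_ge0 ?rt_ge0 ?r0.
have mjg (s : R) := measurable_jumps_given_last K rt_ge0 measurable_rt m (Y n w) s mA.
rewrite (expo_memoryless rr0 (mjg _)); last by move=> u; exact: jumps_given_ge0.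
rewrite integral_cst// [in RHS]muleC; congr (_ * _)%E.
  by have := expo_gt (rt (Y n w) * r w); rewrite max_l// => <-.
rewrite /jumps [RHS](integral_expo_gt0 (mjg t)); last by move=> u; exact: jumps_given_ge0.
apply: eq_integral => u; rewrite inE/= in_itv/= andbT => u0.
by rewrite (jumps_given_shift K rt m A (Y n w) (r0 _ Gw) t0 u0).
Qed.

(** * Non-explosion *)

(** Affine bound for the rate of the [n]-th state; the extra 1 keeps it positive, hence fit to be a
    divisor, even when [f] is null. *)
Let cap (n : nat) : R := fine (rate f) + n%:R * rate_jump rad (d := d) + 1.

Let cap_gt0 n : 0 < cap n.
Proof.
rewrite ltr_wpDl// addr_ge0//; first exact: (rt_ge0 f).
by rewrite mulr_ge0//; exact: rate_jump_ge0.
Qed.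

Let rt_chain_le n w : rt (Y n w) <= cap n.
Proof.
have : rt (Y n w) <= fine (rate f) + n%:R * rate_jump rad (d := d).
  elim: n => [|n IH]; first by rewrite mul0r addr0.
  have : (rate (Y n.+1 w) <= rate (Y n w) + (rate_jump rad (d := d))%:E)%E.
    exact: (rate_update rad0 U01 (C n w) (mark (Y n w) (C n w) (V n w)) (Sc_chain n w)).
  rewrite (rate_rt n.+1) (rate_rt n) -EFinD lee_fin => /le_trans; apply.
  by rewrite -natr1 mulrDl mul1r addrA lerD2r.
by move=> /le_trans; apply; rewrite lerDl.
Qed.

Let hold_ge n w : Epos w -> ((E n w / cap n)%:E <= hold n w)%E.
Proof.
move=> Ew; rewrite holdE; case: ifPn => [_|r0]; first exact: leey.
rewrite lee_fin ler_pM2l// lef_pV2 ?posrE//.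
by rewrite lt_neqAle eq_sym r0 rt_ge0.
Qed.

Let Z N (w : Omega) : R := expR (- \sum_(i < N) E i w / cap i).

Let measurable_Z N : measurable_fun setT (Z N : Ohist 0 N -> R).
Proof.
apply: (measurableT_comp (@measurable_expR R)).
apply: measurableT_comp => //; apply: measurable_sum => i.
by apply: measurable_funM => //; exact: measurable_E_hist.
Qed.

Let measurable_ZT N : measurable_fun setT (Z N).
Proof. by apply: (measurable_sub_fun _ (@measurable_Z N)); exact: hist_gen_measurable. Qed.

(** The exact value is [q / (q + 1)]. Splitting at [u = 1] avoids the density: the exponential is at
    most 1 before and at most [q / (q + 1)] after, which gives [1 - expR (-1) / (q + 1)]. The bound
    is put in exponential form so that products over [i] become sums. *)
Let laplace_le (q : R) : 0 < q ->
  (\int[expo]_u (expR (- (u / q)))%:E <= (expR (- (expR (-1) / (q + 1))))%:E)%E.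
Proof.
move=> q0.
have mexp : measurable_fun setT (fun u : measurableTypeR R => (expR (- (u / q)))%:E).
  apply/measurable_EFinP; apply: (measurableT_comp (@measurable_expR R)).
  by apply: measurableT_comp => //; exact: measurable_funM.
have qq0 : 0 <= q / (q + 1) by rewrite divr_ge0// ?addr_ge0// ltW.
rewrite integral_expo_gt0//.
apply: (@le_trans _ _ (\int[expo]_(u in `]0%R, +oo[)
    ((\1_`]-oo, 1%R]%classic u)%:E + (q / (q + 1))%:E * (\1_`]1%R, +oo[%classic u)%:E))%E).
  apply: ge0_le_integral => //.
  - exact: measurable_funTS.
  - apply: measurable_funTS; apply: emeasurable_funD; first by apply/measurable_EFinP.
    by apply: emeasurable_funM => //; apply/measurable_EFinP.
  - move=> u; rewrite /= in_itv/= andbT => u0; rewrite !indicE !mem_setE !in_itv/= andbT.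
    rewrite -EFinM -EFinD lee_fin; have [u1|u1] := leP u 1.
      by rewrite mulr0 addr0 -[leRHS]expR0 ler_expR oppr_le0 divr_ge0// ltW.
    rewrite mulr1 add0r expRN -[leRHS]invrK.
    rewrite lef_pV2 ?posrE ?expR_gt0 ?invr_gt0 ?divr_gt0 ?addr_gt0//.
    apply: le_trans (expR_ge1Dx _); rewrite invf_div mulrDl mul1r divff ?gt_eqF//.
    by rewrite lerD2l -[leLHS]mul1r ler_pM2r ?invr_gt0// ltW.
rewrite -integral_expo_gt0; last 2 first.
- apply: emeasurable_funD; first by apply/measurable_EFinP.
  by apply: emeasurable_funM => //; apply/measurable_EFinP.
- by move=> u; rewrite adde_ge0// ?lee_fin// mulr_ge0.
rewrite ge0_integralD//; last 3 first.
- by apply/measurable_EFinP.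
- by move=> u _; rewrite mule_ge0// lee_fin.
- by apply: emeasurable_funM => //; apply/measurable_EFinP.
rewrite ge0_integralZl//; last by apply/measurable_EFinP.
rewrite !integral_indic// !setIT.
have e2 : expo `]1%R, +oo[%classic = (expR (- (1 : R)))%:E.
  by rewrite expo_gt max_l.
have e1 : expo `]-oo, 1%R]%classic = (1 - expR (- (1 : R)))%:E.
  by rewrite EFinB -e2 -probability_setC// setCitvr.
rewrite [X in (X + _ <= _)%E]e1 [X in (_ + _ * X <= _)%E]e2.
rewrite -EFinM -EFinD lee_fin.
apply: le_trans (expR_ge1Dx _).
have -> : q / (q + 1) = 1 - (q + 1)^-1.
  by field; rewrite gt_eqF// addr_gt0.
by rewrite le_eqVlt; apply/orP; left; apply/eqP; ring.
Qed.

Let integral_Z_le N :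
  (\int[P]_w (Z N w)%:E <=
   (expR (- \sum_(i < N) expR (-1) / (cap i + 1)))%:E)%E.
Proof.
elim: N => [|N IH].
  rewrite big_ord0 oppr0 expR0 (eq_integral (cst 1%E)); last first.
    by move=> w _; rewrite /Z big_ord0 oppr0 expR0.
  by rewrite integral_cst// mul1e probability_le1.
pose F (z : Ohist 0 N * measurableTypeR R) := ((Z N z.1)%:E * (expR (- (z.2 / cap N)))%:E)%E.
rewrite (eq_integral (fun w => F (w, E N w))); last first.
  by move=> w _; rewrite /Z big_ord_recr/= opprD expRD EFinM.
have mexp : measurable_fun setT (fun u : measurableTypeR R => (expR (- (u / cap N)))%:E).
  apply/measurable_EFinP; apply: (measurableT_comp (@measurable_expR R)).
  by apply: measurableT_comp => //; exact: measurable_funM.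
rewrite disintegration_E; last 2 first.
- by move=> z; rewrite mule_ge0// lee_fin expR_ge0.
- apply: emeasurable_funM.
    apply/measurable_EFinP.
    exact: (measurableT_comp (@measurable_Z N) (@measurable_fst _ _ _ _)).
  exact: (measurableT_comp mexp (@measurable_snd _ _ _ _)).
have Fle w : (\int[expo]_u F (w, u) =
    (Z N w)%:E * \int[expo]_u (expR (- (u / cap N)))%:E)%E.
  by rewrite /F/= ge0_integralZl// lee_fin expR_ge0.
apply: (@le_trans _ _ (\int[P]_w ((Z N w)%:E *
    (expR (- (expR (-1) / (cap N + 1))))%:E))%E).
  apply: ge0_le_integral => //.
  - by move=> w _; apply: integral_ge0 => u _; rewrite mule_ge0// lee_fin expR_ge0.
  - under eq_fun do rewrite Fle.
    by apply: emeasurable_funM => //; apply/measurable_EFinP; exact: measurable_ZT.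
  - by apply: emeasurable_funM => //; apply/measurable_EFinP => //; exact: measurable_ZT.
  - move=> w _; rewrite Fle.
    by apply: lee_wpmul2l; [rewrite lee_fin expR_ge0|exact: laplace_le].
rewrite ge0_integralZr; [|by []|by apply/measurable_EFinP; exact: measurable_ZT|
  by move=> w _; rewrite lee_fin expR_ge0|by rewrite lee_fin expR_ge0].
rewrite big_ord_recr/= opprD expRD EFinM.
by apply: lee_wpmul2r => //; rewrite lee_fin expR_ge0.
Qed.

Let sum_cap_unbounded (A : R) : exists N, A <= \sum_(i < N) expR (-1) / (cap i + 1).
Proof.
(* Chosen so that [cap i + 1] is at most [M * i.+1%:R], which reduces the claim to the harmonic
   series. *)
pose M := cap 0 + rate_jump rad (d := d) + 1.
have j0 : 0 <= rate_jump rad (d := d) by exact: rate_jump_ge0.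
have M0 : 0 < M by rewrite addr_gt0// ltr_wpDr// cap_gt0.
have capM i : cap i + 1 <= M * i.+1%:R.
  have := rt_ge0 f; rewrite /M /cap -natr1 => f0.
  have : 0 <= i%:R :> R by [].
  nra.
have : ~ has_ubound (range (series (@harmonic R))).
  move=> hub; apply: (@dvg_harmonic R); apply: nondecreasing_is_cvgn hub.
  by apply: nondecreasing_series => n _ _; exact: harmonic_ge0.
move=> /has_ubPn/(_ (A * M * expR 1)) [_ [N _ <-]] AN; exists N.
apply: (@le_trans _ _ (\sum_(i < N) expR (-1) / M * i.+1%:R^-1)).
  rewrite -mulr_sumr; move/ltW : AN; rewrite /series/= big_mkord => AN.
  rewrite expRN -invfM mulrC ler_pdivlMr ?mulr_gt0 ?expR_gt0//.
  by rewrite [expR 1 * M]mulrC mulrA.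
apply: ler_sum => i _; rewrite -mulrA ler_pM2l ?expR_gt0// -invfM.
rewrite lef_pV2 ?posrE; [exact: capM|by rewrite mulr_gt0// ltr0n|].
by rewrite addr_gt0// cap_gt0.
Qed.

Let small (M : nat) := [set w | forall N, expR (- M%:R) <= Z N w].

Let measurable_small M : measurable (small M).
Proof.
rewrite (_ : small M = \bigcap_N (Z N @^-1` `[expR (- M%:R), +oo[)).
  apply: bigcapT_measurable => N; rewrite -[X in measurable X]setTI.
  exact: measurable_ZT.
apply/seteqP; split => w h N; first by rewrite /= in_itv/= andbT.
by have := h N I; rewrite /= in_itv/= andbT.
Qed.

(** On [small M] the lower bounds of the jump times never exceed [M]. Markov's inequality for [Z N]
    bounds its probability, up to the factor [expR (- M%:R)], by means that tend to 0. *)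
Let null_small M : P (small M) = 0%E.
Proof.
have bound N : ((expR (- M%:R))%:E * P (small M) <=
    (expR (- \sum_(i < N) expR (-1) / (cap i + 1)))%:E)%E.
  apply: le_trans (integral_Z_le N).
  rewrite -[X in (_ * P X)%E]setIT -integral_indic//.
  rewrite -ge0_integralZl ?lee_fin ?expR_ge0//; last first.
    by apply/measurable_EFinP.
  apply: ge0_le_integral => //.
  - by apply: emeasurable_funM => //; apply/measurable_EFinP.
  - by apply/measurable_EFinP; exact: measurable_ZT.
  - move=> w _; rewrite -EFinM lee_fin indicE.
    have [/set_mem/(_ N)|_] := boolP (w \in small M); first by rewrite mulr1.
    by rewrite mulr0 expR_ge0.
have Pf : P (small M) \is a fin_num by rewrite fin_num_measure.
rewrite -(fineK Pf); congr EFin; apply/eqP; rewrite eq_le fine_ge0// andbT.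
rewrite leNgt; apply/negP => p0.
pose y := expR (- M%:R) * fine (P (small M)).
have y0 : 0 < y by rewrite mulr_gt0// expR_gt0.
(* With this choice [expR (2 / y)] is at least [1 + 2 / y], which exceeds [y^-1], contradicting the
   lower bound [y]. *)
have [N HN] := sum_cap_unbounded (2 / y).
have := bound N; rewrite -(fineK Pf) -EFinM lee_fin -/y => yN.
have : y <= expR (- (2 / y)).
  by apply: le_trans yN _; rewrite ler_expR lerN2.
apply/negP; rewrite -ltNge expRN -[ltRHS]invrK ltf_pV2 ?posrE ?expR_gt0 ?invr_gt0//.
apply: lt_le_trans (expR_ge1Dx _).
have : 0 < y^-1 by rewrite invr_gt0.
lra.
Qed.

(* An almost sure event on which the process does not explode. *)
Let Wgood := Epos `&` ~` (\bigcup_M small M).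

Lemma measurable_Wgood : measurable Wgood.
Proof.
apply: measurableI; first exact: measurable_Epos.
by apply: measurableC; exact: bigcupT_measurable.
Qed.

Lemma null_WgoodC : P (~` Wgood) = 0%E.
Proof.
apply/eqP; rewrite -measure_le0 setCI setCK.
apply: (le_trans (measureU2 _ _ _)).
- by apply: measurableC; exact: measurable_Epos.
- exact: bigcupT_measurable.
rewrite [X in (X + _ <= _)%E]null_EposC add0e.
apply: (@le_trans _ _ (\sum_(M <oo) P (small M))%E).
  by apply: measure_sigma_subadditive => //; exact: bigcupT_measurable.
by rewrite eseries0// => M _ _; rewrite null_small.
Qed.

Lemma Ssum_nondecreasing n w : Epos w -> nondecreasing_seq (fun m => Ssum n m w).
Proof.
move=> Ew; apply/nondecreasing_seqP => m.
by rewrite /Ssum big_ord_recr/= leeDl// ltW// hold_gt0.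
Qed.

Lemma Ssum_dvg w : Wgood w -> Ssum 0 m w @[m --> \oo] --> +oo%E.
Proof.
move=> [Ew Sw]; apply/cvgeyPge => A.
have [N AN] : exists N, (A%:E <= Ssum 0 N w)%E.
  apply: contra_notP Sw => /forallNP SA; exists (Num.bound `|A|) => // N.
  rewrite /Z ler_expR lerN2.
  have : (Ssum 0 N w < A%:E)%E by rewrite ltNge; apply/negP/SA.
  have : ((\sum_(i < N) E i w / cap i)%:E <= Ssum 0 N w)%E.
    by rewrite -sumEFin; apply: lee_sum => i _; exact: hold_ge.
  move=> /le_lt_trans/[apply]; rewrite lte_fin => /ltW/le_trans; apply.
  by apply: (le_trans (ler_norm _)); exact/ltW/archi_boundP.
near=> n; apply: le_trans AN _; apply: Ssum_nondecreasing => //.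
by near: n; exists N.
Unshelve. all: by end_near. Qed.

Lemma non_explosion : non_explosive rad U P f C V E.
Proof.
rewrite /non_explosive.
pose T := [set w | jump_time rad U f C V E n w @[n --> \oo] --> +oo%E].
(* Convergence to infinity tested on integer levels only, hence a countable combination of
   measurable events. *)
have mT : measurable T.
  rewrite (_ : T = \bigcap_A \bigcup_N \bigcap_(n in [set n | (N <= n)%N])
      [set w | ((A : nat)%:R%:E <= Ssum 0 n w)%E]).
    apply: bigcapT_measurable => A; apply: bigcupT_measurable => N.
    apply: bigcap_measurableType => n _; rewrite -[X in measurable X]setTI.
    by apply: measurable_lee => //; exact: measurable_SsumT.
  apply/seteqP; split => w /=.
    by move=> /cvgeyPge Tw A _; have [N _ NA] := Tw A%:R; exists N.
  move=> H; apply/cvgeyPge => A; have [N _ NA] := H (Num.bound `|A|) I.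
  exists N => // n /NA/=; apply: le_trans; rewrite lee_fin.
  by apply: (le_trans (ler_norm _)); exact/ltW/archi_boundP.
have : (P (~` T) <= P (~` Wgood))%E.
  apply: le_measure; rewrite ?inE; [exact: measurableC| |].
    by apply: measurableC; exact: measurable_Wgood.
  by apply: subsetC => w Ww; exact: Ssum_dvg.
rewrite null_WgoodC measure_le0 => /eqP T0.
have := probability_setC P (measurableC mT); rewrite setCK => ->.
by rewrite [X in (_ - X)%E]T0 sube0.
Qed.

(** * Markov property *)

Local Notation X := (process rad U f C V E).
Local Notation ev n t := (window 0 n (fun=> t)).

Lemma window_uniq w (t : R) m n : Epos w -> ev m t w -> ev n t w -> m = n.
Proof.
move=> Ew.
have h i j : (i < j)%N -> ev i t w -> ev j t w -> False.
  move=> ij /andP[_ ti] /andP[tj _].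
  have := Ssum_nondecreasing 0 Ew ij => /le_trans/(_ tj).
  by rewrite leNgt ti.
by move=> mt nt; case: (ltngtP m n) => // [/h|/h]; [move=> /(_ mt nt)|move=> /(_ nt mt)].
Qed.

Lemma processE n w (t : R) : Epos w -> ev n t w -> X t w = Y n w.
Proof.
move=> Ew nt; rewrite /process; case: pselect => [h|[]]; last by exists n.
by case: ex_minnP => m mt _; rewrite (window_uniq Ew nt mt).
Qed.

Lemma Sc_process t w : Sc (X t w).
Proof.
rewrite /process; case: pselect => [h|_]; first exact: Sc_chain.
exact: Sc0.
Qed.

Lemma measurable_process t : measurable_fun setT (X t : Omega -> state).
Proof.
move=> _ A mA; rewrite setTI.
have mev n : measurable (ev n t) by apply: measurable_window.
(* Measurability is required on all of [Omega], including where several indices qualify or none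
   does: the least index is selected as in [process], and the last set accounts for the cemetery
   state. *)
rewrite (_ : _ @^-1` A = \bigcup_n (ev n t `&` \bigcap_(k in `I_n) ~` ev k t `&` Y n @^-1` A) `|`
   ((\bigcap_n ~` ev n t) `&` (if `[< A (cst 0) >] then setT else set0))).
  apply: measurableU.
    apply: bigcupT_measurable => n; apply: measurableI; last exact: measurable_chain_preimage.
    by apply: measurableI => //; apply: bigcap_measurableType => k _; exact: measurableC.
  apply: measurableI; last by case: ifP.
  by apply: bigcapT_measurable => k; exact: measurableC.
apply/seteqP; split => w /=.
  rewrite /process; case: pselect => [h|h]; last first.
    move=> A0; right; split; last by rewrite asboolT.
    by move=> n _ nt; apply: h; exists n.
  case: ex_minnP => m mt mmin Am; left; exists m => //; split => //; split => //.
  by move=> k km kt; have := mmin k kt; rewrite leqNgt km.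
rewrite /process; case: pselect => [h|h].
  case: ex_minnP => m mt mmin [[n _ [[nt nmin] An]]|[]]; last by move=> /(_ m I)/(_ mt).
  suff -> : m = n by [].
  by case: (ltngtP m n) => // [/nmin/(_ mt)|] //; rewrite ltnNge mmin.
by move=> [[n _ [[nt _] _]]|[_]]; [case: h; exists n|case: asboolP].
Qed.

Lemma window_exists n w (s : R) : Wgood w -> (Ssum 0 n w <= s%:E)%E ->
  exists m, ev (n + m) s w.
Proof.
move=> Ww ns; have [Ew _] := Ww.
have [N sN] : exists N, (s%:E < Ssum 0 N w)%E.
  have /cvgeyPgt/(_ s)[N _ NP] := Ssum_dvg Ww.
  by exists N; exact: (NP N (leqnn N)).
pose p N := (s%:E < Ssum 0 N w)%E.
have exN : exists N, p N by exists N.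
have [k sk kmin] := ex_minnP exN; rewrite /p in sk kmin.
have nk : (n < k)%N.
  rewrite ltnNge; apply/negP => kn.
  have := le_trans (Ssum_nondecreasing 0 Ew kn) ns.
  by rewrite leNgt sk.
exists (k.-1 - n)%N; rewrite subnKC; last by rewrite -ltnS prednK// (leq_ltn_trans _ nk).
have k0 : (0 < k)%N by exact: leq_ltn_trans nk.
rewrite /window/= prednK// sk andbT leNgt; apply/negP => /kmin.
by rewrite leqNgt prednK// leqnn.
Qed.

Lemma ae_right_continuous :
  {ae P, forall w t, 0 <= t -> \forall u \near t^'+, X u w = X t w}.
Proof.
exists (~` Wgood); split; first exact/measurableC/measurable_Wgood.
  exact: null_WgoodC.
apply: subsetC => w Ww t t0; have [Ew _] := Ww.
have [m mt] : exists m, ev (0 + m) t w.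
  by apply: window_exists => //; rewrite Ssum0 lee_fin.
rewrite (processE Ew mt); move: mt => /andP[mt tm].
(* [r] is the next jump time, or any later time than [t] if that is infinite. *)
have [r tr rS] : exists2 r, t < r & forall u, u < r -> (u%:E < Ssum 0 m.+1 w)%E.
  move: tm; case: (Ssum 0 m.+1 w) => [r| |//] tr; last first.
    by exists (t + 1) => [|u _]; [rewrite ltrDl|exact: ltry].
  by exists r => // u ur; rewrite lte_fin.
near=> u; apply: processE => //; apply/andP; split.
  by apply: le_trans mt _; rewrite lee_fin.
by apply: rS; near: u; exact: nbhs_right_lt.
Unshelve. all: by end_near. Qed.

Lemma total_probability n (s : R) B : measurable B ->
  (forall w, B w -> (Ssum 0 n w <= s%:E)%E) ->
  P B = (\sum_(m <oo) P (B `&` (Wgood `&` ev (n + m) s)))%E.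
Proof.
move=> mB Bs.
have mW m : measurable (B `&` (Wgood `&` ev (n + m) s)).
  apply: measurableI => //; apply: measurableI; first exact: measurable_Wgood.
  exact: measurable_window.
transitivity (P (\bigcup_m (B `&` (Wgood `&` ev (n + m) s)))).
  apply: (eq_probability_conull measurable_Wgood null_WgoodC) => //.
    by apply: bigcupT_measurable.
  apply/seteqP; split => w.
    move=> [Bw Ww]; split => //.
    by have [m mw] := window_exists Ww (Bs _ Bw); exists m.
  by move=> [[m _ [Bw _]] Ww].
rewrite measure_bigcup//; first by apply: eq_eseriesl => k; rewrite in_setT.
apply/trivIsetP => i j _ _ ij; apply/seteqP; split => // w [[_ [[Ew _] iw]] [_ [_ jw]]].
  by have /addnI/eqP := window_uniq Ew iw jw; rewrite (negbTE ij).
Qed.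

Lemma total_integral (s : R) B (h : Omega -> \bar R) : 0 <= s -> measurable B ->
  measurable_fun setT h -> (forall w, 0 <= h w)%E ->
  (\int[P]_(w in B) h w = \sum_(n <oo) \int[P]_(w in B `&` (Wgood `&` ev n s)) h w)%E.
Proof.
move=> s0 mB mh h0.
have mW m : measurable (B `&` (Wgood `&` ev m s)).
  apply: measurableI => //; apply: measurableI; first exact: measurable_Wgood.
  exact: measurable_window.
rewrite -ge0_integral_bigcup//.
- rewrite (@ge0_negligible_integral _ _ _ P B (~` Wgood))//.
  + congr (integral _ _ _); rewrite setDE setCK.
    apply/seteqP; split => w.
      move=> [Bw Ww]; have [|m mw] := @window_exists 0 w s Ww.
        by rewrite Ssum0 lee_fin.
      by exists m.
    by move=> [m _ [Bw [Ww _]]].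
  + exact/measurableC/measurable_Wgood.
  + exact: measurable_funTS.
  + exact: null_WgoodC.
- exact: measurable_funTS.
- apply/trivIsetP => i j _ _ ij; apply/seteqP; split => // w [[_ [[Ew _] iw]] [_ [_ jw]]].
  by have /eqP := window_uniq Ew iw jw; rewrite (negbTE ij).
Qed.

Let tau n w : R := fine (Ssum 0 n w).

Lemma tauE n w (s : R) : (Ssum 0 n w <= s%:E)%E -> Ssum 0 n w = (tau n w)%:E.
Proof.
move=> ns; rewrite fineK// fin_numElt Ssum_gtNy/=.
exact: le_lt_trans ns (ltry _).
Qed.

Lemma Ssum_cat n m w : Ssum 0 (n + m) w = (Ssum 0 n w + Ssum n m w)%E.
Proof. by rewrite /Ssum big_split_ord. Qed.

Lemma window_split n m w (s t : R) : (Ssum 0 n w <= s%:E)%E ->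
  ev (n + m) (s + t) w <-> window n m (fun w => s - tau n w + t) w.
Proof.
move=> ns; rewrite /window/= -addnS !Ssum_cat (tauE ns).
rewrite [X in X && _](_ : _ = (Ssum n m w <= (s - tau n w + t)%:E)%E); last first.
  have := Ssum_gtNy n m w; case: (Ssum n m w) => [a| |]//= _.
    by rewrite -EFinD !lee_fin; lra.
rewrite [X in _ && X](_ : _ = ((s - tau n w + t)%:E < Ssum n m.+1 w)%E)//.
have := Ssum_gtNy n m.+1 w; case: (Ssum n m.+1 w) => [a| |]//= _.
  by rewrite -EFinD !lte_fin; lra.
by rewrite !ltry.
Qed.

Lemma natural_filtration_measurable s :
  natural_filtration (X : R -> Omega -> state) s `<=` measurable.
Proof.
apply: smallest_sub; first exact: sigma_algebra_measurable.
move=> _ [u [A [_ mA ->]]]; rewrite -[X in measurable X]setTI.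
exact: measurable_process.
Qed.

(* Up to the [n]-th jump, the natural filtration only sees the first [n] steps
   of the chain and the first [n] holding times. *)
Lemma natural_filtration_hist s n G :
  natural_filtration (X : R -> Omega -> state) s G ->
  exists2 G', Hist n n G' & forall w, Epos w -> ev n s w -> (G w <-> G' w).
Proof.
pose Q (G : set Omega) := exists2 G', Hist n n G' &
  forall w, Epos w -> ev n s w -> (G w <-> G' w).
have mH (G' : set Omega) : measurable (G' : set (Ohist n n)) -> Hist n n G' by [].
(* The sets that coincide with one of [Hist n n] on the event form a sigma-algebra, so that only the
   generators remain. *)
suff : natural_filtration (X : R -> Omega -> state) s `<=` Q by apply.
apply: smallest_sub.
  split.
  - exists set0; last by [].
    by apply: mH; exact: measurable0.
  - move=> A [A' HA' AA']; exists (~` A').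
      by apply: mH; exact: measurableC.
    by move=> w Ew nw; rewrite setTD; split => h /(AA' w Ew nw).
  - move=> F QF; have /choice[F' F'P] : forall i, exists G', Hist n n G' /\
        forall w, Epos w -> ev n s w -> (F i w <-> G' w).
      by move=> i; have [G' HG' FG'] := QF i; exists G'.
    exists (\bigcup_i F' i).
      by apply: mH; apply: bigcupT_measurable => i; have [] := F'P i.
    move=> w Ew nw; split => -[i _] Fi; exists i => //; have [_ /(_ w Ew nw)h] := F'P i; exact/h.
move=> _ [u [A [/andP[u0 us] mA ->]]].
have mS k : (k <= n)%N -> measurable_fun setT (Ssum 0 k : Ohist n n -> \bar R).
  by move=> kn; apply: measurable_Ssum; rewrite add0n ?(leq_trans kn)//.
have mYk k : (k <= n)%N -> measurable (Y k @^-1` A : set (Ohist n n)).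
  move=> kn.
  have mYk := measurableT_comp (@measurable_chain_hist k n)
    (measurable_hist_sub kn (leqnn n)).
  by have := mYk measurableT A mA; rewrite setTI.
(* Since [u <= s] and the next jump comes after [s], the state at time [u] is [Y k] for the [k < n]
   determined by the jump times, or [Y n] from the [n]-th jump on. *)
exists (\bigcup_(k in `I_n) (ev k u `&` Y k @^-1` A) `|`
  ([set w | (Ssum 0 n w <= u%:E)%E] `&` Y n @^-1` A)).
  apply: mH; apply: measurableU.
    apply: bigcup_measurable => k kn; apply: measurableI; last by apply: mYk; exact: ltnW.
    rewrite (_ : ev k u = [set w | (Ssum 0 k w <= u%:E)%E] `&`
      [set w | (u%:E < Ssum 0 k.+1 w)%E]); last first.
      by apply/seteqP; split => w; [move=> /andP[]|move=> [? ?]; apply/andP].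
    apply: measurableI; rewrite -[X in measurable X]setTI.
      by apply: measurable_lee => //; by apply: mS; exact: ltnW.
    by apply: measurable_lte => //; exact: mS.
  apply: measurableI; last exact: mYk.
  by rewrite -[X in measurable X]setTI; apply: measurable_lee => //; exact: mS.
move=> w Ew nw; have /andP[ns sn] := nw.
have evn : (Ssum 0 n w <= u%:E)%E -> ev n u w.
  by move=> nu; apply/andP; split => //; apply: le_lt_trans sn; rewrite lee_fin.
split => /=; last first.
  move=> [[k kn [ku Yk]]|[nu Yn]]; first by rewrite (processE Ew ku).
  by rewrite (processE Ew (evn nu)).
have [nu|un] := leP (Ssum 0 n w) u%:E.
  by rewrite (processE Ew (evn nu)); right.
pose p N := (u%:E < Ssum 0 N w)%E.
have exN : exists N, p N by exists n.
have [k uk kmin] := ex_minnP exN; rewrite /p in uk kmin.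
have k0 : (0 < k)%N.
  by rewrite lt0n; apply/eqP => k0; move: uk; rewrite k0 Ssum0 lte_fin ltNge u0.
have ku : ev k.-1 u w.
  rewrite /window/= prednK// uk andbT leNgt; apply/negP => /kmin.
  by rewrite leqNgt prednK// leqnn.
rewrite (processE Ew ku) => Yk; left; exists k.-1 => //=.
by rewrite -ltnS prednK// ltnS kmin.
Qed.

Local Notation mass A g t := (jump_mass K rt A g t).

(** The memoryless property applies with [r] the time elapsed at [s] since the [n]-th jump, once [G]
    is replaced by a set of [Hist n n]. *)
Lemma markov_step s t n G (A : set state) : 0 <= s -> 0 <= t -> measurable A ->
  natural_filtration (X : R -> Omega -> state) s G ->
  P (G `&` X (s + t) @^-1` A `&` (Wgood `&` ev n s)) =
  (\int[P]_(w in G `&` (Wgood `&` ev n s)) mass A (X s w) t)%E.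
Proof.
move=> s0 t0 mA FG.
have mG := natural_filtration_measurable FG.
have [G1 HG1 GG1] := natural_filtration_hist n FG.
have mWn : measurable (Wgood `&` ev n s).
  by apply: measurableI; [exact: measurable_Wgood|exact: measurable_window].
have mXA : measurable (X (s + t) @^-1` A).
  by rewrite -[X in measurable X]setTI; exact: measurable_process.
pose r w := s - tau n w.
pose G2 := G1 `&` [set w | (Ssum 0 n w <= s%:E)%E].
pose G3 := G2 `&` [set w | rt (Y n w) * r w < E n w].
have mS : measurable_fun setT (Ssum 0 n : Ohist n n -> \bar R).
  by apply: measurable_Ssum.
have mr : measurable_fun setT (r : Ohist n n -> R).
  by apply: measurable_funB => //; exact: (measurableT_comp (fine_measurable measurableT) mS).
have HG2 : Hist n n G2.
  suff : measurable (G2 : set (Ohist n n)) by [].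
  apply: measurableI => //; rewrite -[X in measurable X]setTI.
  by apply: measurable_lee.
have mG3 : measurable G3.
  apply: measurableI; first exact: hist_measurable HG2.
  rewrite -[X in measurable X]setTI; apply: measurable_fun_ltr => //.
    apply: measurable_funM; first exact: (measurableT_comp measurable_rt (measurable_chain n)).
    exact: (measurable_sub_fun (@hist_gen_measurable n n) mr).
  exact: (measurable_E con).
have r0 w : G2 w -> 0 <= r w.
  by move=> [_ /= ns]; rewrite subr_ge0 -lee_fin -(tauE ns).
(* [G3] isolates the requirement on [E n], the only one not in [Hist n n]. *)
have evG3 w : Epos w -> G w /\ ev n s w <-> G3 w.
  move=> Ew; have key : (Ssum 0 n w <= s%:E)%E ->
      (s%:E < Ssum 0 n.+1 w)%E = (rt (Y n w) * r w < E n w).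
    move=> ns; rewrite -hold_gt// -addn1 Ssum_cat SsumS Ssum0 adde0 (tauE ns).
    rewrite /r; have := hold_gtNy n w; case: (hold n w) => [a| |]//= _.
      by rewrite -EFinD !lte_fin ltrBlDl.
    by rewrite !ltry.
  split => [[Gw nw]|[[G1w ns] rE]].
    have /andP[ns sn] := nw.
    by split; [split => //; exact/(GG1 w Ew nw)|rewrite /= -key].
  have nw : ev n s w by apply/andP; split => //; rewrite key.
  by split => //; exact/(GG1 w Ew nw).
(* Decomposition by the number [m] of jumps between [s] and [s + t]. *)
transitivity (\sum_(m <oo) \int[P]_(w in G3) js m A (Y n w) t)%E.
  rewrite (total_probability (n := n) (s := s + t)); last 2 first.
  - by apply: measurableI => //; exact: measurableI.
  - move=> w [_ [_ /andP[ns _]]]; apply: le_trans ns _.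
    by rewrite lee_fin lerDl.
  apply: eq_eseriesr => m _.
  rewrite -(window_memoryless m HG2 mr r0 t0 mA).
  have mrT : measurable_fun setT r.
    exact: (measurable_sub_fun (@hist_gen_measurable n n) mr).
  apply: (eq_probability_conull measurable_Wgood null_WgoodC).
  - apply: measurableI; first by apply: measurableI => //; exact: measurableI.
    by apply: measurableI; [exact: measurable_Wgood|exact: measurable_window].
  - apply: measurableI; last exact: measurable_chain_preimage.
    by apply: measurableI => //; apply: measurable_window; exact: measurable_funD.
  - apply/seteqP; split => w.
      move=> [[[[Gw Xw] [_ nw]] [_ mw]] Ww]; have [Ew _] := Ww.
      have /andP[ns _] := nw.
      split => //; split; last by rewrite /= -(processE Ew mw).
      by split; [apply/evG3|apply/(window_split m t ns)].
    move=> [[[G3w mw] Yw] Ww]; have [Ew _] := Ww.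
    have [Gw nw] := (evG3 w Ew).2 G3w.
    have /andP[ns _] := nw.
    have nmw := (window_split m t ns).2 mw.
    do !split => //.
    by rewrite /= (processE Ew nmw).
have mj m : measurable_fun setT (fun w => js m A (Y n w) t).
  exact: (measurableT_comp (measurable_jumps_first K rt_ge0 measurable_rt m t mA)
    (measurable_chain n)).
transitivity (\int[P]_(w in G3) mass A (Y n w) t)%E.
  apply/esym.
  apply: (@integral_nneseries _ _ _ P G3 mG3 (fun m w => js m A (Y n w) t)).
  - by move=> m; apply: measurable_funTS; exact: mj.
  - by move=> m w _; exact: jumps_ge0.
have mmass : measurable_fun setT (fun w => mass A (Y n w) t).
  exact: (measurableT_comp (measurable_jump_mass K rt_ge0 measurable_rt t mA)
    (measurable_chain n)).
transitivity (\int[P]_(w in G3 `\` ~` Wgood) mass A (Y n w) t)%E.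
  apply: (@ge0_negligible_integral _ _ _ P G3 (~` Wgood)
    (fun w => mass A (Y n w) t)).
  - by apply: measurableC; exact: measurable_Wgood.
  - exact: mG3.
  - by apply: measurable_funTS; exact: mmass.
  - by move=> w _; exact: (jump_mass_ge0 K rt A (Y n w) t).
  - exact: null_WgoodC.
rewrite (_ : G3 `\` ~` Wgood = G `&` (Wgood `&` ev n s)); last first.
  rewrite setDE setCK; apply/seteqP; split => w.
    by move=> [G3w Ww]; have [Ew _] := Ww; have [? ?] := (evG3 w Ew).2 G3w.
  by move=> [Gw [Ww nw]]; have [Ew _] := Ww; split => //; apply/evG3.
apply: eq_integral => w; rewrite inE => -[_ [[Ew _] nw]].
by rewrite (processE Ew nw).
Qed.

Lemma markov_mass s t G (A : set state) : 0 <= s -> 0 <= t -> measurable A ->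
  natural_filtration (X : R -> Omega -> state) s G ->
  P (G `&` X (s + t) @^-1` A) = (\int[P]_(w in G) mass A (X s w) t)%E.
Proof.
move=> s0 t0 mA FG; have mG := natural_filtration_measurable FG.
have mXA : measurable (X (s + t) @^-1` A).
  by rewrite -[X in measurable X]setTI; exact: measurable_process.
rewrite (total_probability (n := 0%N) (s := s)); last 2 first.
- exact: measurableI.
- by move=> w _; rewrite Ssum0 lee_fin.
rewrite (total_integral s0 mG); last 2 first.
- exact: (measurableT_comp (measurable_jump_mass K rt_ge0 measurable_rt t mA)
    (@measurable_process s)).
- by move=> w; exact: jump_mass_ge0.
by apply: eq_eseriesr => n _; exact: markov_step.
Qed.

Lemma markov_process (p : R -> R.-pker state ~> state) :
  (forall t g A, p t g A =
    mass A g t + (1 - mass setT g t) * (\1_A (cst 0 : state))%:E)%E ->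
  markov_chain P p (X : R -> Omega -> state).
Proof.
move=> pE; split; first by move=> t _; exact: measurable_process.
- move=> s t A s0 t0 mA; split.
    move=> B mB; rewrite -[X in natural_filtration _ _ X]setTI.
    have FXs D : measurable D ->
        natural_filtration (X : R -> Omega -> state) s (X s @^-1` D).
      move=> mD; apply: sub_sigma_algebra; exists s, D; split => //.
      by rewrite s0 lexx.
    rewrite setTI -[_ @^-1` B]/(X s @^-1` ((fun g => p t g A) @^-1` B)).
    apply: FXs; rewrite -[X in measurable X]setTI.
    exact: (measurable_kernel (p t) _ mA).
  move=> G FG; have mG := natural_filtration_measurable FG.
  under eq_integral do rewrite pE.
  have mmass D : measurable D -> measurable_fun setT (fun w => mass D (X s w) t).
    move=> mD; exact: (measurableT_comp (measurable_jump_mass K rt_ge0 measurable_rt t mD)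
      (@measurable_process s)).
  have mfin g : mass setT g t \is a fin_num.
    rewrite ge0_fin_numE; last exact: jump_mass_ge0.
    exact: le_lt_trans (jump_mass_le1 K rt_ge0 measurable_rt g t) (ltry 1).
  have defect0 g : (0 <= 1 - mass setT g t)%E.
    by rewrite sube_ge0 ?(jump_mass_le1 K rt_ge0 measurable_rt g t)// mfin.
  have mdefect : measurable_fun setT (fun w => 1 - mass setT (X s w) t)%E.
    by apply: emeasurable_funB => //; exact: mmass.
  (* The Markov identity for the full state space says that the mass has integral [P G] over [G];
     the mass moved to the null function thus contributes nothing. *)
  have no_defect : (\int[P]_(w in G) (1 - mass setT (X s w) t) = 0)%E.
    have := markov_mass s0 t0 (@measurableT _ state) FG.
    rewrite preimage_setT setIT => PG.
    have PGf : P G \is a fin_num by rewrite fin_num_measure.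
    have : (P G = P G + \int[P]_(w in G) (1 - mass setT (X s w) t))%E.
      rewrite {2}PG -ge0_integralD//.
      - rewrite (eq_integral (cst 1%E)) ?integral_cst ?mul1e// => w _.
        by rewrite addeC subeK.
      - by move=> w _; exact: jump_mass_ge0.
      - by apply: measurable_funTS; exact: mmass.
      - exact: measurable_funTS.
    move: (\int[P]_(w in G) _)%E => y; rewrite -(fineK PGf).
    case: y => [y| |]//; rewrite -EFinD => -[] h.
    by congr EFin; lra.
  rewrite ge0_integralD; [|exact: mG|by move=> w _; exact: jump_mass_ge0|
    by apply: measurable_funTS; exact: mmass|by move=> w _; rewrite mule_ge0// lee_fin|
    by apply: measurable_funTS; exact: emeasurable_funM].
  rewrite ge0_integralZr; [|exact: mG|exact: measurable_funTS|by []|by rewrite lee_fin].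
  by rewrite no_defect mul0e adde0; exact: markov_mass.
- exact: ae_right_continuous.
Qed.

(** * Generator *)

Lemma E_le i (a : R) : 0 <= a -> P (E i @^-1` `]-oo, a]) = (1 - expR (- a))%:E.
Proof. by move=> a0; rewrite (law_E con)// -expoE expo_le. Qed.

Section generator_estimate.
Variables (n : nat) (psi : n.-tuple 'rV[R]_d -> R).
Hypothesis ipsi : (power_measure (@lebesgue_rV R d) (n:=n)).-integrable setT (EFin \o psi).
Local Notation J := (test_fun psi).
Local Notation M := (test_bound psi).
Local Notation h := (@shifted_test_fun R d rad U n psi).

(** Bounds the rates of both [Y 0] and [Y 1]. *)
Let q := cap 1.
Let D t : set Omega := E 0 @^-1` `]-oo, rt f * t].
(** Two jumps before [t] force both holding times to be at most [t], hence almost surely this event,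
    which no longer involves the chain. *)
Let S t : set Omega := E 0 @^-1` `]-oo, q * t] `&` E 1 @^-1` `]-oo, q * t].

Let mD t : measurable (D t).
Proof. exact: measurable_E_preimage. Qed.

Let mS t : measurable (S t).
Proof. by apply: measurableI; exact: measurable_E_preimage. Qed.

Let P_D t : 0 < t -> P (D t) = (1 - expR (- (rt f * t)))%:E.
Proof. by move=> t0; rewrite E_le// mulr_ge0 ?rt_ge0// ltW. Qed.

Let P_S t : 0 < t -> (P (S t) <= ((q * t) ^+ 2)%:E)%E.
Proof.
move=> t0; have qt0 : 0 <= q * t by rewrite mulr_ge0 ?ltW ?cap_gt0.
rewrite (@hist_E_indep 0 1); last 2 first.
- by apply: sub_sigma_algebra; exact: E_hist_gen.
- exact: measurable_itv.
rewrite E_le// expo_le// -EFinM lee_fin expr2.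
have u0 : 0 <= 1 - expR (- (q * t)) by rewrite subr_ge0 -expR0 ler_expR oppr_le0.
by have := expR_ge1Dx (- (q * t)) => u1; apply: ler_pM => //; lra.
Qed.

Let process0 w : Wgood w -> X 0 w = f.
Proof.
move=> [Ew _]; rewrite (@processE 0)// /window/= Ssum0 lexx/=.
by rewrite SsumS Ssum0 adde0 hold_gt0.
Qed.

Let gain w := J (Y 1 w) - J f.

(** The left-hand side is 0 when at most one jump has occurred. Otherwise two bounded values are
    compared and [2 * M] would do; [4 * M] also covers the crude bound used off the good event. *)
Let one_jump_approx t w : Wgood w -> 0 < t ->
  `|J (X t w) - J (X 0 w) - gain w * \1_(D t) w| <= 4 * M * \1_(S t) w.
Proof.
move=> Ww t0; have [Ew _] := Ww; rewrite process0//.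
have JM w' : `|J (Y 1 w')| <= M by apply: test_fun_bounded => //; exact: Sc_chain.
have M0 := test_bound_ge0 psi.
have [tT|Tt] := ltP t%:E (Ssum 0 1 w).
  rewrite (@processE 0)//; last by rewrite /window/= Ssum0 lee_fin ltW.
  move: tT; rewrite SsumS Ssum0 adde0 hold_gt// => tT.
  rewrite indicE (_ : (w \in D t) = false) ?mulr0 ?subrr ?normr0 ?mulr_ge0//.
  by apply/negbTE/negP; rewrite inE /D /= in_itv/= leNgt tT.
have E0 : E 0 w <= rt f * t.
  by move: Tt; rewrite SsumS Ssum0 adde0 leNgt hold_gt// -leNgt.
rewrite [\1_(D t) w]indicE mem_set /=; last by rewrite /D /= in_itv.
rewrite mulr1 /gain opprB addrA subrK.
have [tT2|T2t] := ltP t%:E (Ssum 0 2 w).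
  by rewrite (@processE 1)// ?subrr ?normr0 ?mulr_ge0//; apply/andP.
have rf : rt f <= q.
  apply: (le_trans (rt_chain_le 0 w)).
  by rewrite lerD2r lerD2l ler_wpM2r ?rate_jump_ge0 ?ler_nat.
have E1 : E 1 w <= rt (Y 1 w) * t.
  rewrite leNgt -hold_gt//; apply/negP => tE.
  have := lt_le_trans tE (le_trans _ T2t); rewrite !SsumS Ssum0 adde0 ltxx.
  by move=> /(_ (leeDr _ (ltW (hold_gt0 _ Ew)))).
rewrite [\1_(S t) w]indicE mem_set /=; last first.
  rewrite /S; split; rewrite /= in_itv/=.
    by apply: le_trans E0 _; rewrite ler_wpM2r// ltW.
  by apply: le_trans E1 _; rewrite ler_wpM2r ?rt_chain_le// ltW.
rewrite mulr1; apply: (le_trans (ler_normB _ _)).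
have := JM w; have : `|J (X t w)| <= M by apply: test_fun_bounded => //; exact: Sc_process.
lra.
Qed.
Let bounded_integrable (u : Omega -> R) (B : R) : measurable_fun setT u ->
  (forall w, `|u w| <= B) -> P.-integrable setT (EFin \o u).
Proof.
move=> mu uB; apply: measurable_bounded_integrable => //.
  by apply: (le_lt_trans (probability_le1 P measurableT)); exact: ltry.
exists B; split; first exact: num_real.
by move=> x Bx w _; apply: (le_trans (uB w)); exact: ltW.
Qed.

Let measurable_JX t : measurable_fun setT (fun w => J (X t w)).
Proof.
have mJ : measurable_fun setT (J : state -> R) by exact: measurable_test_fun.
exact: (measurableT_comp mJ (@measurable_process t)).
Qed.

Let measurable_JY k : measurable_fun setT (fun w => J (Y k w)).
Proof.
have mJ : measurable_fun setT (J : state -> R) by exact: measurable_test_fun.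
exact: (measurableT_comp mJ (@measurable_chain k)).
Qed.

(** Mean change of the test function at the first jump, the shift by [M] being removed. *)
Let kappa := fine (step h f) - (J f + M).

Let JX_le t w : `|J (X t w)| <= M.
Proof. by apply: test_fun_bounded => //; exact: Sc_process. Qed.

Let gain_le w : `|gain w| <= 2 * M.
Proof.
apply: (le_trans (ler_normB _ _)); rewrite mulr2n mulrDl !mul1r.
by rewrite lerD// test_fun_bounded//; exact: Sc_chain.
Qed.

Let gain_ind_le t w : `|gain w * \1_(D t) w| <= 2 * M.
Proof.
rewrite normrM; apply: le_trans (gain_le w); rewrite ler_piMr//.
by rewrite indicE; case: (w \in _); rewrite ?normr1 ?normr0.
Qed.

Let measurable_gain_ind t : measurable_fun setT (fun w => gain w * \1_(D t) w).
Proof.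
apply: measurable_funM => //; apply: measurable_funB => //; exact: measurable_JY.
Qed.

(** [D t] depends on [E 0] alone and the gain on the chain alone, so the mean is the product of
    [P (D t)] and [kappa]. *)
Let integral_gain t : 0 < t ->
  \int[P]_w (gain w * \1_(D t) w) = (1 - expR (- (rt f * t))) * kappa.
Proof.
move=> t0.
have hint : (\int[P]_(w in D t) h (Y 1 w) = P (D t) * step h f)%E.
  rewrite (@integral_independent _ Omega R P (past 1)
    (\bigcup_n preimage_set_system setT (E n) measurable))//.
  - rewrite integral_chain_step//; last 3 first.
    + exact: past_setT.
    + exact: shifted_test_fun_ge0.
    + exact: measurable_shifted_test_fun.
    congr (_ * _)%E; rewrite (eq_integral (cst (step h f)))// integral_cst//.
    rewrite -[RHS]mule1; congr (_ * _)%E; exact: probability_setT.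
  - by move=> G /past_measurable.
  - by move=> _ [i _ [B mB <-]]; rewrite setTI; exact: measurable_E_preimage.
  - move=> D1 D2 nD1 eD2; apply: (indep_E_chain con) => //.
    apply: sub_sigma_algebra; exists 1%N => //.
    by rewrite -measurable_pastE.
  - have mh : measurable_fun setT (h : state -> \bar R).
      exact: measurable_shifted_test_fun.
    exact: (measurableT_comp mh (@measurable_chain_past 1)).
  - by move=> w; exact: shifted_test_fun_ge0.
  - apply: sub_sigma_algebra; exists 0%N => //; exists `]-oo, (rt f * t)]%classic => //.
    by rewrite setTI.
have iD (u : Omega -> R) B : measurable_fun setT u -> (forall w, `|u w| <= B) ->
    P.-integrable (D t) (EFin \o u).
  move=> mu uB; apply: integrableS (bounded_integrable mu uB) => //.
transitivity (\int[P]_(w in D t) (J (Y 1 w) + M - (J f + M))).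
  rewrite [RHS]Rintegral_mkcond; apply: eq_Rintegral => w _.
  rewrite patchE indicE /gain; case: ifP => _; rewrite ?mulr0// mulr1.
  by rewrite opprD addrACA subrr addr0.
have M0 := test_bound_ge0 psi.
rewrite RintegralB//; last 2 first.
- apply: (@iD _ (2 * M)); first by apply: measurable_funD => //; exact: measurable_JY.
  move=> w; apply: (le_trans (ler_normD _ _)); rewrite mulr2n mulrDl !mul1r.
  by rewrite lerD ?(ger0_norm M0)// test_fun_bounded//; exact: Sc_chain.
- by apply: (@iD _ `|J f + M|) => // w; exact: measurable_cst.
rewrite Rintegral_cst// /kappa mulrBr; congr (_ - _).
  rewrite /Rintegral; under eq_integral do
    rewrite -(shifted_test_funE rad U ipsi (Sc_chain _ _)).
  rewrite hint P_D// fineZl//.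
by rewrite mulrC; congr (_ * _); exact: (congr1 fine (P_D t0)).
Qed.

Lemma generator_estimate : exists B : R, forall t, 0 < t ->
  `|fine 'E_P[fun w => J (X t w) - J (X 0 w)] - rt f * kappa * t| <= B * t ^+ 2.
Proof.
(* The first term comes from two jumps before [t], the second from replacing the probability of
   [D t] by [rt f * t]. *)
exists (4 * M * q ^+ 2 + `|kappa| * rt f ^+ 2) => t t0.
have M0 := test_bound_ge0 psi.
rewrite unlock -/(Rintegral P setT (fun w => J (X t w) - J (X 0 w))).
pose Z' w := J (X t w) - J (X 0 w).
have mZ : measurable_fun setT Z' by apply: measurable_funB.
have Z_le w : `|Z' w| <= 2 * M.
  by apply: (le_trans (ler_normB _ _)); rewrite mulr2n mulrDl !mul1r lerD.
have iZ := bounded_integrable mZ Z_le.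
have iG := bounded_integrable (measurable_gain_ind t) (gain_ind_le t).
have iZG : P.-integrable setT (EFin \o (fun w => Z' w - gain w * \1_(D t) w)).
  apply: (@bounded_integrable _ (4 * M)); first exact: measurable_funB.
  move=> w; apply: (le_trans (ler_normB _ _)).
  by have := Z_le w; have := gain_ind_le t w; lra.
have b1 : `|\int[P]_w Z' w - \int[P]_w (gain w * \1_(D t) w)| <= 4 * M * (q * t) ^+ 2.
  rewrite -RintegralB//; apply: (le_trans (le_normr_Rintegral _ iZG)) => //.
  (* With the exceptional null set added, the bound holds at every point. *)
  pose S' := S t `|` ~` Wgood.
  have mS' : measurable S' by apply: measurableU => //; exact/measurableC/measurable_Wgood.
  apply: (@le_trans _ _ (\int[P]_w (4 * M * \1_S' w))).
    apply: le_Rintegral => //; first exact: (integrable_norm iZG).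
      apply: (@bounded_integrable _ (4 * M)); first exact: measurable_funM.
      move=> w; rewrite indicE; case: (w \in _); rewrite ?mulr1 ?mulr0 ?normr0 ?mulr_ge0//.
      by rewrite ger0_norm// mulr_ge0.
    move=> w _; have [Ww|Ww] := pselect (Wgood w).
      apply: (le_trans (one_jump_approx Ww t0)); rewrite ler_wpM2l ?mulr_ge0//.
      rewrite !indicE ler_nat; case: (boolP (w \in S t)) => //.
      by rewrite inE => wS; have -> : w \in S' by apply: mem_set; left.
    rewrite [\1_S' w]indicE mem_set; last by right.
    rewrite mulr1; apply: (le_trans (ler_normB _ _)).
    by have := Z_le w; have := gain_ind_le t w; lra.
  rewrite RintegralZl//; last first.
    apply: (@bounded_integrable _ 1) => // w.
    by rewrite indicE; case: (w \in _); rewrite ?normr1 ?normr0.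
  rewrite ler_wpM2l ?mulr_ge0// /Rintegral integral_indic// setIT.
  rewrite -lee_fin fineK ?fin_num_measure//.
  apply: le_trans (P_S t0); apply: (le_trans (measureU2 _ _ _)) => //.
    exact/measurableC/measurable_Wgood.
  by rewrite [X in (_ + X <= _)%E]null_WgoodC adde0.
have b2 : `|(1 - expR (- (rt f * t))) * kappa - rt f * kappa * t| <= `|kappa| * (rt f * t) ^+ 2.
  have -> : (1 - expR (- (rt f * t))) * kappa - rt f * kappa * t =
    kappa * (1 - expR (- (rt f * t)) - rt f * t) by ring.
  rewrite normrM ler_wpM2l//.
  have x0 : 0 <= rt f * t by rewrite mulr_ge0 ?rt_ge0 ?ltW.
  have := expR_ge1Dx (- (rt f * t)); have := expR_ge1Dx (rt f * t).
  have := expR_gt0 (- (rt f * t)); have : expR (- (rt f * t)) * expR (rt f * t) = 1.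
    by rewrite -expRD addNr expR0.
  move: (expR (- (rt f * t))) (expR (rt f * t)) x0 => a b; move: (rt f * t) => x x0 ab a0 b1' a1.
  rewrite ler_norml; apply/andP; split; last by nra.
  (* Hence [a], the exponential of [- x], is at most [1 - x + x ^+ 2], because
     [(1 + x) * (1 - x + x ^+ 2)] is [1 + x ^+ 3]. *)
  have : a * (1 + x) <= 1 by rewrite -[leRHS]ab ler_wpM2l// ltW.
  by nra.
rewrite -(subrKA (\int[P]_w (gain w * \1_(D t) w))); apply: (le_trans (ler_normD _ _)).
rewrite mulrDl lerD//; first by apply: (le_trans b1); rewrite exprMn mulrA.
by rewrite integral_gain//; apply: (le_trans b2); rewrite exprMn mulrA.
Qed.

Lemma generator_cvg :
  fine 'E_P[fun w => J (X t w) - J (X 0 w)] / t @[t --> 0^'+] --> rt f * kappa.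
Proof.
have [B BP] := generator_estimate.
apply/cvgrPdist_le => e e0; near=> t.
have t0 : 0 < t by near: t; exact: nbhs_right_gt.
have B1 : 0 < `|B| + 1 by rewrite ltr_wpDl.
have te : t <= e / (`|B| + 1) by near: t; apply: nbhs_right_le; rewrite divr_gt0.
have tn0 : t != 0 by rewrite gt_eqF.
rewrite distrC -[X in `|_ - X|](mulfK tn0).
rewrite -mulrBl normrM normfV (gtr0_norm t0) ler_pdivrMr//.
apply: (le_trans (BP _ t0)); rewrite expr2 mulrA; apply: (ler_wpM2r (ltW t0)).
apply: (@le_trans _ _ ((`|B| + 1) * t)); last by rewrite mulrC -ler_pdivlMr.
apply: (ler_wpM2r (ltW t0)).
apply: (le_trans (ler_norm _)).
by rewrite lerDl.
Unshelve. all: by end_near. Qed.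
End generator_estimate.
End chain_law.

Theorem proposition5p3 (R : realType) (d : nat) (rad U : R) :
  (0 < d)%N -> 0 < rad -> 0 < U < 1 ->
  (exists p : R -> R.-pker (@state R d rad U) ~> (@state R d rad U),
    forall f : 'rV[R]_d -> R, Sc f ->
    forall (dO : measure_display) (Omega : measurableType dO)
      (P : probability Omega R) (c0 : 'rV[R]_d)
      (C : nat -> Omega -> 'rV[R]_d) (V E : nat -> Omega -> R),
    slfv_construction rad U P f C V E c0 ->
    [/\ non_explosive rad U P f C V E,
        forall t w, 0 <= t -> Sc (process rad U f C V E t w) &
        markov_chain P p (process rad U f C V E)]) /\
  (forall (n : nat) (psi : n.-tuple 'rV[R]_d -> R), (0 < n)%N ->
    (power_measure (@lebesgue_rV R d) (n:=n)).-integrable setT (EFin \o psi) ->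
    forall f : 'rV[R]_d -> R, Sc f ->
    forall (dO : measure_display) (Omega : measurableType dO)
      (P : probability Omega R) (c0 : 'rV[R]_d)
      (C : nat -> Omega -> 'rV[R]_d) (V E : nat -> Omega -> R),
    slfv_construction rad U P f C V E c0 ->
    fine ('E_P[fun w => test_fun psi (process rad U f C V E t w)
                        - test_fun psi (process rad U f C V E 0 w)]) / t
      @[t --> 0^'+] -->
    \int[@lebesgue_rV R d]_c \int[power_measure (@lebesgue_rV R d) (n:=n)]_x
      ((\sum_(I : {set 'I_n})
         (\prod_(j in ~: I) (\1_(~` eball c rad) (tnth x j) * f (tnth x j)))
         * (\prod_(i in I) \1_(eball c rad) (tnth x i))
         * (f c * (\prod_(i in I) ((1 - U) * f (tnth x i) + U)
                   - \prod_(i in I) f (tnth x i))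
            + (1 - f c) * (\prod_(i in I) ((1 - U) * f (tnth x i))
                           - \prod_(i in I) f (tnth x i))))
       * psi x)).
Proof.
move=> _ rad0 U01; split.
  have [K KE] := @step_kernel R d rad U rad0 U01.
  (* Built from [K] and the rate alone, so the same [p] serves all initial states and probability
     spaces. *)
  have /choice[p pE] := @jump_kernel_ex _ (@state R d rad U) R K
    (fun g => fine (rate rad g)) (cst 0) (@rt_ge0 R d rad U) (measurable_rt U01).
  exists p => f Sf dO Omega P c0 C V E con; split.
  - exact: (non_explosion rad0 U01 Sf con).
  - by move=> t w _; exact: (Sc_process rad U01 Sf).
  - exact: (markov_process rad0 U01 Sf con KE pE).
move=> n psi _ ipsi f Sf dO Omega P c0 C V E con.
under [X in _ --> X]eq_Rintegral do rewrite generator_integrand//.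
rewrite (Rintegral_jump_gain rad0 U01 ipsi Sf).
exact: (generator_cvg rad0 U01 Sf con ipsi).
Qed.
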